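(* Let $M$ be an $(A_n,\mathfrak L(\mathfrak g,X_n))$-module such that $\sigma_X(y)=0$ on $M$ for all $y\in\mathfrak L(\mathfrak g,X_n)_{\ge1}$. Assume in addition that $M$ is completely reducible as a module over $\mathfrak L(\mathfrak g,X_n)_0$ via $\sigma_X$, and that none of its irreducible components is isomorphic to $L^0_X(0,\mu_k,\mathbf 0)$ for any $0\le k\le n_X$. Then every $\rho_X$-submodule $M'$ of $M$ (i.e. every subspace stable under $\rho_X(\mathfrak L(\mathfrak g,X_n))$) is an $(A_n,\mathfrak L(\mathfrak g,X_n))$-submodule, i.e. is also stable under $A_n$ and under $\sigma_X(\mathfrak L(\mathfrak g,X_n)_{\ge0})$.
   Context: The base field is $\mathbb C$ and $\mathbb N=\{0,1,2,\dots\}$. $\mathfrak g$ is a finite-dimensional simple Lie algebra. $n\ge 2$, $A_n=\mathbb C[t_1,\dots,t_n]$, $d_i=\partial/\partial t_i$, $d^\alpha=d_1^{\alpha_1}\cdots d_n^{\alpha_n}$, $|\alpha|=\sum\alpha_i$, $\alpha!=\prod\alpha_i!$ for $\alpha\in\mathbb N^n$. $W_n=\mathrm{Der}(A_n)=\bigoplus_i A_n d_i$; $S_n=\{\sum_i g_id_i\in W_n:\sum_i d_i(g_i)=0\}$, which is spanned by the elements $d_{ij}(f)=d_j(f)d_i-d_i(f)d_j$ ($i<j$, $f\in A_n$); and, when $n=2m$, $H_n=\{d_H(f):f\in A_n\}$ with $d_H(f)=\sum_{j=1}^m d_j(f)d_{m+j}-\sum_{j=m+1}^{2m}d_j(f)d_{j-m}$.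 $X_n$ denotes one of $W_n,S_n,H_n$ (with $n=2m$ if $X_n=H_n$), and the subscript $X$ is $W,S,H$ accordingly. $\mathfrak L(\mathfrak g,X_n)=(\mathfrak g\otimes A_n\oplus\mathcal Z)\rtimes X_n$, where $\mathcal Z$ has basis $\{t^rK_i:r\in\mathbb N^n,1\le i\le n\}$, $[x\otimes f,y\otimes g]=[x,y]\otimes fg$, $\mathcal Z$ is abelian and commutes with $\mathfrak g\otimes A_n$, and $[D,x\otimes f]=x\otimes D(f)$, $[D,fK_j]=D(f)K_j$ for $D\in X_n$. It is $\mathbb Z$-graded: for homogeneous $f$, $x\otimes f$ and $fK_j$ have degree $\deg f$, and $fd_j$ has degree $\deg f-1$. $\mathfrak L(\mathfrak g,X_n)_{\ge k}$ is the sum of the components of degree $\ge k$. $\mathfrak L(\mathfrak g,X_n)_0=\mathfrak g\oplus(X_n)_0\oplus\mathrm{span}\{K_1,\dots,K_n\}$, where $(X_n)_0\cong\mathfrak{gl}_n,\mathfrak{sl}_n,\mathfrak{sp}_n$ for $X=W,S,H$ (via $t_id_j\mapsto E_{ij}$). An $(A_n,\mathfrak L(\mathfrak g,X_n))$-module is a vector space $M$ with an $A_n$-module structure ($f\in A_n$ acting by the operator $f_{A_n}$), an $\mathfrak L(\mathfrak g,X_n)$-module structure $\rho_X$, and an $\mathfrak L(\mathfrak g,X_n)_{\ge0}$-module structure $\sigma_X$ such that: (I) $[\rho_X(Y),f_{A_n}]=(Y(f))_{A_n}$ for $Y\in X_n$, and $[\rho_X(z),f_{A_n}]=0$ for $z\in\mathfrak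 g\otimes A_n\oplus\mathcal Z$, $f\in A_n$; (II) $[\sigma_X(D'),f_{A_n}]=0$ for $D'\in\mathfrak L(\mathfrak g,X_n)_{\ge0}$, $f\in A_n$; (III) $[\rho_X(d_i),\sigma_X(D')]=0$ for $D'\in\mathfrak L(\mathfrak g,X_n)_{\ge0}$, $1\le i\le n$; (IV) $\rho_X(x\otimes f)=\sigma_X(x)\circ f_{A_n}$ and $\rho_X(fK_j)=\sigma_X(K_j)\circ f_{A_n}$ for $x\in\mathfrak g$, $f\in A_n$, $1\le j\le n$; and for all $f\in A_n$: if $X=W$: $\rho_W(fd_j)=f_{A_n}\rho_W(d_j)+\sum_{i=1}^n(d_if)_{A_n}\sigma_W(t_id_j)$ for all $j$; if $X=S$: $\rho_S(d_{ij}(f))=(d_jf)_{A_n}\rho_S(d_i)-(d_if)_{A_n}\rho_S(d_j)+\sum_{|\alpha|=2}\frac1{\alpha!}(d^\alpha f)_{A_n}\sigma_S(d_{ij}(t^\alpha))$ for all $i<j$; if $X=H$: $\rho_H(d_H(f))=\sum_{j=1}^m(d_jf)_{A_n}\rho_H(d_{m+j})-\sum_{j=m+1}^{2m}(d_jf)_{A_n}\rho_H(d_{j-m})+\sum_{|\alpha|=2}\frac1{\alpha!}(d^\alpha f)_{A_n}\sigma_H(d_H(t^\alpha))$. Exceptional modules: $n_X=n,\,n-1,\,m$ for $X=W,S,H$. $\mathfrak h_X$ is the diagonal Cartan subalgebra of $(X_n)_0$ (its intersection with $\mathrm{span}\{t_id_i\}$). $\epsilon_j$ is the linear functional with $\epsilon_j(t_id_i)=\delta_{ij}$,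 restricted to $\mathfrak h_X$; $\mu_0=0$, $\mu_k=\epsilon_1+\cdots+\epsilon_k$ for $1\le k\le n_X$. Highest weights are taken with respect to positive root vectors $t_id_j$ ($i<j$) for $X=W,S$, and $t_id_j-t_{j+m}d_{i+m}$ ($1\le i<j\le m$), $t_sd_{k+m}+t_kd_{s+m}$ ($1\le k\le s\le m$) for $X=H$. $L^0_X(0,\mu_k,\mathbf 0)$ is the finite-dimensional irreducible $(X_n)_0$-module of highest weight $\mu_k$, viewed as an $\mathfrak L(\mathfrak g,X_n)_0$-module with $\mathfrak g$ and all $K_i$ acting by $0$. *)

(* Defs.v *)
From HB Require Import structures.
From mathcomp Require Import all_boot all_order all_algebra.
From mathcomp Require Import mpoly complex reals.

Set Implicit Arguments.
Unset Strict Implicit.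
Unset Printing Implicit Defensive.

Import Order.TTheory GRing.Theory Num.Theory.
Local Open Scope ring_scope.

(* Subspaces of a possibly infinite-dimensional space are Prop-valued
   predicates.  A module over a Lie subalgebra P of an ambient Lie algebra L is
   a family of operators indexed by L whose axioms are only required on P; the
   operators attached to elements outside P play no role. *)
Section LieModules.
Variable F : fieldType.

Record is_lie_bracket (L : lmodType F) (br : L -> L -> L) : Prop :=
  IsLieBracket {
  lie_linl : forall c x y z, br (c *: x + y) z = c *: br x z + br y z;
  lie_linr : forall c x y z, br z (c *: x + y) = c *: br z x + br z y;
  lie_alt : forall x, br x x = 0;
  lie_jacobi : forall x y z, br x (br y z) + br y (br z x) + br z (br x y) = 0
}.

Record is_simple_lie (g : vectType F) (br : g -> g -> g) : Prop := IsSimpleLie {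
  simple_lie_bracket : is_lie_bracket br;
  simple_nonabelian : exists x y, br x y <> 0;
  simple_ideals : forall I : {vspace g},
    (forall x y, y \in I -> br x y \in I) -> I = 0%VS \/ I = fullv
}.

Definition subspace (V : lmodType F) (U : V -> Prop) : Prop :=
  U 0 /\ forall c u v, U u -> U v -> U (c *: u + v).

Definition sum_subspaces (V : lmodType F) (I : Type) (Q : I -> Prop)
    (U : I -> V -> Prop) (v : V) : Prop :=
  exists r : seq V,
    (forall u, u \in r -> exists2 i, Q i & U i u) /\ v = \sum_(u <- r) u.

Section Modules.
Variables (L : lmodType F) (P : L -> Prop) (V : lmodType F).
Variable rho : L -> {linear V -> V}.

Record lie_module (br : L -> L -> L) : Prop := LieModule {
  lie_module_linear : forall c a b v, P a -> P b ->
    rho (c *: a + b) v = c *: rho a v + rho b v;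
  lie_module_bracket : forall a b v, P a -> P b ->
    rho (br a b) v = rho a (rho b v) - rho b (rho a v)
}.

Definition stable (U : V -> Prop) : Prop :=
  forall a v, P a -> U v -> U (rho a v).

Definition submodule (U : V -> Prop) : Prop := subspace U /\ stable U.

Definition irreducible_submodule (U : V -> Prop) : Prop :=
  [/\ submodule U,
      exists2 v, U v & v <> 0 &
      forall U' : V -> Prop, submodule U' -> (forall v, U' v -> U v) ->
        (forall v, U' v -> v = 0) \/ (forall v, U v -> U' v)].

Definition completely_reducible : Prop :=
  exists (I : Type) (U : I -> V -> Prop),
    [/\ forall i, irreducible_submodule (U i),
        forall v, sum_subspaces (fun=> True) U v &
        forall i v, U i v -> sum_subspaces (fun j => j <> i) U v -> v = 0].

End Modules.
End LieModules.

Section VectorFields.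
Variable F : fieldType.

(* The index is the number of variables; H_n only exists for n = m + m, and
   then the variables t_1, ..., t_m are indexed by lshift m i and
   t_(m+1), ..., t_(2m) by rshift m i. *)
Inductive cartan_type : nat -> Type :=
| typeW n : cartan_type n
| typeS n : cartan_type n
| typeH m : cartan_type (m + m).

Definition rankX n (X : cartan_type n) : nat :=
  match X with typeW n => n | typeS n => n.-1 | typeH m => m end.

(* D : vfield n stands for the derivation \sum_i (D i) d_i. *)
Definition vfield n := {ffun 'I_n -> {mpoly F[n]}}.

Definition vf_apply n (D : vfield n) (f : {mpoly F[n]}) : {mpoly F[n]} :=
  \sum_(i < n) D i * f^`M(i).

Definition vf_bracket n (D E : vfield n) : vfield n :=
  [ffun i => vf_apply D (E i) - vf_apply E (D i)].

(* f in position j: f d_j as a vector field, f K_j as an element of Z. *)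
Definition single n (f : {mpoly F[n]}) (j : 'I_n) :
    {ffun 'I_n -> {mpoly F[n]}} :=
  [ffun i => if i == j then f else 0].

Definition d_ij n (i j : 'I_n) (f : {mpoly F[n]}) : vfield n :=
  single f^`M(j) i - single f^`M(i) j.

Definition d_H m (f : {mpoly F[m + m]}) : vfield (m + m) :=
  \sum_(j < m) single f^`M(lshift m j) (rshift m j)
  - \sum_(j < m) single f^`M(rshift m j) (lshift m j).

Definition inX n (X : cartan_type n) : vfield n -> Prop :=
  match X in cartan_type n return vfield n -> Prop with
  | typeW _ => fun=> True
  | typeS n => fun D => \sum_(i < n) (D i)^`M(i) = 0
  | typeH _ => fun D => exists f, D = d_H f
  end.

Definition homogz n (d : int) (f : {mpoly F[n]}) : Prop :=
  forall m, m \in msupp f -> (mdeg m)%:Z = d.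

Definition inX0 n (X : cartan_type n) (D : vfield n) : Prop :=
  inX X D /\ forall i, homogz 1 (D i).

Definition cartanX n (X : cartan_type n) (D : vfield n) : Prop :=
  inX X D /\ exists c : 'I_n -> F, D = \sum_(i < n) c i *: single 'X_i i.

(* mu_k = epsilon_1 + ... + epsilon_k, epsilon_i reading off the coefficient
   of t_i d_i. *)
Definition mu n (k : nat) (D : vfield n) : F :=
  \sum_(i < n | (i < k)%N) (D i)@_U_(i).

Definition pos_root_vector n (X : cartan_type n) : vfield n -> Prop :=
  match X in cartan_type n return vfield n -> Prop with
  | typeW n => fun D => exists i j : 'I_n, (i < j)%N /\ D = single 'X_i j
  | typeS n => fun D => exists i j : 'I_n, (i < j)%N /\ D = single 'X_i j
  | typeH m => fun D =>
      (exists i j : 'I_m, (i < j)%N /\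
        D = single 'X_(lshift m i) (lshift m j)
            - single 'X_(rshift m j) (rshift m i)) \/
      (exists k s : 'I_m, (k <= s)%N /\
        D = single 'X_(lshift m s) (rshift m k)
            + single 'X_(lshift m k) (rshift m s))
  end.

Record irreducible_of_highest_weight_mu n (X : cartan_type n) (k : nat)
    (V : vectType F) (tau : vfield n -> {linear V -> V}) : Prop :=
  IrreducibleOfHighestWeightMu {
    hw_module : lie_module (inX0 X) tau (@vf_bracket n);
    hw_irreducible : irreducible_submodule (inX0 X) tau (fun=> True);
    hw_vector : exists v : V, [/\ v <> 0,
      forall D, pos_root_vector X D -> tau D v = 0 &
      forall D, cartanX X D -> tau D v = mu k D *: v]
  }.

End VectorFields.

Section FullToroidal.
Variables (F : fieldType) (g : vectType F) (brg : g -> g -> g) (n : nat).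

(* g (x) A_n in coordinates: u stands for \sum_i e_i (x) u_i, where e is the
   basis vbasis fullv of g. *)
Definition current := {ffun 'I_(\dim {:g}) -> {mpoly F[n]}}.

Definition pure_tensor (x : g) (f : {mpoly F[n]}) : current :=
  [ffun i => coord (vbasis {:g}) i x *: f].

Definition current_bracket (u v : current) : current :=
  \sum_(i < \dim {:g}) \sum_(j < \dim {:g})
    pure_tensor (brg (vbasis {:g})`_i (vbasis {:g})`_j) (u i * v j).

Definition central := {ffun 'I_n -> {mpoly F[n]}}.

(* The ambient algebra is L(g, W_n); (u, z, D) stands for u + z + D. *)
Definition toroidal := (current * central * vfield F n)%type.

Definition of_current (u : current) : toroidal := (u, 0, 0).
Definition of_central (z : central) : toroidal := (0, z, 0).
Definition of_vfield (D : vfield F n) : toroidal := (0, 0, D).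

Definition toroidal_bracket (a b : toroidal) : toroidal :=
  let: (u, z, D) := a in let: (u', z', D') := b in
  (current_bracket u u'
     + [ffun i => vf_apply D (u' i) - vf_apply D' (u i)],
   [ffun i => vf_apply D (z' i) - vf_apply D' (z i)],
   vf_bracket D D').

Variable X : cartan_type n.

Definition in_toroidal (a : toroidal) : Prop := inX X a.2.

Definition toroidal_deg (d : int) (a : toroidal) : Prop :=
  let: (u, z, D) := a in
  [/\ in_toroidal a, forall i, homogz d (u i), forall i, homogz d (z i) &
      forall i, homogz (d + 1) (D i)].

Definition toroidal_ge (k : int) : toroidal -> Prop :=
  sum_subspaces (fun d : int => k <= d) toroidal_deg.

(* tau a.2 is the action of a on V when g and the K_i act by 0. *)
Definition isomorphic_to_exceptional (M : lmodType F)
    (sigma : toroidal -> {linear M -> M}) (U : M -> Prop) (k : nat) : Prop :=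
  exists (V : vectType F) (tau : vfield F n -> {linear V -> V}),
    irreducible_of_highest_weight_mu X k tau /\
    exists phi : {linear V -> M}, [/\ injective phi,
      forall v, U v <-> exists w, v = phi w &
      forall a w, toroidal_deg 0 a -> phi (tau a.2 w) = sigma a (phi w)].

End FullToroidal.

Section AnLModules.
Variable F : fieldType.

Section Compatibility.
Variable M : lmodType F.

Definition mfactorial n (a : 'X_{1..n}) : nat := \prod_(i < n) (a i)`!.

Definition order2_term n (act : {mpoly F[n]} -> {linear M -> M})
    (sigma : vfield F n -> {linear M -> M})
    (delta : {mpoly F[n]} -> vfield F n) (f : {mpoly F[n]}) (v : M) : M :=
  \sum_(a : 'X_{1..n < 3} | mdeg a == 2%N)
    ((mfactorial a)%:R^-1 : F) *: act f^`M[a] (sigma (delta 'X_[a]) v).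

Definition vfield_compatible n (X : cartan_type n) :
    ({mpoly F[n]} -> {linear M -> M}) ->
    (vfield F n -> {linear M -> M}) -> (vfield F n -> {linear M -> M}) ->
    Prop :=
  match X in cartan_type n return
    ({mpoly F[n]} -> {linear M -> M}) ->
    (vfield F n -> {linear M -> M}) -> (vfield F n -> {linear M -> M}) -> Prop
  with
  | typeW n => fun act rho sigma =>
      forall (f : {mpoly F[n]}) (j : 'I_n) (v : M),
      rho (single f j) v =
        act f (rho (single 1 j) v)
        + \sum_(i < n) act f^`M(i) (sigma (single 'X_i j) v)
  | typeS n => fun act rho sigma =>
      forall (f : {mpoly F[n]}) (i j : 'I_n) (v : M),
      (i < j)%N ->
      rho (d_ij i j f) v =
        act f^`M(j) (rho (single 1 i) v) - act f^`M(i) (rho (single 1 j) v)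
        + order2_term act sigma (d_ij i j) f v
  | typeH m => fun act rho sigma =>
      forall (f : {mpoly F[m + m]}) (v : M),
      rho (d_H f) v =
        \sum_(j < m) act f^`M(lshift m j) (rho (single 1 (rshift m j)) v)
        - \sum_(j < m) act f^`M(rshift m j) (rho (single 1 (lshift m j)) v)
        + order2_term act sigma (@d_H F m) f v
  end.

End Compatibility.

Variables (g : vectType F) (brg : g -> g -> g) (n : nat) (X : cartan_type n).
Variables (M : lmodType F) (act : {mpoly F[n]} -> {linear M -> M}).
Variables rho sigma : toroidal g n -> {linear M -> M}.

Record AnL_module : Prop := AnLModule {
  act_linear : forall (c : F) (f h : {mpoly F[n]}) (v : M),
    act (c *: f + h) v = c *: act f v + act h v;
  act_one : forall v, act 1 v = v;
  act_mul : forall (f h : {mpoly F[n]}) (v : M),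
    act (f * h) v = act f (act h v);
  rho_module : lie_module (in_toroidal X) rho (@toroidal_bracket F g brg n);
  sigma_module : lie_module (toroidal_ge X 0) sigma
    (@toroidal_bracket F g brg n);
  rho_vfield_act : forall (D : vfield F n) (f : {mpoly F[n]}) (v : M),
    inX X D ->
    rho (of_vfield g D) (act f v) - act f (rho (of_vfield g D) v)
    = act (vf_apply D f) v;
  rho_current_act : forall (u : current g n) (z : central F n)
      (f : {mpoly F[n]}) (v : M),
    rho (u, z, 0) (act f v) - act f (rho (u, z, 0) v) = 0;
  sigma_act : forall (a : toroidal g n) (f : {mpoly F[n]}) (v : M),
    toroidal_ge X 0 a ->
    sigma a (act f v) - act f (sigma a v) = 0;
  rho_d_sigma : forall (i : 'I_n) (a : toroidal g n) (v : M),
    toroidal_ge X 0 a ->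
    rho (of_vfield g (single 1 i)) (sigma a v)
    - sigma a (rho (of_vfield g (single 1 i)) v) = 0;
  rho_tensor : forall (x : g) (f : {mpoly F[n]}) (v : M),
    rho (of_current (pure_tensor x f)) v
    = sigma (of_current (pure_tensor x 1)) (act f v);
  rho_central : forall (f : {mpoly F[n]}) (j : 'I_n) (v : M),
    rho (of_central g (single f j)) v
    = sigma (of_central g (single 1 j)) (act f v);
  rho_vfield : vfield_compatible X act
    (fun D => rho (of_vfield g D)) (fun D => sigma (of_vfield g D))
}.

End AnLModules.

(* Main.v *)
(* Let N be the largest A_n-stable subspace of M'; it is stable under rho and
   sigma, so it suffices to prove M' = N.  Multiplying two operators rho(D(p))
   and rho(D(q)), D being p |-> p d_j, d_ij or d_H, and taking an alternating
   sum over splittings of a power of a linear form x cancels all the terms of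
   low order in x and leaves f sigma(e)^2 (types S, H, with e a root vector of
   (X_n)_0) or f (delta_ij E_ij - E_ij^2) (type W).  Hence these quadratic
   elements map M' into N, as do sigma(g) and the sigma(K_i), and the set of
   all such operators is stable under commutators with sigma.  If M' <> N,
   semisimplicity therefore gives an irreducible sigma-submodule U of M on which
   they all vanish.  Every coroot h then satisfies h^3 = h on U and long words in
   generators of (X_n)_0 reduce to shorter ones, so U is finite-dimensional; its
   highest weight takes values in {0, 1} on the coroots involved, which makes
   it one of the mu_k: a contradiction. *)
Require Import Defs.
From HB Require Import structures.
From mathcomp Require Import all_boot all_order all_algebra.
From mathcomp Require Import mpoly complex reals.
From mathcomp Require Import boolp ring lra zify.

Set Implicit Arguments.
Unset Strict Implicit.
Unset Printing Implicit Defensive.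

Import Order.TTheory GRing.Theory Num.Theory.
Local Open Scope ring_scope.

(** [M'] is not known to be stable under sigma, so an operator mapping [M'] into [N] cannot simply
    be moved past sigma. The way out: in degree zero, sigma(D) = rho(D) - sum_k D_k rho(d_k), where
    D_k acts through A_n. An operator T that commutes with A_n and with the rho(d_k) can be pulled
    through the sum, so T sigma(D) maps [M'] into [N] even though sigma(D) may leave [M']. Hence the
    vectors sent into [N] by all such T form a sigma-submodule containing [M'], and U is chosen
    inside it, meeting [N] in 0. A priori U may have infinite dimension, whereas the excluded
    modules are finite-dimensional; the cubic relations serve to bridge this gap. In type H only the
    long root vectors come from squares of linear forms; the short ones are reached by polarization
    and by bounds on weights. *)

Section ModuleExpressions.
Variables (F : fieldType) (V : lmodType F).

Inductive mexp : Type :=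
| MVar of nat
| MZero
| MAdd of mexp & mexp
| MOpp of mexp
| MScale of F & mexp
| MMuln of mexp & nat.

Fixpoint meval (w : seq V) (e : mexp) : V :=
  match e with
  | MVar i => w`_i
  | MZero => 0
  | MAdd a b => meval w a + meval w b
  | MOpp a => - meval w a
  | MScale c a => c *: meval w a
  | MMuln a k => meval w a *+ k
  end.

(** The test [eqn] on numerals is decided by [cbn], which leaves plain field expressions for [ring]
    and [field]. *)
Fixpoint mcoef (e : mexp) (i : nat) : F :=
  match e with
  | MVar j => if eqn i j then 1 else 0
  | MZero => 0
  | MAdd a b => mcoef a i + mcoef b i
  | MOpp a => - mcoef a i
  | MScale c a => c * mcoef a i
  | MMuln a k => mcoef a i * k%:R
  end.

Lemma mevalE (w : seq V) (e : mexp) :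
  meval w e = \sum_(i < size w) mcoef e i *: w`_i.
Proof.
elim: e => [j||a IHa b IHb|a IHa|c a IHa|a IHa k] /=.
- have [ltj|gej] := ltnP j (size w).
    rewrite (bigD1 (Ordinal ltj)) //= -[eqn _ _]/(j == j) eqxx scale1r big1 ?addr0 // => i.
    by rewrite -val_eqE /= => /negPf neq_ij; rewrite -[eqn _ _]/(i == j :> nat) neq_ij scale0r.
  rewrite nth_default // big1 // => i _.
  by rewrite -[eqn _ _]/(i == j :> nat) ltn_eqF ?scale0r // (leq_trans _ gej).
- by rewrite big1 // => i _; rewrite scale0r.
- by rewrite IHa IHb -big_split; apply: eq_bigr => i _; rewrite scalerDl.
- by rewrite IHa -sumrN; apply: eq_bigr => i _; rewrite scaleNr.
- by rewrite IHa scaler_sumr; apply: eq_bigr => i _; rewrite scalerA.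
- by rewrite IHa -sumrMnl; apply: eq_bigr => i _; rewrite mulr_natr scalerMnl.
Qed.

Fixpoint mcoefs_eq (a b : mexp) (k : nat) : Prop :=
  if k is k'.+1 then mcoef a k' = mcoef b k' /\ mcoefs_eq a b k' else True.

Lemma meval_eq (w : seq V) (a b : mexp) :
  mcoefs_eq a b (size w) -> meval w a = meval w b.
Proof.
rewrite !mevalE => eq_ab; apply: eq_bigr => -[i /= lti _]; congr (_ *: _).
elim: (size w) eq_ab lti => //= k IHk [eq_k eq_ab]; rewrite ltnS leq_eqVlt.
by case/orP=> [/eqP->|]; [exact: eq_k | exact: IHk].
Qed.

End ModuleExpressions.

Ltac mod_index x w :=
  match w with
  | cons ?y _ => let _ := match goal with _ => unify x y end in constr:(0%N)
  | cons _ ?w' => let i := mod_index x w' in constr:(S i)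
  end.

Ltac mod_atoms e w :=
  lazymatch e with
  | (?a + ?b)%R => let w' := mod_atoms a w in mod_atoms b w'
  | (- ?a)%R => mod_atoms a w
  | (_ *: ?a)%R => mod_atoms a w
  | (?a *+ _)%R => mod_atoms a w
  | 0%R => w
  | _ => match w with
         | _ => let i := mod_index e w in w
         | _ => constr:(cons e w)
         end
  end.

Ltac mod_reify F e w :=
  lazymatch e with
  | (?a + ?b)%R =>
      let a' := mod_reify F a w in let b' := mod_reify F b w in
      constr:(@MAdd F a' b')
  | (- ?a)%R => let a' := mod_reify F a w in constr:(@MOpp F a')
  | (?c *: ?a)%R => let a' := mod_reify F a w in constr:(@MScale F c a')
  | (?a *+ ?k)%R => let a' := mod_reify F a w in constr:(@MMuln F a' k)
  | 0%R => constr:(@MZero F)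
  | _ => let i := mod_index e w in constr:(@MVar F i)
  end.

(* Proves an equality of linear combinations in a module by comparing the
   coefficients of each atom. *)
Ltac module_ring V F :=
  lazymatch goal with
  | |- ?l = ?r =>
      let w0 := constr:(@nil V) in
      let w1 := mod_atoms l w0 in
      let w := mod_atoms r w1 in
      let l' := mod_reify F l w in
      let r' := mod_reify F r w in
      apply: (@meval_eq F V w l' r');
      cbn [mcoefs_eq size mcoef eqn]; repeat split; first [ring | field]
  end.

(** * Subspaces and semisimplicity *)

Section Subspaces.
Variables (F : fieldType) (V : lmodType F).

Section Closure.
Variables (U : V -> Prop) (sU : subspace U).

Lemma subspace0 : U 0. Proof. by case: sU. Qed.

Lemma subspaceZ c u : U u -> U (c *: u).
Proof. by move=> Uu; rewrite -[_ *: _]addr0; apply: (proj2 sU) => //; case: sU. Qed.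

Lemma subspaceD u v : U u -> U v -> U (u + v).
Proof. by move=> Uu Uv; rewrite -[u]scale1r; apply: (proj2 sU). Qed.

Lemma subspaceN u : U u -> U (- u).
Proof. by rewrite -scaleN1r; apply: subspaceZ. Qed.

Lemma subspaceB u v : U u -> U v -> U (u - v).
Proof. by move=> Uu Uv; apply: subspaceD => //; apply: subspaceN. Qed.


Lemma subspace_sum (I : eqType) (r : seq I) (P : pred I) (f : I -> V) :
  (forall i, i \in r -> P i -> U (f i)) -> U (\sum_(i <- r | P i) f i).
Proof.
move=> Uf; rewrite big_seq_cond; apply: big_ind.
- exact: subspace0.
- exact: subspaceD.
- by move=> i /andP[ri Pi]; apply: Uf.
Qed.

End Closure.

Fixpoint lspan (b : seq V) (v : V) : Prop :=
  if b is u :: b' then exists c : F, lspan b' (v - c *: u) else v = 0.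

Lemma lspan_subspace b : subspace (lspan b).
Proof.
elim: b => [|u b IHb] /=; first by split=> // c _ _ -> ->; rewrite scaler0 addr0.
split=> [|c v w [cv sv] [cw sw]].
  by exists 0; rewrite scale0r subr0; apply: subspace0.
exists (c * cv + cw); have := proj2 IHb c _ _ sv sw.
by congr lspan; module_ring V F.
Qed.

Lemma mem_lspan (b : seq V) v : v \in b -> lspan b v.
Proof.
elim: b => [//|u b IHb] /=; rewrite inE => /orP[/eqP->|/IHb sv].
  by exists 1; rewrite scale1r subrr; exact: (subspace0 (lspan_subspace _)).
by exists 0; rewrite scale0r subr0.
Qed.

Lemma lspan_min (W : V -> Prop) (b : seq V) v :
  subspace W -> (forall u, u \in b -> W u) -> lspan b v -> W v.
Proof.
move=> sW; elim: b v => [|u b IHb] v /= Wb; first by move=> ->; apply: subspace0.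
case=> c /IHb Wv; rewrite -[v](subrK (c *: u)); apply: subspaceD => //.
  by apply: Wv => w bw; apply: Wb; rewrite inE bw orbT.
by apply: subspaceZ => //; apply: Wb; rewrite mem_head.
Qed.


(** A vector that depends on the later ones is skipped, which keeps the coordinate map injective.
    This turns a finitely spanned subspace into a [vectType], the form in which the exceptional
    modules are given. *)
Lemma lspan_coordinates (b : seq V) :
  exists (d : nat) (phi : {linear 'rV[F]_d -> V}),
    injective phi /\ forall v, lspan b v <-> exists w, v = phi w.
Proof.
elim: b => [|u b [d [phi [inj_phi phiP]]]] /=.
  pose f (w : 'rV[F]_0) : V := 0.
  have lin_f : linear f by move=> c x y; rewrite /f scaler0 addr0.
  pose phi : {linear 'rV[F]_0 -> V} :=
    HB.pack f (GRing.isLinear.Build F 'rV[F]_0 V *:%R f lin_f).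
  exists 0%N, phi.
  split=> [x y _|v]; first by rewrite [x]thinmx0 [y]thinmx0.
  by split=> [->|[w ->]] //; exists 0.
have [[w0 Du]|not_u] := pselect (exists w, u = phi w).
  exists d, phi; split=> // v; split=> [[c /phiP[w Dv]]|[w Dv]].
    by exists (c *: w0 + w); rewrite linearP -Du -Dv addrC subrK.
  by exists 0; rewrite scale0r subr0; apply/phiP; exists w.
pose f (w : 'rV[F]_(1 + d)) : V := lsubmx w 0 0 *: u + phi (rsubmx w).
have lin_f : linear f.
  move=> c x y; rewrite /f !linearP !mxE /=; module_ring V F.
pose phi' : {linear 'rV[F]_(1 + d) -> V} :=
  HB.pack f (GRing.isLinear.Build F 'rV[F]_(1 + d) V *:%R f lin_f).
exists (1 + d)%N, phi'.
have ker_f w : f w = 0 -> w = 0.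
  rewrite /f => fw0; have c0 : lsubmx w 0 0 = 0.
    apply: contrapT => /eqP c_neq0; case: not_u.
    exists (- (lsubmx w 0 0)^-1 *: rsubmx w); rewrite linearZ /=.
    move/eqP: fw0; rewrite addrC addr_eq0 => /eqP->.
    by rewrite scalerN scaleNr opprK scalerA mulVf // scale1r.
  rewrite c0 scale0r add0r in fw0.
  have r0 : rsubmx w = 0 by apply: inj_phi; rewrite fw0 linear0.
  have l0 : lsubmx w = 0 by apply/matrixP=> i j; rewrite !ord1 c0 mxE.
  by rewrite -[w]hsubmxK r0 l0 row_mx0.
split=> [x y /= fxy|v /=].
  apply/eqP; rewrite -subr_eq0; apply/eqP/ker_f.
  by rewrite addrC -scaleN1r lin_f fxy scaleN1r addNr.
split=> [[c /phiP[w Dv]]|[w ->]].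
  exists (row_mx (const_mx c) w); rewrite /f row_mxKl row_mxKr mxE -Dv.
  by rewrite addrC subrK.
exists (lsubmx w 0 0); rewrite /f [X in lspan _ (X - _)]addrC addrK.
by apply/phiP; exists (rsubmx w).
Qed.

End Subspaces.

(** * Simple submodules lying between two submodules *)

Section Semisimplicity.
Variables (F : fieldType) (L : lmodType F) (P : L -> Prop) (V : lmodType F).
Variable rho : L -> {linear V -> V}.
Let submod := submodule P rho.
Let irreducible := irreducible_submodule P rho.

Definition sum2 (A B : V -> Prop) (v : V) := exists a b, [/\ A a, B b & v = a + b].

Lemma submodule_sum2 A B : submod A -> submod B -> submod (sum2 A B).
Proof.
move=> [sA tA] [sB tB]; split; first split.
- by exists 0, 0; rewrite addr0; split=> //; apply: subspace0.
- move=> c _ _ [a [b [Aa Bb ->]]] [a' [b' [Aa' Bb' ->]]].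
  exists (c *: a + a'), (c *: b + b').
  by split; [apply: (proj2 sA)|apply: (proj2 sB)|module_ring V F].
move=> l _ Pl [a [b [Aa Bb ->]]]; exists (rho l a), (rho l b).
by rewrite linearD; split=> //; [apply: tA|apply: tB].
Qed.

Lemma submoduleI A B : submod A -> submod B -> submod (fun v => A v /\ B v).
Proof.
move=> [sA tA] [sB tB]; split; first split.
- by split; apply: subspace0.
- by move=> c u v [Au Bu] [Av Bv]; split; [apply: (proj2 sA)|apply: (proj2 sB)].
by move=> l v Pl [Av Bv]; split; [apply: tA|apply: tB].
Qed.

(* The image of an irreducible submodule U under the projection along W. *)
Lemma irreducible_projection K W U :
    submod K -> submod W -> (forall v, K v -> W v -> v = 0) -> irreducible U ->
    (forall v, U v -> sum2 K W v) -> (forall v, U v -> W v -> v = 0) ->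
  irreducible (fun k => K k /\ exists2 w, W w & U (k + w)).
Proof.
move=> mK mW KW0 [mU [u0 Uu0 u0_neq0] irrU] sUKW UW0.
have [[sK tK] [sW tW]] := (mK, mW); have [sU tU] := mU.
split.
- split; first split.
  + split; first exact: subspace0.
    by exists 0; [apply: subspace0 | rewrite addr0; apply: subspace0].
  + move=> c k k' [Kk [w Ww Uw]] [Kk' [w' Ww' Uw']]; split; first exact: (proj2 sK).
    exists (c *: w + w'); first exact: (proj2 sW).
    by have := proj2 sU c _ _ Uw Uw'; congr U; module_ring V F.
  move=> l k Pl [Kk [w Ww Uw]]; split; first exact: tK.
  by exists (rho l w); [apply: tW | rewrite -linearD; apply: tU].
- have [k [w [Kk Ww Du]]] := sUKW _ Uu0.
  exists k; first by split=> //; exists w => //; rewrite -Du.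
  by move=> k0; apply/u0_neq0/UW0 => //; rewrite Du k0 add0r.
(* A submodule [Z] of the projected image is tested by lifting it back to the intersection of [U]
   with [Z + W], where simplicity of [U] applies. *)
move=> Z mZ sZ; pose Z' v := U v /\ sum2 Z W v.
have mZ' : submod Z' by apply: submoduleI => //; apply: submodule_sum2.
have [Z0|Zall] := irrU Z' mZ' (fun v => @proj1 _ _).
  left=> z Zz; have [Kz [w Ww Uzw]] := sZ z Zz.
  have : z + w = 0 by apply: Z0; split=> //; exists z, w.
  by move/eqP; rewrite addr_eq0 => /eqP Dz; apply: KW0 => //; rewrite Dz; apply: subspaceN.
right=> k [Kk [w Ww Uw]]; have [_ [z [w' [Zz Ww' Dkw]]]] := Zall _ Uw.
suff /eqP : k - z = 0 by rewrite subr_eq0 => /eqP->.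
apply: KW0; first by apply: subspaceB => //; case: (sZ z Zz).
rewrite (_ : k - z = w' - w); first exact: subspaceB.
by rewrite -[k](addrK w) Dkw; module_ring V F.
Qed.

(** A vector [v] of [K] outside [N] lies in a sum of finitely many simple submodules, and induction
    on their number replaces a maximality argument. Write [v = w + v'] with [w] in the next summand
    [W]. If [W] lies in [N], continue with [v']. If [W] meets [N] in 0 and lies in [K], it is the
    answer. If [W] meets [K] in 0, apply induction to [N + W] and [K + W], then project the result
    onto [K] along [W]. *)
Lemma irreducible_between_finite (r : seq (V -> Prop)) (N K : V -> Prop) v :
    (forall i, (i < size r)%N -> irreducible (nth (fun=> True) r i)) ->
    submod N -> submod K -> (forall u, N u -> K u) ->
    foldr sum2 (fun u => u = 0) r v -> K v -> ~ N v ->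
  exists U, [/\ irreducible U, forall u, U u -> K u & forall u, U u -> N u -> u = 0].
Proof.
elim: r N K v => [|W r IHr] N K v irr_r mN mK sNK /=.
  by move=> -> _ []; apply: subspace0; case: mN.
case=> w [v' [Ww rv' ->]] Kv Nv; have irrW : irreducible W by apply: (irr_r 0%N).
have {}irr_r i : (i < size r)%N -> irreducible (nth (fun=> True) r i).
  by move=> lti; apply: (irr_r i.+1).
have [mW _ minW] := irrW; have [[sN tN] [sK tK]] := (mN, mK); have [sW tW] := mW.
have [NW0|sWN] := minW _ (submoduleI mN mW) (fun u => @proj2 _ _); last first.
  have Nw := proj1 (sWN w Ww).
  apply: (IHr N K v') => //.
    by rewrite -[v'](addKr w) addrC; apply: subspaceB => //; apply: sNK.
  by move=> Nv'; apply: Nv; apply: subspaceD.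
have [KW0|sWK] := minW _ (submoduleI mK mW) (fun u => @proj2 _ _); last first.
  exists W; split=> // [u /sWK[]//|u Wu Nu]; exact: NW0.
have mKW := submodule_sum2 mK mW; have mNW := submodule_sum2 mN mW.
have [||||U [irrU sU NU0]] := IHr (sum2 N W) (sum2 K W) v' irr_r mNW mKW.
- by move=> _ [a [b [Na Wb ->]]]; exists a, b; split=> //; apply: sNK.
- exact: rv'.
- exists (w + v'), (- w); split=> //; first exact: subspaceN.
  by rewrite addrC addKr.
(* If [v' = a + b], then [w + b = v - a] lies in both [K] and [W], hence vanishes, and [v = a] would
   be in [N]. *)
- case=> a [b [Na Wb Dv']]; apply: Nv.
  have wb0 : w + b = 0.
    apply: KW0; split; last exact: subspaceD.
    rewrite (_ : w + b = w + v' - a); first by apply: subspaceB => //; apply: sNK.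
    by rewrite Dv' [a + b]addrC addrA addrK.
  by rewrite Dv' addrCA wb0 addr0.
exists (fun k => K k /\ exists2 w, W w & U (k + w)); split.
- apply: irreducible_projection => //; first by move=> u Ku Wu; apply: KW0.
  by move=> u Uu Wu; apply: NU0 => //; exists 0, u; rewrite add0r; split=> //; apply: subspace0.
- by move=> u [].
move=> u [Ku [z Wz Uuz]] Nu.
have /eqP : u + z = 0 by apply: NU0 => //; exists u, z.
by rewrite addr_eq0 => /eqP Du; apply: KW0; rewrite {2}Du; split=> //; apply: subspaceN.
Qed.

Lemma irreducible_between (N K : V -> Prop) :
    completely_reducible P rho -> submod N -> submod K -> (forall u, N u -> K u) ->
    ~ (forall u, K u -> N u) ->
  exists U, [/\ irreducible U, forall u, U u -> K u & forall u, U u -> N u -> u = 0].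
Proof.
case=> I [C [irrC sumC _]] mN mK sNK /existsNP[v /not_implyP[Kv Nv]].
have [s [sC Dv]] := sumC v.
suff [r irr_r rv] : exists2 r : seq (V -> Prop),
    forall i, (i < size r)%N -> irreducible (nth (fun=> True) r i)
    & foldr sum2 (fun u => u = 0) r v.
  exact: (irreducible_between_finite irr_r mN mK sNK rv Kv Nv).
rewrite {}Dv; elim: s sC {Kv Nv} => [|u s IHs] sC; first by exists [::]; rewrite ?big_nil.
have [|r irr_r rs] := IHs; first by move=> w sw; apply: sC; rewrite inE sw orbT.
have [i _ Cu] := sC u (mem_head _ _).
exists (C i :: r); first by case=> [_|j]; [apply: irrC | apply: (irr_r j)].
by rewrite big_cons; exists u, (\sum_(j <- s) j).
Qed.

End Semisimplicity.

(** * Words in finitely many operators subject to cubic relations *)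

Section Words.
Variables (F : fieldType) (V : lmodType F) (I : finType) (x : I -> {linear V -> V}).

Definition word_act (w : seq I) (v : V) : V := foldr (fun i => x i) v w.

Fixpoint word_vectors (d : nat) (v : V) : seq V :=
  if d is d'.+1 then
    v :: [seq x i u | i <- enum I, u <- word_vectors d' v]
  else [:: v].

Lemma mem_word_vectors d v w :
  (size w <= d)%N -> word_act w v \in word_vectors d v.
Proof.
elim: d w => [|d IHd] [|i w] //= ltwd; rewrite ?mem_head // inE.
by apply/orP; right; apply/allpairsP; exists (i, word_act w v); rewrite mem_enum; split=> //; apply: IHd.
Qed.

Lemma word_vectorsP d v u :
  u \in word_vectors d v -> exists2 w, (size w <= d)%N & u = word_act w v.
Proof.
elim: d u => [|d IHd] u /=; first by rewrite inE => /eqP->; exists [::].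
rewrite inE => /orP[/eqP->|]; first by exists [::].
case/allpairsP=> [[i u'] [_ /IHd[w lewd ->] ->]].
by exists (i :: w).
Qed.

Variables (U : V -> Prop) (v0 : V) (c : I -> F) (s : I -> I -> I -> F).
Hypothesis stableU : forall i v, U v -> U (x i v).
Hypothesis Uv0 : U v0.
Hypothesis commU : forall i j v, U v ->
  x i (x j v) = x j (x i v) + \sum_k s i j k *: x k v.
Hypothesis cubeU : forall i v, U v -> x i (x i (x i v)) = c i *: x i v.

Let G d := lspan (word_vectors d v0).

Lemma word_stable w v : U v -> U (word_act w v).
Proof. by move=> Uv; elim: w => //= i w; apply: stableU. Qed.

Lemma word_span_word w d : (size w <= d)%N -> G d (word_act w v0).
Proof. by move=> lewd; apply/mem_lspan/mem_word_vectors. Qed.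

Lemma word_span_subspace d : subspace (G d).
Proof. exact: lspan_subspace. Qed.

Lemma word_span_min d (W : V -> Prop) : subspace W ->
  (forall w, (size w <= d)%N -> W (word_act w v0)) -> forall v, G d v -> W v.
Proof. by move=> sW Ww v; apply: lspan_min => // u /word_vectorsP[w lewd ->]; apply: Ww. Qed.

Lemma word_spanS d i v : G d v -> G d.+1 (x i v).
Proof.
move: v; apply: word_span_min => [|w lewd]; last exact: (@word_span_word (i :: w)).
have sG := word_span_subspace d.+1.
by split=> [|a u v Gu Gv]; rewrite ?linear0 ?linearP; [apply: subspace0|apply: (proj2 sG)].
Qed.

Lemma word_span_sub d d' v : (d <= d')%N -> G d v -> G d' v.
Proof.
move=> ledd'; move: v; apply: word_span_min; first exact: word_span_subspace.
by move=> w lewd; apply: word_span_word; apply: leq_trans ledd'.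
Qed.

(** Each exchange of neighbours costs a commutator, and by [commU] a commutator replaces two letters
    by one: the error consists of shorter words. *)
Lemma word_move_front i w : i \in w ->
  G (size w).-1 (word_act w v0 - x i (word_act (rem i w) v0)).
Proof.
elim: w => [//|j w IHw] /=; rewrite inE; have [-> _|neq_ji] := eqVneq j i.
  by rewrite subrr; exact: (subspace0 (word_span_subspace _)).
move=> /= wi; have /IHw Gi := wi.
have w_gt0 : (0 < size w)%N by case: (w) wi.
have := word_spanS j Gi; rewrite prednK // linearB /= => Gj.
rewrite -[X in G _ X](subrKA (x j (x i (word_act (rem i w) v0)))).
apply: subspaceD => //; first exact: word_span_subspace.
rewrite commU; last exact: word_stable.
rewrite addrC addrA addNr add0r; apply: (subspace_sum (word_span_subspace _)) => k _ _.
apply: (subspaceZ (word_span_subspace _)).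
by apply: (@word_span_word (k :: _)); rewrite /= size_rem // prednK.
Qed.

Lemma word_long (w : seq I) : (#|I|.*2 < size w)%N -> exists i, (2 < count_mem i w)%N.
Proof.
have szw : size w = \sum_(i : I) count_mem i w.
  elim: w => [|a w IHw] /=; first by rewrite big1.
  rewrite big_split -IHw /= (bigD1 a) //= eqxx big1 ?addn0 // => i.
  by move=> neq_ia; rewrite eq_sym (negPf neq_ia).
move=> long_w; apply: contrapT => /forallNP small.
move: long_w; rewrite ltnNge szw => /negP[].
rewrite -muln2 -sum_nat_const; apply: leq_sum => i _.
by rewrite leqNgt; apply/negP/small.
Qed.

(** A word with more than [2 #|I|] letters contains some letter three times. Modulo shorter words
    the three copies move to the front, where [cubeU] turns them into one. *)
Lemma word_span_bounded d v : G d v -> G #|I|.*2 v.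
Proof.
elim: d v => [|d IHd] v; first exact: word_span_sub.
have [led|ltd] := leqP d.+1 #|I|.*2; first exact: word_span_sub.
move: v; apply: word_span_min => [|w]; first exact: word_span_subspace.
rewrite leq_eqVlt ltnS => /orP[/eqP szw|led]; last exact/IHd/word_span_word.
apply: IHd; have [|i ci] := @word_long w; first by rewrite szw.
have ct (y : seq I) : i \in y -> count_mem i (rem i y) = (count_mem i y).-1.
  by move=> yi; rewrite (permP (perm_to_rem yi)) /= eqxx.
have wi : i \in w by rewrite -has_pred1 has_count (leq_trans _ ci).
set y := rem i w; have cy : (1 < count_mem i y)%N by rewrite ct // -ltnS prednK ?(leq_trans _ ci).
have yi : i \in y by rewrite -has_pred1 has_count (leq_trans _ cy).
set z := rem i y; have cz : (0 < count_mem i z)%N by rewrite ct // -ltnS prednK ?(leq_trans _ cy).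
have zi : i \in z by rewrite -has_pred1 has_count.
have szy : size y = d by rewrite size_rem // szw.
have szz : size z = d.-1 by rewrite size_rem // szy.
have d1 : (0 < d)%N by rewrite -szy; case: (y) yi.
have d2 : (0 < d.-1)%N by rewrite -szz; case: (z) zi.
(* [G1], [G2], [G3] bring the copies of [i] forward one at a time, up to words of size at most [d];
   after the cube is collapsed in [G3], the remaining word [i :: t] has size [d.-1]. *)
have := word_move_front wi; rewrite szw /= -/y => G1.
have := word_spanS i (word_move_front yi); rewrite szy prednK // -/z linearB /= => G2.
have := word_spanS i (word_spanS i (word_move_front zi)).
rewrite szz !prednK // !linearB /= cubeU; last exact: word_stable.
set t := rem i z => G3.
have G4 : G d (c i *: x i (word_act t v0)).
  apply: (subspaceZ (word_span_subspace _)); apply: (@word_span_word (i :: t)).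
  by rewrite /= size_rem // szz prednK // leq_pred.
have sG := word_span_subspace d.
have := subspaceD sG G1 (subspaceD sG G2 (subspaceD sG G3 G4)).
by congr (G _ _); module_ring V F.
Qed.

Lemma word_span_stable i v : G #|I|.*2 v -> G #|I|.*2 (x i v).
Proof. by move=> Gv; apply: (@word_span_bounded #|I|.*2.+1); apply: word_spanS. Qed.

Lemma finite_stable_span : subspace U -> exists b : seq V,
  [/\ lspan b v0, forall v, lspan b v -> U v & forall i v, lspan b v -> lspan b (x i v)].
Proof.
move=> sU; exists (word_vectors #|I|.*2 v0); split; last exact: word_span_stable.
  exact: (@word_span_word [::]).
by apply: word_span_min => // w _; apply: word_stable.
Qed.

End Words.

(** * Highest weight vectors *)

Section Sl2.
Variables (F : numFieldType) (V : lmodType F) (U : V -> Prop).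
Variables e f h : {linear V -> V}.
Hypothesis stable_e : forall u, U u -> U (e u).
Hypothesis stable_f : forall u, U u -> U (f u).
Hypothesis sqr_e : forall u, U u -> e (e u) = 0.
Hypothesis sqr_f : forall u, U u -> f (f u) = 0.
Hypothesis hE : forall u, U u -> h u = e (f u) - f (e u).
Hypothesis he_comm : forall u, U u -> h (e u) = e (h u) + e u *+ 2.
Hypothesis hf_comm : forall u, U u -> h (f u) = f (h u) - f u *+ 2.

Lemma mulr2n_inj (u v : V) : u *+ 2 = v *+ 2 -> u = v.
Proof.
rewrite -!scaler_nat => uv.
have n2 : (2%:R : F) != 0 by rewrite pnatr_eq0.
by rewrite -[u]scale1r -(mulVf n2) -scalerA uv scalerA mulVf // scale1r.
Qed.

(** Since [e] squares to 0, [h e = e f e] and [e h = - e f e]; the relation [[h, e] = 2 e] then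
    forces [e f e = e]. *)
Lemma sl2_he u : U u -> h (e u) = e u.
Proof.
move=> Uu; have Ueu := stable_e Uu.
have h1 : h (e u) = e (f (e u)) by rewrite hE // sqr_e // linear0 subr0.
have := he_comm Uu; rewrite h1 hE // linearB /= sqr_e; last exact: stable_f.
move=> /(congr1 (fun z => z + e (f (e u)))) h2.
by apply: mulr2n_inj; move: h2; rewrite -mulr2n => ->; module_ring V F.
Qed.

Lemma sl2_hf u : U u -> h (f u) = - f u.
Proof.
move=> Uu; have Ufu := stable_f Uu.
have h1 : h (f u) = - f (e (f u)) by rewrite hE // sqr_f // linear0 sub0r.
have := hf_comm Uu; rewrite h1 hE // linearB /= sqr_f; last exact: stable_e.
move=> /(congr1 (fun z => z - f (e (f u)))) h2.
by apply: mulr2n_inj; rewrite mulr2n h2; module_ring V F.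
Qed.

Lemma sl2_hh u : U u -> h (h u) = e (f u) + f (e u).
Proof.
move=> Uu; rewrite (hE Uu) linearB /= sl2_he ?sl2_hf ?opprK //.
  exact: stable_e.
exact: stable_f.
Qed.

(** Square-zero [e] and [f] leave room only for the trivial and the two-dimensional representation,
    whose weights 0, 1, -1 are the roots of [z^3 = z]. *)
Lemma sl2_cube u : U u -> h (h (h u)) = h u.
Proof.
move=> Uu; rewrite (sl2_hh Uu) linearD /= sl2_he ?sl2_hf ?(hE Uu) //.
  exact: stable_e.
exact: stable_f.
Qed.

Lemma sl2_highest u : U u -> e u = 0 -> h (h u) = h u.
Proof. by move=> Uu eu0; rewrite sl2_hh // hE // eu0 linear0 subr0 addr0. Qed.

End Sl2.

Lemma cube_eq_norm_le1 (z : int) : z ^+ 3 = z -> `|z| <= 1.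
Proof.
move=> z3; have : z * (z - 1) * (z + 1) = 0.
  have -> : z * (z - 1) * (z + 1) = z ^+ 3 - z by ring.
  by rewrite z3 subrr.
by move/eqP; rewrite !mulf_eq0 => /orP[/orP[]|]; lia.
Qed.

Section HighestWeightVector.
Variables (F : numFieldType) (V : lmodType F) (U : V -> Prop) (sU : subspace U).
Variables (I : finType) (B : Type) (H : I -> {linear V -> V}) (E : B -> {linear V -> V}).
Variables (a : B -> I -> int) (w : I -> int).
Hypothesis stableH : forall i u, U u -> U (H i u).
Hypothesis stableE : forall b u, U u -> U (E b u).
Hypothesis commH : forall i j u, U u -> H i (H j u) = H j (H i u).
Hypothesis cubeH : forall i u, U u -> H i (H i (H i u)) = H i u.
Hypothesis commHE : forall i b u,
  U u -> H i (E b u) = E b (H i u) + (a b i)%:~R *: E b u.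
Hypothesis raise : forall b, 0 < \sum_i w i * a b i.

Lemma eigenvalue_norm_le1 i v (z : int) :
  U v -> v <> 0 -> H i v = z%:~R *: v -> `|z| <= 1.
Proof.
move=> Uv v0 Hv; apply: cube_eq_norm_le1; have := cubeH i Uv.
rewrite !(Hv, linearZ) /= => /eqP; rewrite !scalerA -subr_eq0 -scalerBl scaler_eq0.
case/orP=> [|/eqP//]; rewrite subr_eq0 -!intrM eqr_int => /eqP.
by rewrite exprS expr2 mulrA.
Qed.

(** For [h = H i] one has [2 v = 2 (v - h^2 v) + (h v + h^2 v) + (h^2 v - h v)], and the cubic
    relation makes the three parts eigenvectors for 0, 1 and -1, at least one of them nonzero. The
    operators commute, so each part keeps the eigenvalues already found for the others. *)
Lemma common_eigenvector_seq (s : seq I) u : U u -> u <> 0 ->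
  exists v, [/\ U v, v <> 0 & forall i, i \in s -> exists z : int, H i v = z%:~R *: v].
Proof.
move=> Uu u0; elim: s => [|i s [v [Uv v0 eig_v]]]; first by exists u.
suff [v' [Uv' v'0 [z Hv'] eig_v']] : exists v', [/\ U v', v' <> 0,
    exists z : int, H i v' = z%:~R *: v'
    & forall j, j \in s -> exists z : int, H j v' = z%:~R *: v'].
  exists v'; split=> // j; rewrite inE => /orP[/eqP->|/eig_v'//].
  by exists z.
have UH := stableH i Uv; have UHH := stableH i UH.
have eig2 j : j \in s -> exists z : int, [/\ H j v = z%:~R *: v,
    H j (H i v) = z%:~R *: H i v & H j (H i (H i v)) = z%:~R *: H i (H i v)].
  move=> /eig_v[z Hz]; exists z; split=> //.
    by rewrite (commH j i Uv) Hz linearZ.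
  by rewrite (commH j i UH) (commH j i Uv) Hz !linearZ.
have [v1|v1] := pselect (v - H i (H i v) = 0); last first.
  exists (v - H i (H i v)); split=> //; first exact: subspaceB.
    by exists 0; rewrite linearB /= cubeH // scale0r subrr.
  by move=> j /eig2[z [E1 E2 E3]]; exists z; rewrite linearB /= E1 E3 scalerBr.
have [v2|v2] := pselect (H i v + H i (H i v) = 0); last first.
  exists (H i v + H i (H i v)); split=> //; first exact: subspaceD.
    by exists 1; rewrite linearD /= cubeH // scale1r addrC.
  by move=> j /eig2[z [E1 E2 E3]]; exists z; rewrite linearD /= E2 E3 scalerDr.
exists (H i (H i v) - H i v); split; first exact: subspaceB.
- move=> v3; apply: v0; apply: (@mulr2n_inj F V); rewrite mul0rn.
  have <- : (v - H i (H i v)) *+ 2 + (H i v + H i (H i v)) + (H i (H i v) - H i v) = 0.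
    by rewrite v1 v2 v3 mul0rn !addr0.
  by module_ring V F.
- by exists (-1); rewrite linearB /= cubeH // mulrN1z scaleN1r opprB.
- by move=> j /eig2[z [E1 E2 E3]]; exists z; rewrite linearB /= E2 E3 scalerBr.
Qed.

(** Applying some [E b] strictly increases the integer sum of the [w i * z i], while [|z i| <= 1]
    bounds it by the sum of the [|w i|]. Raising therefore stops, even in infinite dimension; the
    induction is on a bound for the remaining gap. *)
Lemma highest_weight_vector u : U u -> u <> 0 ->
  exists v (z : I -> int), [/\ U v, v <> 0, forall b, E b v = 0
    & forall i, H i v = (z i)%:~R *: v].
Proof.
move=> Uu u0; have [v [Uv v0 eig_v]] := common_eigenvector_seq (enum I) Uu u0.
have /choice[z Hv] : forall i, exists z : int, H i v = z%:~R *: v.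
  by move=> i; apply: eig_v; rewrite mem_enum.
have [k] : exists k : nat, \sum_i `|w i| - \sum_i w i * z i < k%:Z.
  by move: (_ - _) => D; exists (absz D).+1; lia.
elim: k v z Uv v0 Hv {eig_v} => [|k IHk] v z Uv v0 Hv.
  rewrite ltNge subr_ge0 => /negP[]; apply: ler_sum => i _.
  have := eigenvalue_norm_le1 Uv v0 (Hv i) => zle1.
  by apply: le_trans (ler_norm _) _; rewrite normrM ler_piMr.
move=> ltk; have [Ev|] := pselect (forall b, E b v = 0); first by exists v, z.
move=> /existsNP[b Eb0]; apply: (IHk (E b v) (fun i => z i + a b i)) => //.
- exact: stableE.
- by move=> i; rewrite commHE // Hv linearZ /= -scalerDl -intrD.
have -> : \sum_i w i * (z i + a b i) = \sum_i w i * z i + \sum_i w i * a b i.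
  by rewrite -big_split; apply: eq_bigr => i _; rewrite mulrDr.
by have := raise b; lia.
Qed.

End HighestWeightVector.

Lemma initial_segment n (p : pred 'I_n) :
  (forall i j : 'I_n, (i < j)%N -> p j -> p i) ->
  exists2 k, (k <= n)%N & forall i : 'I_n, p i = (i < k)%N.
Proof.
move=> down_p; have [all_p|/existsNP[i0 not_p0]] := pselect (forall i, p i).
  by exists n => // i; rewrite all_p ltn_ord.
have [|i not_pi min_i] := @arg_minnP _ i0 (fun i => ~~ p i) (@nat_of_ord n).
  exact/negP.
exists i; first exact: ltnW.
move=> j; have [ltji|leij] := ltnP j i.
  by apply: contraTT ltji => /min_i; rewrite -leqNgt.
apply/negP => pj; move: leij; rewrite leq_eqVlt => /orP[/eqP/val_inj eij|/down_p/(_ pj) pi].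
  by rewrite eij pj in not_pi.
by rewrite pi in not_pi.
Qed.

(** * Irreducible modules over Lie algebras of matrices *)

Section MatrixModules.
Variables (F : numFieldType) (M : lmodType F) (n : nat).
Variables (P : 'M[F]_n -> Prop) (tau : 'M[F]_n -> {linear M -> M}) (U : M -> Prop).

(** [U] stays a predicate on [M], because nothing is known yet about its dimension. [P] will be
    gl_n, sl_n or sp_2m. *)
Record irreducible_mx_module : Prop := IrreducibleMxModule {
  mxm_algebra : subspace P;
  mxm_comm : forall A B, P A -> P B -> P (A *m B - B *m A);
  mxm_subspace : subspace U;
  mxm_stable : forall A u, P A -> U u -> U (tau A u);
  mxm_linear : forall c A B u, P A -> P B -> U u ->
    tau (c *: A + B) u = c *: tau A u + tau B u;
  mxm_bracket : forall A B u, P A -> P B -> U u ->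
    tau (A *m B - B *m A) u = tau A (tau B u) - tau B (tau A u);
  mxm_nonzero : exists2 u, U u & u <> 0;
  mxm_irreducible : forall W : M -> Prop, subspace W -> (forall u, W u -> U u) ->
    (forall A u, P A -> W u -> W (tau A u)) ->
    (forall u, W u -> u = 0) \/ (forall u, U u -> W u)
}.

Hypothesis hU : irreducible_mx_module.
Let sP := mxm_algebra hU.
Let sU := mxm_subspace hU.

Lemma mxm0 u : U u -> tau 0 u = 0.
Proof.
move=> Uu; have := mxm_linear hU (-1) (subspace0 sP) (subspace0 sP) Uu.
by rewrite scaler0 addr0 scaleN1r addNr.
Qed.

Lemma mxmD A B u : P A -> P B -> U u -> tau (A + B) u = tau A u + tau B u.
Proof. by move=> PA PB Uu; have := mxm_linear hU 1 PA PB Uu; rewrite !scale1r. Qed.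

Lemma mxmZ c A u : P A -> U u -> tau (c *: A) u = c *: tau A u.
Proof.
move=> PA Uu; rewrite -[c *: A]addr0 (mxm_linear hU) //; last exact: (subspace0 sP).
by rewrite mxm0 // addr0.
Qed.

Lemma mxmB A B u : P A -> P B -> U u -> tau (A - B) u = tau A u - tau B u.
Proof.
move=> PA PB Uu; have := mxm_linear hU (-1) PB PA Uu.
by rewrite !scaleN1r addrC => ->; rewrite addrC.
Qed.

Lemma mxm_sum (I : finType) (Q : pred I) (G : I -> 'M[F]_n) u :
  (forall i, Q i -> P (G i)) -> U u ->
  tau (\sum_(i | Q i) G i) u = \sum_(i | Q i) tau (G i) u.
Proof.
move=> PG Uu.
pose R A v := P A /\ tau A u = v.
suff [] : R (\sum_(i | Q i) G i) (\sum_(i | Q i) tau (G i) u) by [].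
apply: (big_ind2 R).
- by split; [exact: (subspace0 sP)|rewrite mxm0].
- move=> A v B v' [PA <-] [PB <-]; split; first exact: (subspaceD sP).
  by rewrite mxmD.
- by move=> i Qi; split=> //; apply: PG.
Qed.

Lemma mxm_commute A B u : P A -> P B -> U u -> A *m B - B *m A = 0 ->
  tau A (tau B u) = tau B (tau A u).
Proof.
by move=> PA PB Uu AB; apply/eqP; rewrite -subr_eq0 -(mxm_bracket hU) // AB mxm0.
Qed.

(** The structure constants of the spanning family [G] make its operators fit the reduction of
    words. Words applied to one nonzero vector then span a finite-dimensional stable subspace, which
    is all of [U] by irreducibility. *)
Lemma mxm_finite (I : finType) (G : I -> 'M[F]_n) (c : I -> F) :
    (forall i, P (G i)) ->
    (forall A, P A -> exists d : I -> F, A = \sum_i d i *: G i) ->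
    (forall i u, U u -> tau (G i) (tau (G i) (tau (G i) u)) = c i *: tau (G i) u) ->
  exists b : seq M, forall v, U v <-> lspan b v.
Proof.
move=> PG spanG cubeG; have [u0 Uu0 u00] := mxm_nonzero hU.
have tauE (A : 'M[F]_n) (d : I -> F) u : U u -> A = \sum_i d i *: G i ->
    tau A u = \sum_i d i *: tau (G i) u.
  move=> Uu ->; rewrite mxm_sum // => [|i _]; last exact: (subspaceZ sP).
  by apply: eq_bigr => i _; rewrite mxmZ.
have /choice[s sE] : forall ij : I * I, exists d : I -> F,
    G ij.1 *m G ij.2 - G ij.2 *m G ij.1 = \sum_k d k *: G k.
  by move=> ij; apply: spanG; apply: (mxm_comm hU).
have [|||||b [bu0 bU bx]] := @finite_stable_span F M I (fun i => tau (G i)) U u0 c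
  (fun i j => s (i, j)).
- by move=> i v; apply: (mxm_stable hU).
- by [].
- move=> i j v Uv; rewrite -(tauE _ _ _ Uv (sE (i, j))) (mxm_bracket hU) //.
  by rewrite addrC subrK.
- exact: cubeG.
- exact: sU.
exists b => v; split=> [|/bU//]; move: v.
have [|b0|//] := mxm_irreducible hU (lspan_subspace b) bU.
  move=> A u PA bu; have [d DA] := spanG A PA; rewrite (tauE _ _ _ (bU _ bu) DA).
  apply: (subspace_sum (lspan_subspace b)) => i _ _.
  by apply: (subspaceZ (lspan_subspace b)); apply: bx.
by case: u00; apply: b0.
Qed.

Lemma mxm_bracketE A B C u : P A -> P B -> U u -> A *m B - B *m A = C ->
  tau A (tau B u) = tau B (tau A u) + tau C u.
Proof. by move=> PA PB Uu <-; rewrite (mxm_bracket hU) // addrC subrK. Qed.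

End MatrixModules.

Section MatrixModulesMore.
Variables (F : numFieldType) (M : lmodType F) (n : nat).
Variables (P : 'M[F]_n -> Prop) (tau : 'M[F]_n -> {linear M -> M}) (U : M -> Prop).
Hypothesis hU : irreducible_mx_module P tau U.
Let sP := mxm_algebra hU.
Let sU := mxm_subspace hU.

Lemma mxmMn A k u : P A -> U u -> tau (A *+ k) u = tau A u *+ k.
Proof. by move=> PA Uu; rewrite -[A *+ k]scaler_nat (mxmZ hU) // scaler_nat. Qed.

Lemma mxmN A u : P A -> U u -> tau (- A) u = - tau A u.
Proof. by move=> PA Uu; rewrite -[- A]scaleN1r (mxmZ hU) // scaleN1r. Qed.

Lemma mxm_eigen A B (c : F) u : P A -> P B -> U u -> A *m B - B *m A = c *: B ->
  tau A (tau B u) = tau B (tau A u) + c *: tau B u.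
Proof.
by move=> PA PB Uu AB; rewrite (mxm_bracketE hU PA PB Uu AB) (mxmZ hU).
Qed.

Definition mx_sl2 (e f h : 'M[F]_n) :=
  [/\ P e, P f, P h & [/\ e *m f - f *m e = h, h *m e - e *m h = 2 *: e
    & h *m f - f *m h = - 2 *: f]].

Section Triple.
Variables e f h : 'M[F]_n.
Hypothesis efh : mx_sl2 e f h.
Hypothesis sqr_e : forall u, U u -> tau e (tau e u) = 0.
Hypothesis sqr_f : forall u, U u -> tau f (tau f u) = 0.

Let stable_e u : U u -> U (tau e u).
Proof. by case: efh => Pe _ _ _; apply: (mxm_stable hU). Qed.
Let stable_f u : U u -> U (tau f u).
Proof. by case: efh => _ Pf _ _; apply: (mxm_stable hU). Qed.
Let hE u : U u -> tau h u = tau e (tau f u) - tau f (tau e u).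
Proof. by case: efh => Pe Pf _ [<- _ _] Uu; apply: (mxm_bracket hU). Qed.
Let he u : U u -> tau h (tau e u) = tau e (tau h u) + tau e u *+ 2.
Proof.
by case: efh => Pe _ Ph [_ Dhe _] Uu; rewrite (mxm_eigen Ph Pe Uu Dhe) scaler_nat.
Qed.
Let hf u : U u -> tau h (tau f u) = tau f (tau h u) - tau f u *+ 2.
Proof.
case: efh => _ Pf Ph [_ _ Dhf] Uu.
by rewrite (mxm_eigen Ph Pf Uu Dhf) scaleNr scaler_nat.
Qed.

Lemma mx_sl2_cube u : U u -> tau h (tau h (tau h u)) = tau h u.
Proof. exact: (sl2_cube stable_e stable_f sqr_e sqr_f hE he hf). Qed.

Lemma mx_sl2_highest u (z : int) : U u -> u <> 0 -> tau e u = 0 ->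
  tau h u = z%:~R *: u -> (z == 0) || (z == 1).
Proof.
move=> Uu u0 eu0 hu.
have := sl2_highest stable_e stable_f sqr_e sqr_f hE he hf Uu eu0.
rewrite hu linearZ /= hu scalerA => /eqP; rewrite -subr_eq0 -scalerBl scaler_eq0.
case/orP=> [|/eqP//]; rewrite subr_eq0 -intrM eqr_int -subr_eq0.
by rewrite -[X in _ - X]mulr1 -mulrBr mulf_eq0 subr_eq0.
Qed.

End Triple.
End MatrixModulesMore.

Definition fspan (F : fieldType) (V : lmodType F) (I : finType) (G : I -> V) (v : V) :=
  exists d : I -> F, v = \sum_i d i *: G i.

Lemma fspan_subspace (F : fieldType) (V : lmodType F) (I : finType) (G : I -> V) :
  subspace (fspan G).
Proof.
split; first by exists (fun=> 0); rewrite big1 // => i _; rewrite scale0r.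
move=> c _ _ [d ->] [d' ->]; exists (fun i => c * d i + d' i).
rewrite scaler_sumr -big_split; apply: eq_bigr => i _.
by rewrite scalerDl scalerA.
Qed.

Lemma mem_fspan (F : fieldType) (V : lmodType F) (I : finType) (G : I -> V) i :
  fspan G (G i).
Proof.
exists (fun j => (j == i)%:R); rewrite (bigD1 i) //= eqxx scale1r big1 ?addr0 // => j.
by move=> /negPf->; rewrite scale0r.
Qed.

Lemma sum_mul_pred1 (R : pzRingType) (I : finType) (w : I -> R) (i : I) :
  \sum_l w l * (l == i)%:R = w i.
Proof.
by rewrite (bigD1 i) //= eqxx mulr1 big1 ?addr0 // => j /negPf->; rewrite mulr0.
Qed.

Lemma natb_intr (F : numFieldType) (b : bool) : ((b : nat)%:R : int)%:~R = b%:R :> F.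
Proof. by case: b. Qed.

(** * Modules over gl_n, sl_n and sp_2m killed by squares of root vectors *)

Section TypeA.
Variables (F : numFieldType) (M : lmodType F) (n : nat).
Variables (P : 'M[F]_n -> Prop) (tau : 'M[F]_n -> {linear M -> M}) (U : M -> Prop).
Hypothesis hU : irreducible_mx_module P tau U.
Hypothesis P_traceless : forall A, \tr A = 0 -> P A.
Hypothesis sqr_root : forall i j u, i != j -> U u ->
  tau (delta_mx i j) (tau (delta_mx i j) u) = 0.

Definition coroot (i j : 'I_n) : 'M[F]_n := delta_mx i i - delta_mx j j.

Lemma mxtrace_delta (i j : 'I_n) : \tr (delta_mx i j : 'M[F]_n) = (i == j)%:R.
Proof.
rewrite /mxtrace (bigD1 i) //= !mxE eqxx /= big1 ?addr0 // => k neq_ki.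
by rewrite mxE (negPf neq_ki).
Qed.

Lemma root_traceless (i j : 'I_n) : i != j -> P (delta_mx i j).
Proof. by move=> /negPf neq_ij; apply: P_traceless; rewrite mxtrace_delta neq_ij. Qed.

Lemma coroot_traceless i j : P (coroot i j).
Proof. by apply: P_traceless; rewrite raddfB /= !mxtrace_delta !eqxx subrr. Qed.

Lemma comm_diag_root (l i j : 'I_n) :
  delta_mx l l *m delta_mx i j - delta_mx i j *m delta_mx l l =
  ((l == i)%:R - (l == j)%:R) *: delta_mx i j :> 'M[F]_n.
Proof.
rewrite !mul_delta_mx_cond scalerBl !scaler_nat; congr (_ - _).
  by have [->|] := eqVneq l i.
by rewrite eq_sym; have [->|] := eqVneq l j.
Qed.

Lemma comm_coroot_root (l o i j : 'I_n) :
  coroot l o *m delta_mx i j - delta_mx i j *m coroot l o =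
  ((l == i)%:R - (l == j)%:R - ((o == i)%:R - (o == j)%:R)) *: delta_mx i j.
Proof.
rewrite scalerBl -!comm_diag_root /coroot mulmxBl mulmxBr.
by module_ring 'M[F]_n F.
Qed.

Lemma coroot_sl2 (i j : 'I_n) : i != j ->
  mx_sl2 P (delta_mx i j) (delta_mx j i) (coroot i j).
Proof.
move=> neq_ij; have neq_ji : j != i by rewrite eq_sym.
split; [exact: root_traceless|exact: root_traceless|exact: coroot_traceless|split].
- by rewrite !mul_delta_mx.
- rewrite comm_coroot_root !eqxx (negPf neq_ij) (negPf neq_ji).
  by congr (_ *: _) => /=; ring.
- rewrite comm_coroot_root !eqxx (negPf neq_ij) (negPf neq_ji).
  by congr (_ *: _) => /=; ring.
Qed.

Lemma coroot_cube (i j : 'I_n) u : U u ->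
  tau (coroot i j) (tau (coroot i j) (tau (coroot i j) u)) = tau (coroot i j) u.
Proof.
move=> Uu; have [->|neq_ij] := eqVneq i j.
  by rewrite /coroot subrr (mxm0 hU Uu) !linear0.
apply: (mx_sl2_cube hU (coroot_sl2 neq_ij)) => // v Uv; apply: sqr_root => //.
by rewrite eq_sym.
Qed.

Lemma coroot_highest (i j : 'I_n) u (z : int) : i != j -> U u -> u <> 0 ->
    tau (delta_mx i j) u = 0 -> tau (coroot i j) u = z%:~R *: u ->
  (z == 0) || (z == 1).
Proof.
move=> neq_ij; apply: (mx_sl2_highest hU (coroot_sl2 neq_ij)) => // v Uv; apply: sqr_root => //.
by rewrite eq_sym.
Qed.

Lemma diag_commute (A B : 'M[F]_n) :
  is_diag_mx A -> is_diag_mx B -> A *m B - B *m A = 0.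
Proof. by move=> /diag_mxP[a ->] /diag_mxP[b ->]; rewrite diag_mxC subrr. Qed.

Lemma delta_diag (i : 'I_n) : is_diag_mx (delta_mx i i : 'M[F]_n).
Proof.
apply/is_diag_mxP => k l neq_kl; rewrite mxE.
by apply/eqP; rewrite pnatr_eq0 eqb0; apply: contra neq_kl => /andP[/eqP-> /eqP->].
Qed.

Lemma coroot_diag (i j : 'I_n) : is_diag_mx (coroot i j).
Proof.
by have /diag_mxP[a Da] := delta_diag i; have /diag_mxP[b Db] := delta_diag j;
  rewrite /coroot Da Db -raddfB /=; apply: diag_mx_is_diag.
Qed.

Lemma coroot_root_eigen (l o i j : 'I_n) u : i != j -> U u ->
  tau (coroot l o) (tau (delta_mx i j) u) =
  tau (delta_mx i j) (tau (coroot l o) u)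
  + (((l == i)%:R - (l == j)%:R - ((o == i)%:R - (o == j)%:R)) : int)%:~R
    *: tau (delta_mx i j) u.
Proof.
move=> neq_ij Uu; rewrite !rmorphB /= !natb_intr; apply: (mxm_eigen hU) => //.
- exact: coroot_traceless.
- exact: root_traceless.
- exact: comm_coroot_root.
Qed.

(** The Cartan subalgebra is spanned by the coroots relative to the first index [o], and a traceless
    diagonal [A] has its own entries as coefficients. Here [z o = 0], and [z i - z j] is 0 or 1 for
    [i < j], so [z] is 0 on an initial segment and -1 afterwards. *)
Lemma typeS_highest_weight (n_gt0 : (0 < n)%N) :
  exists2 k, (k <= n.-1)%N & exists v, [/\ U v, v <> 0,
    forall i j : 'I_n, (i < j)%N -> tau (delta_mx i j) v = 0 &
    forall A, is_diag_mx A -> \tr A = 0 -> tau A v = (\sum_(i < n | (i < k)%N) A i i) *: v].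
Proof.
pose o := Ordinal n_gt0; have [u Uu u0] := mxm_nonzero hU.
pose B := {ij : 'I_n * 'I_n | (ij.1 < ij.2)%N}.
have neqB (b : B) : (val b).1 != (val b).2.
  by rewrite -val_eqE /= neq_ltn (valP b).
(* With the weights [- l], the vector [delta_mx i j] raises the sum by [j - i], plus the sum of all
   [l] when [i = o]. *)
have [||||||v [z [Uv v0 Ev Hv]]] := @highest_weight_vector F M U (mxm_subspace hU) 'I_n B
  (fun l => tau (coroot l o)) (fun b => tau (delta_mx (val b).1 (val b).2))
  (fun b l => (l == (val b).1)%:R - (l == (val b).2)%:R
     - ((o == (val b).1)%:R - (o == (val b).2)%:R))
  (fun l => - (l : nat)%:Z) _ _ _ _ _ _ u Uu u0.
- by move=> i w; apply: (mxm_stable hU); apply: coroot_traceless.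
- by move=> b w; apply: (mxm_stable hU); apply: root_traceless.
- move=> i j w Uw; apply: (mxm_commute hU) => //; try exact: coroot_traceless.
  by apply: diag_commute; apply: coroot_diag.
- by move=> i w; apply: coroot_cube.
- by move=> l b w; apply: coroot_root_eigen.
- move=> [[i j] /= ltij].
  have -> : (o == j) = false by rewrite -val_eqE /= ltn_eqF // (leq_ltn_trans _ ltij).
  under eq_bigr do rewrite mulrBr mulrBr.
  rewrite !big_split !sumrN !sum_mul_pred1 /= -mulr_suml sumrN subr0.
  rewrite mulNr opprK; have : 0 <= \sum_(l < n) (l : nat)%:Z by apply: sumr_ge0.
  by move: (\sum_(l < n) _) => S; case: (o == i) => /=; lia.
have Ev' (i j : 'I_n) : (i < j)%N -> tau (delta_mx i j) v = 0.
  by move=> ltij; apply: (Ev (exist _ (i, j) ltij)).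
have zo : z o = 0.
  have := Hv o; rewrite /coroot subrr (mxm0 hU Uv) => /esym/eqP.
  by rewrite scaler_eq0 intr_eq0 => /orP[/eqP|/eqP].
have zle (i j : 'I_n) : (i < j)%N -> (z i - z j == 0) || (z i - z j == 1).
  move=> ltij; have neq_ij : i != j by rewrite -val_eqE /= neq_ltn ltij.
  apply: (coroot_highest neq_ij Uv v0); first exact: Ev'.
  rewrite rmorphB /= scalerBl -!Hv -(mxmB hU) //; try exact: coroot_traceless.
  by rewrite /coroot opprB addrA subrK.
have z01 (j : 'I_n) : (z j == 0) || (z j == -1).
  have [->|neq_jo] := eqVneq j o; first by rewrite zo eqxx.
  have lt0j : (o < j)%N by rewrite /= lt0n; apply: contra neq_jo => /eqP e; apply/eqP/val_inj.
  by have := zle o j lt0j; rewrite zo; lia.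
have [i j ltij /eqP zj0|k lekn zk] := @initial_segment n (fun i => z i == 0).
  by have := zle i j ltij; have := z01 i; rewrite zj0; lia.
have weight A : is_diag_mx A -> \tr A = 0 -> tau A v = (\sum_(i < n | (i < k)%N) A i i) *: v.
  move=> /is_diag_mxP dA trA.
  have {1}-> : A = \sum_l A l l *: coroot l o.
    rewrite [LHS]matrix_sum_delta; under [RHS]eq_bigr do rewrite scalerBr.
    rewrite sumrB -scaler_suml [X in _ - X *: _](_ : _ = \tr A) // trA scale0r subr0.
    apply: eq_bigr => i _; rewrite (bigD1 i) //= big1 ?addr0 // => j neq_ji.
    by rewrite dA ?scale0r // eq_sym.
  rewrite (mxm_sum hU) // => [|i _]; last first.
    by apply: (subspaceZ (mxm_algebra hU)); apply: coroot_traceless.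
  under eq_bigr => l _ do rewrite (mxmZ hU _ (coroot_traceless l o) Uv) Hv scalerA.
  rewrite -scaler_suml; congr (_ *: _).
  (* The eigenvalue is minus the sum of the entries from [k] on; the vanishing trace makes it the
     sum of the first [k] entries. *)
  have /eqP := trA; rewrite /mxtrace (bigID (fun i : 'I_n => (i < k)%N)) /=.
  rewrite addr_eq0 => /eqP->; rewrite (bigID (fun i : 'I_n => (i < k)%N)) /=.
  rewrite [X in X + _]big1 => [|i ltik]; last by move: ltik; rewrite -zk => /eqP->; rewrite mulr0.
  rewrite add0r -sumrN.
  apply: eq_bigr => i; rewrite -zk => zi0; have := z01 i; rewrite (negPf zi0) => /eqP->.
  by rewrite mulrN1.
(* For [k = n] the weight is the trace, which is 0 on sl_n; it is recorded as mu_0 to stay within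
   the rank [n.-1]. *)
have [ltkn|lenk] := ltnP k n.
  exists k; first by rewrite -ltnS prednK.
  by exists v.
exists 0%N => //; exists v; split=> // A dA trA.
rewrite weight //; congr (_ *: v); transitivity (\tr A); last by rewrite trA big_pred0.
by apply: eq_bigl => i; rewrite (leq_trans _ lenk).
Qed.

(** All pairs serve as indices, with 0 at [(o, o)], so that the coefficients of a traceless matrix
    are its entries. *)
Definition traceless_gen (o : 'I_n) (ij : 'I_n * 'I_n) : 'M[F]_n :=
  if ij.1 == ij.2 then coroot ij.1 o else delta_mx ij.1 ij.2.

Lemma traceless_span (o : 'I_n) A : \tr A = 0 -> fspan (traceless_gen o) A.
Proof.
move=> trA; have sG := fspan_subspace (traceless_gen o).
have -> : A = \sum_i \sum_j A i j *: traceless_gen o (i, j).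
  rewrite [LHS]matrix_sum_delta; apply/eqP; rewrite eq_sym -subr_eq0 -sumrB.
  under eq_bigr => i _.
    rewrite -sumrB (bigD1 i) //= big1 ?addr0 => [|j neq_ji]; last first.
      by rewrite /traceless_gen /= eq_sym (negPf neq_ji) subrr.
    rewrite /traceless_gen /= eqxx /coroot scalerBr addrAC subrr sub0r -scaleNr.
    over.
  by rewrite -scaler_suml sumrN -/(\tr A) trA oppr0 scale0r.
apply: (subspace_sum sG) => i _ _; apply: (subspace_sum sG) => j _ _.
by apply: (subspaceZ sG); apply: mem_fspan.
Qed.

Lemma typeS_finite (n_gt0 : (0 < n)%N) : (forall A, P A -> \tr A = 0) ->
  exists b : seq M, forall v, U v <-> lspan b v.
Proof.
move=> trP; pose o := Ordinal n_gt0.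
pose c (ij : 'I_n * 'I_n) : F := (ij.1 == ij.2)%:R.
apply: (mxm_finite hU (G := traceless_gen o) (c := c)).
- move=> [i j]; rewrite /traceless_gen /=; have [_|] := eqVneq i j.
    exact: coroot_traceless.
  exact: root_traceless.
- by move=> A /trP; apply: traceless_span.
move=> [i j] u Uu; rewrite /traceless_gen /c /=; have [_|neq_ij] := eqVneq i j.
  by rewrite coroot_cube // scale1r.
by rewrite sqr_root ?scale0r ?linear0 //; apply: (mxm_stable hU) => //; apply: root_traceless.
Qed.

End TypeA.

(** * Modules over gl_n *)

Section TypeW.
Variables (F : numFieldType) (M : lmodType F) (n : nat).
Variables (tau : 'M[F]_n -> {linear M -> M}) (U : M -> Prop).
Hypothesis hU : irreducible_mx_module (fun=> True) tau U.
Hypothesis sqr_delta : forall i j u, U u ->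
  tau (delta_mx i j) (tau (delta_mx i j) u) = (i == j)%:R *: tau (delta_mx i j) u.

Let sqr_root i j u : i != j -> U u -> tau (delta_mx i j) (tau (delta_mx i j) u) = 0.
Proof. by move=> /negPf neq_ij Uu; rewrite sqr_delta // neq_ij scale0r. Qed.

Lemma typeW_finite : exists b : seq M, forall v, U v <-> lspan b v.
Proof.
pose G (ij : 'I_n * 'I_n) : 'M[F]_n := delta_mx ij.1 ij.2.
pose c (ij : 'I_n * 'I_n) : F := (ij.1 == ij.2)%:R.
apply: (mxm_finite hU (G := G) (c := c)) => //.
- move=> A _; have sG := fspan_subspace G; rewrite -/(fspan G A) (matrix_sum_delta A).
  apply: (subspace_sum sG) => i _ _; apply: (subspace_sum sG) => j _ _.
  by apply: (subspaceZ sG); apply: (mem_fspan G (i, j)).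
move=> [i j] u Uu; rewrite /G /c /= !sqr_delta ?linearZ /= ?sqr_delta //.
  by case: (i == j); rewrite ?scale0r ?scale1r // linear0.
exact: (mxm_stable hU).
Qed.

(** The diagonal units act as idempotents, so their eigenvalues are 0 or 1; the coroots, through
    sl_2, make these eigenvalues decrease with the index. *)
Lemma typeW_highest_weight :
  exists2 k, (k <= n)%N & exists v, [/\ U v, v <> 0,
    forall i j : 'I_n, (i < j)%N -> tau (delta_mx i j) v = 0 &
    forall A, is_diag_mx A -> tau A v = (\sum_(i < n | (i < k)%N) A i i) *: v].
Proof.
have [u Uu u0] := mxm_nonzero hU.
pose B := {ij : 'I_n * 'I_n | (ij.1 < ij.2)%N}.
have [||||||v [z [Uv v0 Ev Hv]]] := @highest_weight_vector F M U (mxm_subspace hU) 'I_n B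
  (fun l => tau (delta_mx l l)) (fun b => tau (delta_mx (val b).1 (val b).2))
  (fun b l => (l == (val b).1)%:R - (l == (val b).2)%:R)
  (fun l => - (l : nat)%:Z) _ _ _ _ _ _ u Uu u0.
- by move=> i w; apply: (mxm_stable hU).
- by move=> b w; apply: (mxm_stable hU).
- move=> i j w Uw; apply: (mxm_commute hU) => //.
  by apply: diag_commute; apply: delta_diag.
- by move=> i w Uw; rewrite !sqr_delta ?eqxx ?scale1r ?sqr_delta ?eqxx ?scale1r //;
    apply: (mxm_stable hU).
- move=> l b w Uw; rewrite rmorphB /= !natb_intr.
  by apply: (mxm_eigen hU) => //; apply: comm_diag_root.
- move=> [[i j] /= ltij].
  under eq_bigr do rewrite mulrBr.
  by rewrite sumrB !sum_mul_pred1; lia.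
have zle (i j : 'I_n) : (i < j)%N -> (z i - z j == 0) || (z i - z j == 1).
  move=> ltij; have neq_ij : i != j by rewrite -val_eqE /= neq_ltn ltij.
  apply: (coroot_highest hU (fun _ _ => I) sqr_root neq_ij Uv v0).
    exact: (Ev (exist _ (i, j) ltij)).
  by rewrite rmorphB /= scalerBl -!Hv -(mxmB hU).
have z01 (j : 'I_n) : (z j == 0) || (z j == 1).
  have := sqr_delta j j Uv; rewrite eqxx scale1r Hv linearZ /= Hv scalerA => /eqP.
  rewrite -subr_eq0 -scalerBl scaler_eq0 => /orP[|/eqP//].
  rewrite -intrM subr_eq0 eqr_int -subr_eq0 -[X in _ - X]mulr1 -mulrBr mulf_eq0.
  by rewrite subr_eq0.
have [i j ltij /eqP zj1|k lekn zk] := @initial_segment n (fun i => z i == 1).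
  by have := zle i j ltij; have := z01 i; rewrite zj1; lia.
exists k => //; exists v; split=> // [i j ltij|A /is_diag_mxP dA].
  exact: (Ev (exist _ (i, j) ltij)).
have {1}-> : A = \sum_l A l l *: delta_mx l l.
  rewrite [LHS]matrix_sum_delta; apply: eq_bigr => i _.
  by rewrite (bigD1 i) //= big1 ?addr0 // => j neq_ji; rewrite dA ?scale0r // eq_sym.
rewrite (mxm_sum hU) //; under eq_bigr => l _ do rewrite (mxmZ hU _ _ Uv) // Hv scalerA.
rewrite -scaler_suml; congr (_ *: _); rewrite [RHS]big_mkcond /=; apply: eq_bigr => i _.
by rewrite -zk; case/orP: (z01 i) => /eqP->; rewrite ?mulr1 ?mulr0.
Qed.

End TypeW.

(** * Modules over sp_2m *)

Section TypeH.
Variables (F : numFieldType) (m : nat).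
Local Notation n := (m + m)%N.
Implicit Types (i j k s : 'I_m) (a b : 'I_n) (A B : 'M[F]_n).
Local Notation lsh := (lshift m).
Local Notation rsh := (@rshift m m).

Definition symplectic_mx : 'M[F]_n :=
  \sum_j (delta_mx (lsh j) (rsh j) - delta_mx (rsh j) (lsh j)).
Local Notation Omega := symplectic_mx.

(** This is sp_2m, parametrized by quadratic forms: multiplication by Omega exchanges it with the
    symmetric matrices, since Omega squares to -1. *)
Definition hamiltonian_mx A := (A *m Omega)^T = A *m Omega.

Lemma mul_delta_symplecticl a j : delta_mx a (lsh j) *m Omega = delta_mx a (rsh j).
Proof.
rewrite /Omega mulmx_sumr (bigD1 j) //= big1 ?addr0 => [|k neq_kj].
  by rewrite mulmxBr !mul_delta_mx_cond eqxx eq_lrshift mulr1n mulr0n subr0.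
rewrite mulmxBr !mul_delta_mx_cond eq_lrshift eq_lshift eq_sym (negPf neq_kj).
by rewrite !mulr0n subr0.
Qed.

Lemma mul_delta_symplecticr a j : delta_mx a (rsh j) *m Omega = - delta_mx a (lsh j).
Proof.
rewrite /Omega mulmx_sumr (bigD1 j) //= big1 ?addr0 => [|k neq_kj].
  by rewrite mulmxBr !mul_delta_mx_cond eqxx eq_rlshift mulr1n mulr0n sub0r.
rewrite mulmxBr !mul_delta_mx_cond eq_rlshift eq_rshift eq_sym (negPf neq_kj).
by rewrite !mulr0n subr0.
Qed.

Definition mul_delta_symplectic := (mul_delta_symplecticl, mul_delta_symplecticr).

Let subE A B a b : (A - B) a b = A a b - B a b. Proof. by rewrite !mxE. Qed.

Lemma mul_mx_deltaE A p q a b : (A *m delta_mx p q) a b = A a p * (b == q)%:R.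
Proof.
rewrite mxE (bigD1 p) //= mxE eqxx big1 ?addr0 // => k neq_kp.
by rewrite mxE (negPf neq_kp) mulr0.
Qed.

Lemma mul_symplecticEr A a j : (A *m Omega) a (rsh j) = A a (lsh j).
Proof.
rewrite mulmx_sumr summxE (bigD1 j) //= big1 ?addr0 => [|k neq_kj].
  by rewrite mulmxBr subE !mul_mx_deltaE eqxx eq_rlshift mulr1 mulr0 subr0.
by rewrite mulmxBr subE !mul_mx_deltaE eq_rlshift eq_rshift eq_sym (negPf neq_kj) !mulr0 subr0.
Qed.

Lemma mul_symplecticEl A a j : (A *m Omega) a (lsh j) = - A a (rsh j).
Proof.
rewrite mulmx_sumr summxE (bigD1 j) //= big1 ?addr0 => [|k neq_kj].
  by rewrite mulmxBr subE !mul_mx_deltaE eqxx eq_lrshift mulr1 mulr0 sub0r.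
by rewrite mulmxBr subE !mul_mx_deltaE eq_lrshift eq_lshift eq_sym (negPf neq_kj) !mulr0 subr0.
Qed.

Lemma trmx_symplectic : Omega^T = - Omega.
Proof.
rewrite /Omega raddf_sum -sumrN; apply: eq_bigr => j _ /=.
by rewrite linearB /= !trmx_delta opprB.
Qed.

Lemma mul_symplecticK A : A *m Omega *m Omega = - A.
Proof.
rewrite {1}(matrix_sum_delta A) [in RHS](matrix_sum_delta A) !mulmx_suml -sumrN.
apply: eq_bigr => a _; rewrite !mulmx_suml -sumrN; apply: eq_bigr => b _.
rewrite -!scalemxAl -scalerN; case: (split_ordP b) => j ->; rewrite !mul_delta_symplectic //.
by rewrite mulNmx mul_delta_symplectic.
Qed.

Lemma hamiltonian_subspace : subspace hamiltonian_mx.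
Proof.
split; first by rewrite /hamiltonian_mx mul0mx trmx0.
move=> c A B; rewrite /hamiltonian_mx => hA hB.
by rewrite mulmxDl -scalemxAl linearD linearZ /= hA hB.
Qed.

Lemma hamiltonian_mxE A : hamiltonian_mx A <-> Omega *m A^T = - (A *m Omega).
Proof.
rewrite /hamiltonian_mx trmx_mul trmx_symplectic mulNmx.
by split=> [<-|->]; rewrite opprK.
Qed.

Lemma hamiltonian_comm A B :
  hamiltonian_mx A -> hamiltonian_mx B -> hamiltonian_mx (A *m B - B *m A).
Proof.
move=> /hamiltonian_mxE hA /hamiltonian_mxE hB; apply/hamiltonian_mxE.
rewrite linearB /= !trmx_mul mulmxBr !mulmxA hA hB !mulNmx -!mulmxA hA hB.
by rewrite !mulmxN !opprK !mulmxA mulmxBl opprB.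
Qed.

Definition short_root i j : 'M[F]_n :=
  delta_mx (lsh i) (lsh j) - delta_mx (rsh j) (rsh i).
Definition long_root k s : 'M[F]_n :=
  delta_mx (lsh s) (rsh k) + delta_mx (lsh k) (rsh s).
Definition symp_coroot i : 'M[F]_n := coroot F (lsh i) (rsh i).

Lemma short_root_hamiltonian i j : hamiltonian_mx (short_root i j).
Proof.
rewrite /hamiltonian_mx mulmxBl !mul_delta_symplectic opprK linearD /= !trmx_delta.
by rewrite addrC.
Qed.

Lemma long_root_hamiltonian k s : hamiltonian_mx (long_root k s).
Proof.
rewrite /hamiltonian_mx mulmxDl !mul_delta_symplectic linearD !linearN /= !trmx_delta.
by rewrite addrC.
Qed.

Lemma symp_coroot_hamiltonian i : hamiltonian_mx (symp_coroot i).
Proof. exact: short_root_hamiltonian. Qed.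

Lemma long_delta_hamiltonian a : hamiltonian_mx (delta_mx a a *m Omega).
Proof. by rewrite /hamiltonian_mx mul_symplecticK linearN /= trmx_delta. Qed.

Lemma upper_root_hamiltonian i : hamiltonian_mx (delta_mx (lsh i) (rsh i)).
Proof. by rewrite -mul_delta_symplectic; apply: long_delta_hamiltonian. Qed.

Lemma lower_root_hamiltonian i : hamiltonian_mx (delta_mx (rsh i) (lsh i)).
Proof.
rewrite -[delta_mx _ _]opprK -mul_delta_symplectic.
exact: (subspaceN hamiltonian_subspace (long_delta_hamiltonian _)).
Qed.

Let shiftE := (@eq_lshift m m, @eq_rshift m m, @eq_lrshift m m, @eq_rlshift m m).

Lemma symp_coroot_sl2 i :
  mx_sl2 hamiltonian_mx (delta_mx (lsh i) (rsh i)) (delta_mx (rsh i) (lsh i)) (symp_coroot i).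
Proof.
split; [exact: upper_root_hamiltonian|exact: lower_root_hamiltonian
  |exact: symp_coroot_hamiltonian|split].
- by rewrite !mul_delta_mx.
- rewrite comm_coroot_root !shiftE !eqxx.
  by congr (_ *: _) => /=; ring.
- rewrite comm_coroot_root !shiftE !eqxx.
  by congr (_ *: _) => /=; ring.
Qed.

Lemma comm_symp_coroot_short l i j :
  symp_coroot l *m short_root i j - short_root i j *m symp_coroot l =
  ((l == i)%:R - (l == j)%:R) *: short_root i j.
Proof.
transitivity ((symp_coroot l *m delta_mx (lsh i) (lsh j) - delta_mx (lsh i) (lsh j) *m symp_coroot l)
  - (symp_coroot l *m delta_mx (rsh j) (rsh i) - delta_mx (rsh j) (rsh i) *m symp_coroot l)).
  by rewrite /short_root; move: (symp_coroot l) => C; rewrite mulmxBr mulmxBl; module_ring 'M[F]_n F.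
by rewrite !comm_coroot_root !shiftE /short_root /=; module_ring 'M[F]_n F.
Qed.

Lemma comm_symp_coroot_long l k s :
  symp_coroot l *m long_root k s - long_root k s *m symp_coroot l =
  ((l == k)%:R + (l == s)%:R) *: long_root k s.
Proof.
transitivity ((symp_coroot l *m delta_mx (lsh s) (rsh k) - delta_mx (lsh s) (rsh k) *m symp_coroot l)
  + (symp_coroot l *m delta_mx (lsh k) (rsh s) - delta_mx (lsh k) (rsh s) *m symp_coroot l)).
  by rewrite /long_root; move: (symp_coroot l) => C; rewrite mulmxDr mulmxDl; module_ring 'M[F]_n F.
by rewrite !comm_coroot_root !shiftE /long_root /=; module_ring 'M[F]_n F.
Qed.

Lemma comm_short_root i j : i != j ->
  short_root i j *m short_root j i - short_root j i *m short_root i j =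
  symp_coroot i - symp_coroot j.
Proof.
move=> neq_ij; rewrite /short_root !mulmxBl !mulmxBr !mul_delta_mx_cond !shiftE !eqxx.
by rewrite /symp_coroot /coroot !mulr1n !mulr0n; module_ring 'M[F]_n F.
Qed.

(** Up to a factor, the linear Hamiltonian field of [(t_a + t_b)^2]. Squares of linear forms are the
    quadratic Hamiltonians to which the finite differences apply. *)
Definition square_mx a b : 'M[F]_n :=
  (delta_mx a a + delta_mx b b + delta_mx a b + delta_mx b a) *m Omega.

Lemma square_mx_hamiltonian a b : hamiltonian_mx (square_mx a b).
Proof.
rewrite /hamiltonian_mx mul_symplecticK linearN /= !linearD /= !trmx_delta.
by rewrite [in LHS]addrAC.
Qed.

(** Polarization: the symmetric matrix [A *m Omega] is a combination of symmetrized matrix units,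
    and the form [t_a t_b] is a combination of squares. *)
Lemma hamiltonian_span A : hamiltonian_mx A ->
  fspan (fun ab : 'I_n * 'I_n => square_mx ab.1 ab.2) A.
Proof.
move=> hA; set G := fun _ => _; have sG := fspan_subspace G.
have symS a b : (A *m Omega) a b = (A *m Omega) b a by rewrite -[in LHS]hA mxE.
have -> : A = \sum_a \sum_b
    (- (A *m Omega) a b / 2) *: (delta_mx a b *m Omega + delta_mx b a *m Omega).
  under eq_bigr => a _ do under eq_bigr => b _ do rewrite scalerDr.
  under eq_bigr => a _ do rewrite big_split.
  rewrite big_split /= [X in _ + X]exchange_big -big_split /=.
  rewrite -[A in LHS]opprK -mul_symplecticK mulNmx.
  rewrite {1}(matrix_sum_delta (- (A *m Omega))) mulmx_suml; apply: eq_bigr => a _.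
  rewrite mulmx_suml -big_split; apply: eq_bigr => b _ /=.
  by rewrite mxE (symS b a) -scalerDl -scalemxAl; congr (_ *: _); field.
apply: (subspace_sum sG) => a _ _; apply: (subspace_sum sG) => b _ _.
apply: (subspaceZ sG).
(* The factor 1/4 appears because [square_mx a a] belongs to [(2 t_a)^2]. *)
have -> : delta_mx a b *m Omega + delta_mx b a *m Omega =
    square_mx a b - 4^-1 *: square_mx a a - 4^-1 *: square_mx b b.
  by rewrite /square_mx !mulmxDl; module_ring 'M[F]_n F.
apply: (subspaceB sG); first apply: (subspaceB sG); last first.
- by apply: (subspaceZ sG); apply: (mem_fspan G (b, b)).
- by apply: (subspaceZ sG); apply: (mem_fspan G (a, a)).
exact: (mem_fspan G (a, b)).
Qed.

Section Module.
Variables (M : lmodType F) (tau : 'M[F]_n -> {linear M -> M}) (U : M -> Prop).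
Hypothesis hU : irreducible_mx_module hamiltonian_mx tau U.
Hypothesis sqr_square : forall a b u, U u ->
  tau (square_mx a b) (tau (square_mx a b) u) = 0.

Lemma typeH_finite : exists b : seq M, forall v, U v <-> lspan b v.
Proof.
apply: (mxm_finite hU (G := fun ab : 'I_n * 'I_n => square_mx ab.1 ab.2) (c := fun=> 0)).
- by move=> ab; apply: square_mx_hamiltonian.
- exact: hamiltonian_span.
- by move=> ab u Uu; rewrite sqr_square ?scale0r //; apply: (mxm_stable hU) (square_mx_hamiltonian _ _) Uu.
Qed.

Lemma sqr_long_delta a u : U u ->
  tau (delta_mx a a *m Omega) (tau (delta_mx a a *m Omega) u) = 0.
Proof.
move=> Uu; have ha := long_delta_hamiltonian a.
have := sqr_square a a Uu.
have -> : square_mx a a = 4 *: (delta_mx a a *m Omega).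
  by rewrite /square_mx !mulmxDl; module_ring 'M[F]_n F.
rewrite !(mxmZ hU) //; last by apply: (subspaceZ (mxm_subspace hU)); apply: (mxm_stable hU).
by rewrite linearZ /= scalerA => /eqP; rewrite scaler_eq0 mulf_eq0 pnatr_eq0 => /eqP.
Qed.

Lemma sqr_upper_root i u : U u ->
  tau (delta_mx (lsh i) (rsh i)) (tau (delta_mx (lsh i) (rsh i)) u) = 0.
Proof. by rewrite -mul_delta_symplectic; apply: sqr_long_delta. Qed.

Lemma sqr_lower_root i u : U u ->
  tau (delta_mx (rsh i) (lsh i)) (tau (delta_mx (rsh i) (lsh i)) u) = 0.
Proof.
move=> Uu; rewrite -[delta_mx _ _]opprK -mul_delta_symplectic.
have hr := long_delta_hamiltonian (rsh i).
rewrite !(mxmN hU) //; first by rewrite linearN opprK sqr_long_delta.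
by apply: (subspaceN (mxm_subspace hU)); apply: (mxm_stable hU).
Qed.

Lemma symp_coroot_commute i j u : U u ->
  tau (symp_coroot i) (tau (symp_coroot j) u) = tau (symp_coroot j) (tau (symp_coroot i) u).
Proof.
move=> Uu; apply: (mxm_commute hU) => //; try exact: symp_coroot_hamiltonian.
by apply: diag_commute; apply: coroot_diag.
Qed.

(** The long roots form sl_2-triples with square-zero root vectors, which puts each [z j] in {0, 1}.
    Short root vectors do not come from squares of linear forms, so the order of the [z j] is
    obtained from the bound [|z| <= 1] on all weights instead. *)
Lemma typeH_highest_weight :
  exists2 k, (k <= m)%N & exists v, [/\ U v, v <> 0,
    forall i j, (i < j)%N -> tau (short_root i j) v = 0,
    forall k s, (k <= s)%N -> tau (long_root k s) v = 0 &
    forall A, is_diag_mx A -> hamiltonian_mx A ->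
      tau A v = (\sum_(i < n | (i < k)%N) A i i) *: v].
Proof.
have sU := mxm_subspace hU; have [u Uu u0] := mxm_nonzero hU.
have hC := symp_coroot_hamiltonian.
pose B := ({ij : 'I_m * 'I_m | (ij.1 < ij.2)%N} + {ks : 'I_m * 'I_m | (ks.1 <= ks.2)%N})%type.
pose E (b : B) := match b with
  | inl ij => short_root (val ij).1 (val ij).2
  | inr ks => long_root (val ks).1 (val ks).2 end.
pose wt (b : B) l : int := match b with
  | inl ij => (l == (val ij).1)%:R - (l == (val ij).2)%:R
  | inr ks => (l == (val ks).1)%:R + (l == (val ks).2)%:R end.
have hE (b : B) : hamiltonian_mx (E b).
  by case: b => b; [apply: short_root_hamiltonian | apply: long_root_hamiltonian].
have stH i w : U w -> U (tau (symp_coroot i) w) by apply: (mxm_stable hU).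
have cubeH i w : U w ->
    tau (symp_coroot i) (tau (symp_coroot i) (tau (symp_coroot i) w)) = tau (symp_coroot i) w.
  by apply: (mx_sl2_cube hU (symp_coroot_sl2 i)) => x Ux; [apply: sqr_upper_root | apply: sqr_lower_root].
(* The weights [m - l] are positive and decreasing in [l], so both the long and the short positive
   roots raise the sum. *)
have [|||||v [z [Uv v0 Ev Hv]]] := @highest_weight_vector F M U sU 'I_m B
  (fun l => tau (symp_coroot l)) (fun b : B => tau (E b)) wt
  (fun l => m%:Z - (l : nat)%:Z) stH _ _ _ _ _ u Uu u0.
- by move=> b w; apply: (mxm_stable hU).
- exact: symp_coroot_commute.
- exact: cubeH.
- move=> l b w Uw; apply: (mxm_eigen hU) => //; case: b => b /=.
    by rewrite rmorphB /= !natb_intr comm_symp_coroot_short.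
  by rewrite rmorphD /= !natb_intr comm_symp_coroot_long.
- move=> [[[i j] /= ltij]|[[i j] /= leij]].
    by under eq_bigr do rewrite mulrBr; rewrite sumrB !sum_mul_pred1; lia.
  under eq_bigr do rewrite mulrDr; rewrite big_split /= !sum_mul_pred1.
  by have := ltn_ord i; have := ltn_ord j; lia.
have Ev1 i j (ltij : (i < j)%N) : tau (short_root i j) v = 0 := Ev (inl (exist _ (i, j) ltij)).
have Ev2 i j (leij : (i <= j)%N) : tau (long_root i j) v = 0 := Ev (inr (exist _ (i, j) leij)).
have z01 j : (z j == 0) || (z j == 1).
  apply: (mx_sl2_highest hU (symp_coroot_sl2 j) _ _ Uv v0); last exact: Hv.
  - by move=> x Ux; apply: sqr_upper_root.
  - by move=> x Ux; apply: sqr_lower_root.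
  (* [long_root j j] is twice the upper root vector. *)
  have := Ev2 j j (leqnn j); rewrite /long_root -mulr2n (mxmMn hU) //.
    by rewrite -[RHS](mul0rn _ 2) => /(@mulr2n_inj F M).
  exact: upper_root_hamiltonian.
have [i j ltij /eqP zj1|k lekn zk] := @initial_segment m (fun i => z i == 1).
  apply: contraT => zi1; have zi0 : z i = 0 by have := z01 i; rewrite (negPf zi1) orbF => /eqP.
  have hji := short_root_hamiltonian j i.
  have Uy : U (tau (short_root j i) v) by apply: (mxm_stable hU).
  (* If [z i = 0] and [z j = 1] with [i < j], this vector would have weight 2 for the coroot of [j].
     It vanishes, and then the bracket of the two opposite short roots, which acts on [v] by
     [z i - z j = -1], gives [v = 0]. *)
  have y0 : tau (short_root j i) v = 0.
    apply: contrapT => y0.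
    have := @eigenvalue_norm_le1 F M U 'I_m (fun l => tau (symp_coroot l)) cubeH j _ 2 Uy y0.
    have neq_ij : (j == i) = false by rewrite -val_eqE /= gtn_eqF.
    rewrite (mxm_eigen hU (hC j) hji Uv (comm_symp_coroot_short _ _ _)) eqxx neq_ij subr0.
    by rewrite Hv zj1 linearZ /= -scalerDl => /(_ erefl).
  have neq_ij : i != j by rewrite -val_eqE /= neq_ltn ltij.
  have := mxm_bracketE hU (short_root_hamiltonian i j) hji Uv (comm_short_root neq_ij).
  rewrite y0 (Ev1 i j ltij) !linear0 add0r (mxmB hU) // !Hv zi0 zj1 scale0r sub0r scale1r.
  by move/esym/eqP; rewrite oppr_eq0 => /eqP.
exists k => //; exists v; split=> // A /is_diag_mxP dA hA.
have Arr i : A (rsh i) (rsh i) = - A (lsh i) (lsh i).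
  have := congr1 (fun C : 'M_n => C (lsh i) (rsh i)) hA.
  by rewrite mxE mul_symplecticEl mul_symplecticEr => <-; rewrite opprK.
have {1}-> : A = \sum_i A (lsh i) (lsh i) *: symp_coroot i.
  transitivity (\sum_a A a a *: delta_mx a a).
    rewrite [LHS]matrix_sum_delta; apply: eq_bigr => a _.
    by rewrite (bigD1 a) //= big1 ?addr0 // => b neq_ba; rewrite dA ?scale0r // eq_sym.
  rewrite big_split_ord /= -big_split; apply: eq_bigr => i _ /=.
  by rewrite Arr scaleNr -scalerBr.
rewrite (mxm_sum hU) //; last by move=> i _; apply: (subspaceZ hamiltonian_subspace).
under eq_bigr => l _ do rewrite (mxmZ hU _ (hC l) Uv) Hv scalerA.
rewrite -scaler_suml; congr (_ *: _); rewrite [RHS]big_mkcond big_split_ord /=.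
rewrite [X in _ + X]big1 ?addr0 => [|i _]; last first.
  by rewrite ltnNge (leq_trans lekn) // leq_addr.
by apply: eq_bigr => i _; rewrite -zk; case/orP: (z01 i) => /eqP->; rewrite ?mulr1 ?mulr0.
Qed.

End Module.
End TypeH.

(** * Polynomial vector fields *)

Section LinearFields.
Variables (F : numFieldType) (n : nat).
Implicit Types (A B : 'M[F]_n) (p q : {mpoly F[n]}) (D : vfield F n).

Lemma mderivXU (i j : 'I_n) : ('X_j : {mpoly F[n]})^`M(i) = (i == j)%:R%:MP.
Proof.
rewrite mderivX mnm1E eq_sym; have [->|_] := eqVneq i j.
  have -> : (U_(j) - U_(j) = 0)%MM by apply/mnmP=> k; rewrite mnmBE subnn mnm0E.
  by rewrite scale1r mpolyX0 mpolyC1.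
by rewrite scale0r mpolyC0.
Qed.

(** Rows index the variable and columns the derivation: [delta_mx i j] becomes [t_i d_j], and
    brackets of fields match commutators of matrices without a sign. *)
Definition lin_field A : vfield F n := [ffun j => \sum_i A i j *: 'X_i].

Lemma lin_fieldP c A B : lin_field (c *: A + B) = c *: lin_field A + lin_field B.
Proof.
apply/ffunP=> j; rewrite !ffunE scaler_sumr -big_split; apply: eq_bigr => i _.
by rewrite !mxE scalerDl scalerA.
Qed.

Lemma lin_field_delta i j : lin_field (delta_mx i j) = single 'X_i j.
Proof.
apply/ffunP=> k; rewrite !ffunE (bigD1 i) //= !mxE eqxx big1 ?addr0 => [|l neq_li].
  by case: eqP => _; rewrite ?scale1r ?scale0r.
by rewrite mxE (negPf neq_li) scale0r.
Qed.

Lemma mcoeff_lin_field A i j : (lin_field A j)@_U_(i) = A i j.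
Proof.
rewrite ffunE raddf_sum (bigD1 i) //= mcoeffZ mcoeffXU eqxx mulr1 big1 ?addr0 //.
by move=> k neq_ki; rewrite mcoeffZ mcoeffXU (negPf neq_ki) mulr0.
Qed.

Lemma mderiv_lin_field A i j : (lin_field A j)^`M(i) = (A i j)%:MP.
Proof.
rewrite ffunE raddf_sum (bigD1 i) //= mderivZ mderivXU eqxx big1 ?addr0.
  by rewrite -mul_mpolyC -mpolyCM mulr1.
by move=> k neq_ki; rewrite mderivZ mderivXU eq_sym (negPf neq_ki) mpolyC0 scaler0.
Qed.


Lemma vf_bracket_lin A B : vf_bracket (lin_field A) (lin_field B) = lin_field (A *m B - B *m A).
Proof.
have half C E j : vf_apply (lin_field C) (lin_field E j) = lin_field (C *m E) j.
  rewrite /vf_apply [RHS]ffunE; under eq_bigr => k _.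
    rewrite mderiv_lin_field mulrC mul_mpolyC ffunE scaler_sumr.
    over.
  rewrite exchange_big; apply: eq_bigr => i _ /=; rewrite mxE scaler_suml.
  by apply: eq_bigr => k _; rewrite scalerA mulrC.
apply/ffunP=> j; rewrite ffunE !half !ffunE -sumrB; apply: eq_bigr => i _.
by rewrite !mxE scalerBl.
Qed.

Lemma homogzP (d : int) p : homogz d p <-> forall m, (mdeg m)%:Z != d -> p@_m = 0.
Proof.
split=> [hp m neq_md|hp m].
  by apply/eqP; rewrite mcoeff_eq0; apply: contra neq_md => /hp->.
by rewrite mcoeff_msupp => pm; apply/eqP; apply: contraR pm => /hp->.
Qed.

Lemma homogz1_lin D : (forall i, homogz 1 (D i)) -> exists A, D = lin_field A.
Proof.
move=> hD; exists (\matrix_(i, j) (D j)@_U_(i)); apply/ffunP=> j; apply/mpolyP=> m.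
have [/eqP/mdeg1P[i /eqP->]|neq_m1] := eqVneq (mdeg m) 1%N.
  by rewrite mcoeff_lin_field mxE.
have /homogzP-> // := hD j; rewrite ffunE raddf_sum big1 // => i _ /=.
rewrite mcoeffZ mcoeffX; case: eqP => [eim|]; last by rewrite mulr0.
by case/eqP: neq_m1; rewrite -eim mdeg1.
Qed.

Lemma homogz_lin A i : homogz 1 (lin_field A i).
Proof.
apply/homogzP=> m neq_m1; rewrite ffunE raddf_sum big1 // => j _ /=.
rewrite mcoeffZ mcoeffX; case: eqP => [ejm|]; last by rewrite mulr0.
by case/eqP: neq_m1; rewrite -ejm mdeg1.
Qed.


(* For an antisymmetric matrix c, the fields d_ij(p) and d_H(p) are special cases. *)
Definition grad_field (c : 'M[F]_n) p : vfield F n := [ffun k => \sum_l c k l *: p^`M(l)].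

Lemma grad_fieldP c a p q : grad_field c (a *: p + q) = a *: grad_field c p + grad_field c q.
Proof.
apply/ffunP=> k; rewrite !ffunE scaler_sumr -big_split; apply: eq_bigr => l _.
by rewrite linearP /= scalerDr !scalerA mulrC.
Qed.

Lemma grad_field1 c : grad_field c 1 = 0.
Proof.
apply/ffunP=> k; rewrite !ffunE big1 // => l _.
by rewrite -mpolyC1 mderivC scaler0.
Qed.

Definition linear_form (xi : 'I_n -> F) : {mpoly F[n]} := \sum_i xi i *: 'X_i.

Lemma mderiv_linear_form xi i : (linear_form xi)^`M(i) = (xi i)%:MP.
Proof.
rewrite raddf_sum (bigD1 i) //= mderivZ mderivXU eqxx big1 ?addr0.
  by rewrite -mul_mpolyC -mpolyCM mulr1.
by move=> k neq_ki; rewrite mderivZ mderivXU eq_sym (negPf neq_ki) mpolyC0 scaler0.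
Qed.

(** An antisymmetric form vanishes on the pair [(xi, xi)]. Consequently the operator of the field
    attached to [x] commutes with multiplication by [x]. *)
Lemma grad_field_linear_form c xi : c^T = - c ->
  vf_apply (grad_field c (linear_form xi)) (linear_form xi) = 0.
Proof.
move=> anti_c; rewrite /vf_apply.
have -> : \sum_(i < n) grad_field c (linear_form xi) i * (linear_form xi)^`M(i)
    = (\sum_i \sum_l c i l * xi l * xi i)%:MP.
  rewrite raddf_sum; apply: eq_bigr => i _ /=.
  rewrite ffunE mderiv_linear_form mulr_suml raddf_sum; apply: eq_bigr => l _ /=.
  by rewrite mderiv_linear_form -mul_mpolyC -!mpolyCM.
set s := \sum_i _; suff -> : s = 0 by rewrite mpolyC0.
have s_opp : s = - s.
  rewrite {1}/s exchange_big -sumrN; apply: eq_bigr => i _ /=.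
  rewrite -sumrN; apply: eq_bigr => l _.
  have -> : c l i = - c i l.
    by have := congr1 (fun C : 'M_n => C i l) anti_c; rewrite !mxE.
  by ring.
have /eqP : s *+ 2 = 0 by rewrite mulr2n {2}s_opp subrr.
by rewrite mulrn_eq0 => /eqP.
Qed.

Lemma grad_field_quadratic c xi i :
  grad_field c (linear_form xi * linear_form xi) i =
  (2 * \sum_l c i l * xi l) *: linear_form xi.
Proof.
rewrite ffunE mulr_sumr scaler_suml; apply: eq_bigr => l _.
rewrite mderivM mderiv_linear_form [X in _ + X]mulrC -mulr2n mul_mpolyC.
by rewrite -scaler_nat !scalerA; congr (_ *: _); ring.
Qed.

Lemma mdeg2P (m : 'X_{1..n}) : mdeg m = 2 -> exists i j, m = (U_(i) + U_(j))%MM.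
Proof.
move=> m2; have [i mi|m0] := pickP (fun i => m i != 0%N); last first.
  by move: m2; rewrite mdegE big1 // => i _; apply/eqP; have /negbFE := m0 i.
have leim : (U_(i) <= m)%MM.
  by apply/mnm_lepP=> j; rewrite mnm1E; case: eqP => [<-|//]; rewrite lt0n.
have m_eq : m = (m - U_(i) + U_(i))%MM by rewrite submK.
have /eqP/mdeg1P[j /eqP mj] : mdeg (m - U_(i)) = 1%N.
  by move: m2; rewrite {1}m_eq mdegD mdeg1 addn1 => -[].
by exists j, i; rewrite -mj.
Qed.

(** The double commutator of a second-order operator with [x] is multiplication by a function, found
    at [p = 1]; the second derivatives of the linear form [x] contribute nothing. *)
Lemma mderivm2_square xi p (m : 'X_{1..n}) : mdeg m = 2 -> let x := linear_form xi in
  (x * x * p)^`M[m] = 2 *: (x * (x * p)^`M[m]) - x * x * p^`M[m] + p * (x * x)^`M[m].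
Proof.
move=> /mdeg2P[i [j ->]] x; rewrite !mderivmDm !mderivmU1m.
rewrite !(mderivM, mderivD, mderiv_linear_form, mderivC).
rewrite -[2 *: _]mul_mpolyC mpolyC_nat; ring.
Qed.

Lemma mderiv_square (x : {mpoly F[n]}) p i :
  (x * x * p)^`M(i) = 2 *: (x * (x * p)^`M(i)) - x * x * p^`M(i).
Proof.
rewrite !mderivM.
rewrite -[2 *: _]mul_mpolyC mpolyC_nat; ring.
Qed.

Lemma grad_field_square c (x : {mpoly F[n]}) p i :
  grad_field c (x * x * p) i =
  2 *: (x * grad_field c (x * p) i) - x * x * grad_field c p i.
Proof.
rewrite !ffunE !mulr_sumr scaler_sumr -sumrB; apply: eq_bigr => l _.
rewrite mderiv_square scalerBr -!scalerAr !scalerA [2 * _]mulrC.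
by congr (_ - _); rewrite -scalerA.
Qed.

Lemma mderivm2_homog q (m : 'X_{1..n}) : homogz 2 q -> mdeg m = 2 ->
  q^`M[m] = ((mfactorial m)%:R * q@_m)%:MP.
Proof.
move=> /homogzP hq m2; apply/mpolyP=> k; rewrite mcoeff_mderivm mcoeffC.
have [->|k0] := eqVneq k 0%MM.
  rewrite addm0 mulr1 mulrC mulr_natr; congr (_ *+ _); apply: eq_bigr => i _.
  by rewrite ffactnn.
rewrite mulr0 hq ?mul0rn // mdegD m2.
by move: k0; rewrite -mdeg_eq0; lia.
Qed.

Lemma homogz2E q : homogz 2 q -> q = \sum_(a : 'X_{1..n < 3} | mdeg a == 2%N) q@_a *: 'X_[a].
Proof.
move=> hq; have szq : (msize q <= 3)%N.
  by rewrite msizeE; apply/bigmax_leqP_seq => m /hq; lia.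
rewrite {1}(mpolywE szq) (bigID (fun a : 'X_{1..n < 3} => mdeg a == 2%N)) /=.
rewrite [X in _ + X]big1 ?addr0 // => a a2.
by have /homogzP-> := hq; rewrite ?scale0r //; move: a2; apply: contra; lia.
Qed.

End LinearFields.

(** * Finite differences of products of fields *)

Section Differences.
Variables (F : numFieldType) (n : nat) (M : lmodType F).
Variable act : {mpoly F[n]} -> {linear M -> M}.
Hypothesis act_linear : forall c f h v, act (c *: f + h) v = c *: act f v + act h v.
Hypothesis act_one : forall v, act 1 v = v.
Hypothesis act_mul : forall f h v, act (f * h) v = act f (act h v).

Lemma act0 v : act 0 v = 0.
Proof.
by have := act_linear (-1) 0 0 v; rewrite scaler0 addr0 scaleN1r addNr.
Qed.

Lemma actD f h v : act (f + h) v = act f v + act h v.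
Proof. by have := act_linear 1 f h v; rewrite !scale1r. Qed.

Lemma actZ c f v : act (c *: f) v = c *: act f v.
Proof. by have := act_linear c f 0 v; rewrite act0 !addr0. Qed.

Lemma actN f v : act (- f) v = - act f v.
Proof. by rewrite -[- f]scaleN1r actZ scaleN1r. Qed.

Lemma act_sum (I : Type) (r : seq I) (P : pred I) (f : I -> {mpoly F[n]}) v :
  act (\sum_(i <- r | P i) f i) v = \sum_(i <- r | P i) act (f i) v.
Proof.
apply: (big_morph (fun f => act f v)) => [f1 f2|]; [exact: actD|exact: act0].
Qed.

(* The fourth finite difference in s of x^(4-s) (x) x^s f isolates the product
   of the leading symbols of two second-order operators. *)
Lemma fourth_difference (D : {mpoly F[n]} -> {linear M -> M}) (h : {linear M -> M})
    (x f : {mpoly F[n]}) (v : M) :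
    (forall w, D 1 w = 0) ->
    (forall p w, D (x * (x * p)) w =
      2 *: act x (D (x * p) w) - act x (act x (D p w)) + act p (h w)) ->
    (forall w, D x (act x w) = act x (D x w)) ->
    (forall p w, h (act p w) = act p (h w)) ->
  D (x * (x * (x * x))) (D f v) - 4 *: D (x * (x * x)) (D (x * f) v)
  + 6 *: D (x * x) (D (x * (x * f)) v) - 4 *: D x (D (x * (x * (x * f))) v)
  = 6 *: act f (h (h v)).
Proof.
move=> D1 Dxx Dx hact.
(* [D(x^k) = k x^(k-1) D(x) + binom(k,2) x^(k-2) h]. The binomial sum has only four terms because
   the one with [D 1] is 0. The coefficient of [f h^2] sums [(-1)^s binom(4,s) binom(4-s,2)
   binom(s,2)], where only [s = 2] survives and gives 6. *)
have D2 w : D (x * x) w = 2 *: act x (D x w) + h w.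
  by have := Dxx 1 w; rewrite mulr1 D1 !linear0 addr0 act_one.
have D3 w : D (x * (x * x)) w =
    3 *: act x (act x (D x w)) + 3 *: act x (h w).
  by rewrite Dxx D2 linearD linearZ /=; module_ring M F.
have D4 w : D (x * (x * (x * x))) w =
    4 *: act x (act x (act x (D x w))) + 6 *: act x (act x (h w)).
  by rewrite Dxx D3 D2 act_mul !(linearD, linearZ) /=; module_ring M F.
have E3 : D (x * (x * (x * f))) v = 3 *: act x (act x (D (x * f) v))
    - 2 *: act x (act x (act x (D f v))) + 3 *: act x (act f (h v)).
  by rewrite !Dxx act_mul !(linearD, linearN, linearZ) /=; module_ring M F.
rewrite D4 D3 E3 !Dxx D2 !(linearD, linearN, linearZ) /=.
rewrite !(hact, Dx); module_ring M F.
Qed.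

(** In type W a single commutator of [D] with [x] is already of order zero, so the second difference
    suffices. The term with [d] records that [D 1] does not commute with [x]. *)
Lemma second_difference (D : {mpoly F[n]} -> {linear M -> M}) (e : {linear M -> M})
    (x f : {mpoly F[n]}) (d : F) (v : M) :
    (forall p w, D (x * p) w = act x (D p w) + act p (e w)) ->
    (forall w, D 1 (act x w) = act x (D 1 w) + d *: w) ->
    (forall p w, e (act p w) = act p (e w)) ->
  D (x * x) (D f v) - 2 *: D x (D (x * f) v) + D 1 (D (x * (x * f)) v)
  = 2 *: act f (d *: e v - e (e v)).
Proof.
move=> Dx D1 eact.
have D1x w : D x w = act x (D 1 w) + e w by rewrite -[X in D X]mulr1 Dx act_one.
rewrite !Dx !D1x act_mul !(linearD, linearN, linearZ) /=.
rewrite !(D1, linearD) /= !(eact, D1, linearD, linearZ) /=.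
module_ring M F.
Qed.

Lemma sum_act_single (p : {mpoly F[n]}) i (w : 'I_n -> M) :
  \sum_k act (single p i k) (w k) = act p (w i).
Proof.
rewrite (bigD1 i) //= ffunE eqxx big1 ?addr0 // => k /negPf neq_ki.
by rewrite ffunE neq_ki act0.
Qed.

Section SecondOrder.
Variables (r s : vfield F n -> {linear M -> M}) (Q Q0 : vfield F n -> Prop).
Hypothesis sQ0 : subspace Q0.
Hypothesis r0 : forall v, r 0 v = 0.
Hypothesis s_linear : forall c D E v, Q0 D -> Q0 E -> s (c *: D + E) v = c *: s D v + s E v.
Hypothesis s_act : forall D f v, Q0 D -> s D (act f v) = act f (s D v).
Hypothesis r_act : forall D f v, Q D ->
  r D (act f v) = act f (r D v) + act (vf_apply D f) v.
Variable c : 'M[F]_n.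
Hypothesis anti_c : c^T = - c.
Hypothesis gradQ : forall p, Q (grad_field c p).
Hypothesis gradQ0 : forall q, homogz 2 q -> Q0 (grad_field c q).
Hypothesis r_grad : forall p v, r (grad_field c p) v =
  \sum_k act (grad_field c p k) (r (single 1 k) v) + order2_term act s (grad_field c) p v.

Lemma s_sum (I : finType) (P : pred I) (G : I -> vfield F n) (a : I -> F) v :
  (forall i, P i -> Q0 (G i)) ->
  s (\sum_(i | P i) a i *: G i) v = \sum_(i | P i) a i *: s (G i) v.
Proof.
move=> hG; pose R D w := Q0 D /\ s D v = w.
have s0 : s 0 v = 0.
  have := s_linear (-1) v (subspace0 sQ0) (subspace0 sQ0).
  by rewrite scaler0 addr0 scaleN1r addNr.
suff [] : R (\sum_(i | P i) a i *: G i) (\sum_(i | P i) a i *: s (G i) v) by [].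
apply: (big_ind2 R).
- by split=> //; apply: subspace0.
- move=> D w E w' [QD <-] [QE <-]; split; first exact: subspaceD.
  by have := s_linear 1 v QD QE; rewrite !scale1r.
- move=> i Pi; split; first by apply: subspaceZ => //; apply: hG.
  have := s_linear (a i) v (hG i Pi) (subspace0 sQ0).
  by rewrite !addr0 s0 addr0.
Qed.

Lemma grad_field_sum (I : finType) (P : pred I) (G : I -> {mpoly F[n]}) (a : I -> F) :
  grad_field c (\sum_(i | P i) a i *: G i) = \sum_(i | P i) a i *: grad_field c (G i).
Proof.
apply: (big_ind2 (fun p D => grad_field c p = D)).
- have := grad_fieldP c (-1) 0 0; rewrite scaler0 addr0 => ->.
  by rewrite scaleN1r addNr.
- by move=> p D q E <- <-; have := grad_fieldP c 1 p q; rewrite !scale1r.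
- move=> i _; have := grad_fieldP c (a i) (G i) 0; rewrite addr0 => ->.
  have := grad_fieldP c (-1) 0 0; rewrite scaler0 addr0 => ->.
  by rewrite scaleN1r addNr addr0.
Qed.

Lemma homogz2_monomial (a : 'X_{1..n}) : mdeg a = 2 -> homogz 2 ('X_[a] : {mpoly F[n]}).
Proof. by move=> a2 k; rewrite msuppX inE => /eqP->; rewrite a2. Qed.

(** The second derivative of a quadratic [q] along [a] is [a!] times a coefficient of [q]. This
    cancels the factor [1/a!], and the Taylor sum becomes a single value of [s]. *)
Lemma order2_homog q p v : homogz 2 q ->
  \sum_(a : 'X_{1..n < 3} | mdeg a == 2%N)
    ((mfactorial a)%:R^-1 : F) *: act (p * q^`M[a]) (s (grad_field c 'X_[a]) v)
  = act p (s (grad_field c q) v).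
Proof.
move=> hq; rewrite {2}(homogz2E hq) grad_field_sum s_sum => [|a /eqP a2]; last first.
  exact/gradQ0/homogz2_monomial.
rewrite linear_sum; apply: eq_bigr => a /eqP a2 /=.
rewrite mderivm2_homog // [p * _]mulrC mul_mpolyC actZ scalerA mulrA mulVf ?mul1r ?linearZ //.
rewrite pnatr_eq0 -lt0n /mfactorial; apply/prodn_gt0 => i; exact: fact_gt0.
Qed.

Lemma r_homog2 q v : homogz 2 q ->
  r (grad_field c q) v =
  \sum_k act (grad_field c q k) (r (single 1 k) v) + s (grad_field c q) v.
Proof.
move=> hq; rewrite r_grad; congr (_ + _); rewrite -[RHS]act_one -order2_homog //.
by apply: eq_bigr => a _; rewrite mul1r.
Qed.

Section Square.
Variable xi : 'I_n -> F.
Let x : {mpoly F[n]} := linear_form xi.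

Lemma homogz_linear_form_sqr : homogz 2 (x * x).
Proof.
have hx : x = \sum_i xi i *: 'X_i by [].
move: hx; move: (x) => y ->; apply/homogzP => m m2.
rewrite mulr_suml raddf_sum big1 //= => i _; rewrite mulr_sumr raddf_sum big1 //= => j _.
rewrite -scalerAl -scalerAr !mcoeffZ -mpolyXD mcoeffX.
case: eqP => [em|_]; last by rewrite !mulr0.
by move: m2; rewrite -em mdegD !mdeg1.
Qed.

(** The first-order part of [r_grad] has zero double commutator with [x]; the second-order part
    contributes the functions of [mderivm2_square], which [order2_homog] gathers into the field of
    [x^2]. *)
Lemma r_grad_square p v : r (grad_field c (x * (x * p))) v =
  2 *: act x (r (grad_field c (x * p)) v) - act x (act x (r (grad_field c p) v))
  + act p (s (grad_field c (x * x)) v).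
Proof.
rewrite !r_grad -order2_homog; last exact: homogz_linear_form_sqr.
have -> : \sum_k act (grad_field c (x * (x * p)) k) (r (single 1 k) v) =
    2 *: act x (\sum_k act (grad_field c (x * p) k) (r (single 1 k) v))
    - act x (act x (\sum_k act (grad_field c p k) (r (single 1 k) v))).
  rewrite !(raddf_sum, scaler_sumr) /= -big_split; apply: eq_bigr => k _ /=.
  by rewrite mulrA grad_field_square actD actN actZ !act_mul.
have -> : order2_term act s (grad_field c) (x * (x * p)) v =
    2 *: act x (order2_term act s (grad_field c) (x * p) v)
    - act x (act x (order2_term act s (grad_field c) p v))
    + \sum_(a : 'X_{1..n < 3} | mdeg a == 2%N)
      ((mfactorial a)%:R^-1 : F) *: act (p * (x * x)^`M[a]) (s (grad_field c 'X_[a]) v).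
  rewrite /order2_term !(raddf_sum, scaler_sumr) /= -!big_split; apply: eq_bigr => a /eqP a2 /=.
  rewrite mulrA (mderivm2_square xi p a2) -/x !actD actN actZ !act_mul !linearZ /=.
  by module_ring M F.
by rewrite !linearD /=; module_ring M F.
Qed.

Lemma square_stable (M' : M -> Prop) f v : subspace M' ->
    (forall D w, Q D -> M' w -> M' (r D w)) -> M' v ->
  M' (act f (s (grad_field c (x * x)) (s (grad_field c (x * x)) v))).
Proof.
move=> sM' stM' M'v; set h := s _.
have st p w : M' w -> M' (r (grad_field c p) w) by apply: stM'.
have D1 w : r (grad_field c 1) w = 0 by rewrite grad_field1 r0.
have Dx w : r (grad_field c x) (act x w) = act x (r (grad_field c x) w).
  by rewrite r_act // grad_field_linear_form // act0 addr0.
have hact p w : h (act p w) = act p (h w).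
  by apply: s_act; apply: gradQ0; apply: homogz_linear_form_sqr.
have E := @fourth_difference (fun p => r (grad_field c p)) h x f v D1 r_grad_square Dx hact.
have M'6 : M' (6 *: act f (h (h v))).
  rewrite -E; apply: subspaceB => //; last by apply: subspaceZ => //; do 2!apply: (st).
  apply: subspaceD => //; last by apply: subspaceZ => //; do 2!apply: (st).
  apply: subspaceB => //; first by do 2!apply: (st).
  by apply: subspaceZ => //; do 2!apply: (st).
have n6 : (6 : F) != 0 by rewrite pnatr_eq0.
by have := subspaceZ sM' 6^-1 M'6; rewrite scalerA mulVf // scale1r.
Qed.

End Square.
End SecondOrder.
End Differences.

(** * The fields d_ij and d_H as gradient fields *)

Section GradFields.
Variables (F : numFieldType) (n : nat).
Implicit Types (c : 'M[F]_n) (f : {mpoly F[n]}).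

Lemma lin_fieldZ a (A : 'M[F]_n) : lin_field (a *: A) = a *: lin_field A.
Proof.
have lin0 : lin_field (0 : 'M[F]_n) = 0.
  by have := lin_fieldP (-1) (0 : 'M[F]_n) 0; rewrite scaler0 addr0 scaleN1r addNr.
by have := lin_fieldP a A 0; rewrite lin0 !addr0.
Qed.

Lemma lin_field0 : lin_field (0 : 'M[F]_n) = 0.
Proof. by rewrite -(scale0r (0 : 'M[F]_n)) lin_fieldZ scale0r. Qed.

Lemma lin_fieldD (A B : 'M[F]_n) : lin_field (A + B) = lin_field A + lin_field B.
Proof. by have := lin_fieldP 1 A B; rewrite !scale1r. Qed.

Lemma lin_fieldB (A B : 'M[F]_n) : lin_field (A - B) = lin_field A - lin_field B.
Proof. by rewrite lin_fieldD -[- B]scaleN1r lin_fieldZ scaleN1r. Qed.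

Lemma grad_field_delta a b f : grad_field (delta_mx a b) f = single f^`M(b) a.
Proof.
apply/ffunP=> k; rewrite !ffunE (bigD1 b) //= mxE eqxx andbT big1 ?addr0.
  by case: eqP; rewrite ?scale1r ?scale0r.
by move=> l neq_lb; rewrite mxE (negPf neq_lb) andbF scale0r.
Qed.

Lemma grad_fieldBl c c' f : grad_field (c - c') f = grad_field c f - grad_field c' f.
Proof.
apply/ffunP=> k; rewrite !ffunE -sumrB; apply: eq_bigr => l _.
by rewrite !mxE scalerBl.
Qed.

Lemma grad_field_suml (I : finType) (G : I -> 'M[F]_n) f :
  grad_field (\sum_i G i) f = \sum_i grad_field (G i) f.
Proof.
apply/ffunP=> k; rewrite !ffunE sum_ffunE.
under [RHS]eq_bigr do rewrite ffunE.
rewrite exchange_big; apply: eq_bigr => l _ /=.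
by rewrite summxE scaler_suml.
Qed.

Lemma grad_field_sqr c (xi : 'I_n -> F) :
  grad_field c (linear_form xi * linear_form xi) =
  lin_field (2 *: ((\matrix_(k, l) (xi k * xi l)) *m c^T)).
Proof.
apply/ffunP=> i; rewrite grad_field_quadratic ffunE scaler_sumr.
apply: eq_bigr => k _; rewrite scalerA !mxE; congr (_ *: _).
rewrite -mulrA mulr_suml; congr (_ * _); apply: eq_bigr => l _.
by rewrite !mxE; ring.
Qed.

Definition skew_mx (i j : 'I_n) : 'M[F]_n := delta_mx i j - delta_mx j i.

Lemma skew_mx_anti i j : (skew_mx i j)^T = - skew_mx i j.
Proof. by rewrite linearB /= !trmx_delta opprB. Qed.

Lemma d_ijE i j : @d_ij F n i j = grad_field (skew_mx i j).
Proof. by apply/funext=> f; rewrite grad_fieldBl !grad_field_delta. Qed.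

End GradFields.

(** The minus sign arises because [d_H] has [d_j f] in position [m + j], whereas Omega has 1 in row
    [j], column [m + j]. *)
Lemma d_HE (F : numFieldType) m : @d_H F m = grad_field (- symplectic_mx F m).
Proof.
apply/funext=> f; rewrite /symplectic_mx -sumrN grad_field_suml /d_H -sumrB.
by apply: eq_bigr => j _; rewrite opprB grad_fieldBl !grad_field_delta.
Qed.

(** * Fields of degree zero as matrices *)

Definition mxX (F : numFieldType) n (X : cartan_type n) : 'M[F]_n -> Prop :=
  match X in cartan_type n return 'M[F]_n -> Prop with
  | typeW _ => fun=> True
  | typeS _ => fun A => \tr A = 0
  | typeH _ => fun A => hamiltonian_mx A
  end.

Section Correspondence.
Variable F : numFieldType.

Lemma mxX_subspace n (X : cartan_type n) : subspace (@mxX F n X).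
Proof.
case: X => {}n //=; last exact: hamiltonian_subspace.
by split=> [|c A B]; rewrite ?mxtrace0 // mxtraceD mxtraceZ => -> ->; rewrite mulr0 addr0.
Qed.

Lemma mxX_comm n (X : cartan_type n) (A B : 'M[F]_n) :
  mxX X A -> mxX X B -> mxX X (A *m B - B *m A).
Proof.
case: X A B => {}n A B //=; last exact: hamiltonian_comm.
by move=> _ _; rewrite linearB /= mxtrace_mulC subrr.
Qed.

Lemma inX_subspace n (X : cartan_type n) : subspace (@inX F n X).
Proof.
case: X => {}n //=.
  split=> [|c D E D0 E0]; first by rewrite big1 // => i _; rewrite ffunE mderiv0.
  under eq_bigr do rewrite !ffunE linearP /=.
  by rewrite big_split -scaler_sumr /= D0 E0 scaler0 addr0.
split=> [|c _ _ [f ->] [h ->]]; last by exists (c *: f + h); rewrite d_HE grad_fieldP.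
exists 0; rewrite d_HE; have := grad_fieldP (- symplectic_mx F n) (-1) 0 0.
by rewrite scaler0 addr0 scaleN1r addNr.
Qed.

Lemma inX_skew n i j (f : {mpoly F[n]}) : inX (typeS n) (grad_field (skew_mx F i j) f).
Proof.
rewrite /= grad_fieldBl !grad_field_delta.
have sum1 p k : \sum_(l < n) (single p k l)^`M(l) = p^`M(k) :> {mpoly F[n]}.
  rewrite (bigD1 k) //= ffunE eqxx big1 ?addr0 // => l /negPf neq_lk.
  by rewrite ffunE neq_lk mderiv0.
have subE (D E : vfield F n) k : (D - E) k = D k - E k by rewrite !ffunE.
under eq_bigr do rewrite subE linearB /=.
by rewrite sumrB !sum1 mderiv_comm subrr.
Qed.

Definition pair_form n (a b : 'I_n) : 'I_n -> F := fun k => (k == a)%:R + (k == b)%:R.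

Lemma lin_square_mx m (a b : 'I_(m + m)) :
  grad_field (- symplectic_mx F m)
    (linear_form (pair_form a b) * linear_form (pair_form a b)) =
  lin_field (2 *: square_mx F a b).
Proof.
rewrite grad_field_sqr linearN /= trmx_symplectic opprK; congr lin_field.
congr (_ *: (_ *m _)); apply/matrixP=> k l; rewrite !mxE /pair_form.
by rewrite -!mulnb !natrM; ring.
Qed.

Lemma inX_lin n (X : cartan_type n) (A : 'M[F]_n) : inX X (lin_field A) <-> mxX X A.
Proof.
case: X A => {}n A //=.
  under eq_bigr do rewrite mderiv_lin_field.
  rewrite -raddf_sum /= -/(\tr A).
  by split=> [/eqP|->]; rewrite ?mpolyC0 // mpolyC_eq0 => /eqP.
split=> [[f Df]|/hamiltonian_span[d ->]].
  (* [H] is the Hessian of [f] at the origin: only the quadratic part of [f] contributes to a linear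
     field. *)
  pose H := \matrix_(a, l) (f^`M(l))@_U_(a) : 'M[F]_(n + n).
  have symH : H^T = H.
    by apply/matrixP=> a l; rewrite !mxE !mcoeff_mderiv !mnm1E addmC [a == l]eq_sym.
  have -> : A = H *m symplectic_mx F n.
    apply/matrixP=> a k; rewrite -mcoeff_lin_field Df d_HE ffunE raddf_sum mxE.
    apply: eq_bigr => l _ /=; rewrite mcoeffZ !mxE mulrC; congr (_ * _).
    by have := congr1 (fun C : 'M_(n + n) => C l k) (trmx_symplectic F n); rewrite !mxE => ->; rewrite opprK.
  by rewrite /hamiltonian_mx mul_symplecticK linearN /= symH.
have sX := inX_subspace (typeH n).
apply: (big_ind (fun B => inX (typeH n) (lin_field B))).
- by rewrite lin_field0; apply: (subspace0 sX).
- by move=> B C hB hC; rewrite lin_fieldD; apply: (subspaceD sX).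
move=> [a b] _; rewrite lin_fieldZ; apply: (subspaceZ sX) => /=.
set x := linear_form (pair_form a b); exists (2^-1 *: (x * x)).
have := grad_fieldP (- symplectic_mx F n) 2^-1 (x * x) 0.
rewrite d_HE addr0 => ->; rewrite lin_square_mx lin_fieldZ scalerA mulVf ?pnatr_eq0 // scale1r.
have := grad_fieldP (- symplectic_mx F n) (-1) 0 0.
by rewrite scaler0 addr0 scaleN1r addNr => ->; rewrite addr0.
Qed.

Lemma inX0_lin n (X : cartan_type n) (D : vfield F n) :
  inX0 X D <-> exists2 A, mxX X A & D = lin_field A.
Proof.
split=> [[XD /homogz1_lin[A DA]]|[A XA ->]].
  by exists A => //; apply/inX_lin; rewrite -DA.
by split; [apply/inX_lin | apply: homogz_lin].
Qed.

Lemma inX0_subspace n (X : cartan_type n) : subspace (@inX0 F n X).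
Proof.
have sX := mxX_subspace X; split; first by apply/inX0_lin; exists 0; rewrite ?lin_field0 //; case: sX.
move=> c _ _ /inX0_lin[A XA ->] /inX0_lin[B XB ->]; apply/inX0_lin.
by exists (c *: A + B); [apply: (proj2 sX) | rewrite lin_fieldP].
Qed.

Lemma grad_field_homog2 n (c : 'M[F]_n) q : homogz 2 q -> forall i, homogz 1 (grad_field c q i).
Proof.
move=> /homogzP hq i; apply/homogzP=> m m1; rewrite ffunE raddf_sum big1 // => l _ /=.
rewrite mcoeffZ mcoeff_mderiv hq ?mul0rn ?mulr0 // mdegD mdeg1.
by move: m1; lia.
Qed.

Lemma single1_inX n (X : cartan_type n) i : inX X (single 1 i : vfield F n).
Proof.
have d1 (k l : 'I_n) : (single 1 k l : {mpoly F[n]})^`M(l) = 0.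
  by rewrite ffunE; case: eqP; rewrite ?mderiv0 // -mpolyC1 mderivC.
case: X i d1 => {}n i d1 //=; first by rewrite big1.
have sX := inX_subspace (typeH n).
have gradX (a : 'I_(n + n)) : d_H ('X_a : {mpoly F[n + n]}) =
    \sum_(j < n) single ((lshift n j == a)%:R%:MP) (rshift n j)
    - \sum_(j < n) single ((rshift n j == a)%:R%:MP) (lshift n j).
  by rewrite /d_H; under eq_bigr do rewrite mderivXU; under [X in _ - X]eq_bigr do rewrite mderivXU.
have s0 k : single 0 k = 0 :> vfield F (n + n).
  by apply/ffunP=> l; rewrite !ffunE; case: ifP.
(* [d_j] is the Hamiltonian field of [- t_(m+j)], and [d_(m+j)] that of [t_j]. *)
case: (split_ordP i) => j ->.
  exists (- 'X_(rshift n j)); rewrite d_HE.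
  have := grad_fieldP (- symplectic_mx F n) (-1) 'X_(rshift n j) 0; rewrite addr0 scaleN1r => ->.
  have := grad_fieldP (- symplectic_mx F n) (-1) 0 0.
  rewrite scaler0 addr0 scaleN1r addNr => ->; rewrite addr0 -d_HE gradX scaleN1r opprB.
  rewrite (bigD1 j) //= eqxx mpolyC1 !big1 ?addr0 ?subr0 // => k.
    by rewrite eq_lrshift mpolyC0 s0.
  by rewrite eq_rshift => /negPf->; rewrite mpolyC0 s0.
exists 'X_(lshift n j); rewrite gradX.
rewrite (bigD1 j) //= eqxx mpolyC1 !big1 ?addr0 ?subr0 // => k.
  by rewrite eq_rlshift mpolyC0 s0.
by rewrite eq_lshift => /negPf->; rewrite mpolyC0 s0.
Qed.

End Correspondence.

(** * Quadratic operators on rho-submodules, type by type *)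

Section VectorFieldModules.
Variable F : numFieldType.

(** The vector-field part of an [AnL_module], isolated so that the three types can be treated
    without toroidal coordinates. *)
Record vfield_module n (X : cartan_type n) (M : lmodType F)
    (act : {mpoly F[n]} -> {linear M -> M}) (r s : vfield F n -> {linear M -> M}) : Prop :=
  VfieldModule {
  vfm_act_linear : forall c f h v, act (c *: f + h) v = c *: act f v + act h v;
  vfm_act_one : forall v, act 1 v = v;
  vfm_act_mul : forall f h v, act (f * h) v = act f (act h v);
  vfm_r_linear : forall c D E v, inX X D -> inX X E -> r (c *: D + E) v = c *: r D v + r E v;
  vfm_s_linear : forall c D E v, inX0 X D -> inX0 X E -> s (c *: D + E) v = c *: s D v + s E v;
  vfm_r_act : forall D f v, inX X D -> r D (act f v) = act f (r D v) + act (vf_apply D f) v;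
  vfm_s_act : forall D f v, inX0 X D -> s D (act f v) = act f (s D v);
  vfm_compatible : vfield_compatible X act r s
}.

Section Theory.
Variables (n : nat) (X : cartan_type n) (M : lmodType F).
Variables (act : {mpoly F[n]} -> {linear M -> M}) (r s : vfield F n -> {linear M -> M}).
Hypothesis hM : vfield_module X act r s.

Lemma vfm_r0 v : r 0 v = 0.
Proof.
have X0 := subspace0 (inX_subspace F X).
by have := vfm_r_linear hM (-1) v X0 X0; rewrite scaler0 addr0 scaleN1r addNr.
Qed.

Lemma vfm_s_lin c A B v : mxX X A -> mxX X B ->
  s (lin_field (c *: A + B)) v = c *: s (lin_field A) v + s (lin_field B) v.
Proof.
by move=> XA XB; rewrite lin_fieldP (vfm_s_linear hM) //; apply/inX0_lin; [exists A|exists B].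
Qed.

Lemma vfm_sZ c A v : mxX X A -> s (lin_field (c *: A)) v = c *: s (lin_field A) v.
Proof.
move=> XA; have X0 := subspace0 (mxX_subspace F X).
have s0 : s (lin_field 0) v = 0.
  by have := vfm_s_lin (-1) v X0 X0; rewrite scaler0 addr0 scaleN1r addNr.
by have := vfm_s_lin c v XA X0; rewrite s0 !addr0.
Qed.

(** Read backwards, it expresses [s] through [r] and A_n; this is how stability under rho and A_n
    yields stability under sigma in degree zero. It is linear in [A], so a spanning family
    suffices. *)
Definition degree0_formula (A : 'M[F]_n) := mxX X A /\ forall v,
  r (lin_field A) v =
  \sum_k act (lin_field A k) (r (single 1 k) v) + s (lin_field A) v.

Lemma degree0_formula_subspace : subspace degree0_formula.
Proof.
have sX := mxX_subspace F X; have X0 := subspace0 sX.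
split.
  split=> // v; have := vfm_sZ 0 v X0; rewrite !scale0r => ->.
  rewrite lin_field0 vfm_r0 addr0 big1 // => k _.
  by rewrite ffunE (act0 (vfm_act_linear hM)).
move=> c A B [XA fA] [XB fB]; split; first exact: (proj2 sX).
move=> v; rewrite vfm_s_lin // lin_fieldP (vfm_r_linear hM); try exact/inX_lin.
have -> : \sum_k act ((c *: lin_field A + lin_field B) k) (r (single 1 k) v) =
    c *: \sum_k act (lin_field A k) (r (single 1 k) v)
    + \sum_k act (lin_field B k) (r (single 1 k) v).
  rewrite scaler_sumr -big_split; apply: eq_bigr => k _ /=.
  by rewrite -(vfm_act_linear hM) !ffunE.
by rewrite fA fB; module_ring M F.
Qed.

End Theory.

Section TypeWOps.
Variables (n : nat) (M : lmodType F).
Variables (act : {mpoly F[n]} -> {linear M -> M}) (r s : vfield F n -> {linear M -> M}).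
Hypothesis hM : vfield_module (typeW n) act r s.

Lemma r_single_mul f l j v : r (single ('X_l * f) j) v =
  act 'X_l (r (single f j) v) + act f (s (single 'X_l j) v).
Proof.
have aL := vfm_act_linear hM; have aM := vfm_act_mul hM; have /= cW := vfm_compatible hM.
rewrite (cW ('X_l * f) j v) (cW f j v) aM linearD /= linear_sum -addrA; congr (_ + _).
have -> : act f (s (single 'X_l j) v) = \sum_i act ((i == l)%:R%:MP * f) (s (single 'X_i j) v).
  rewrite (bigD1 l) //= eqxx mpolyC1 mul1r big1 ?addr0 // => i /negPf->.
  by rewrite mpolyC0 mul0r (act0 aL).
rewrite -big_split; apply: eq_bigr => i _ /=.
by rewrite mderivM mderivXU (actD aL) [LHS]addrC !aM.
Qed.

Lemma typeW_stable (M' : M -> Prop) f v i j : subspace M' ->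
    (forall D w, M' w -> M' (r D w)) -> M' v ->
  M' (act f ((i == j)%:R *: s (single 'X_i j) v - s (single 'X_i j) (s (single 'X_i j) v))).
Proof.
move=> sM' stM' M'v.
have aL := vfm_act_linear hM; have aM := vfm_act_mul hM.
have D1x w : r (single 1 j) (act 'X_i w) = act 'X_i (r (single 1 j) w) + (i == j)%:R *: w.
  rewrite (vfm_r_act hM) //; congr (_ + _).
  have -> : vf_apply (single 1 j) 'X_i = (i == j)%:R *: 1 :> {mpoly F[n]}.
    rewrite /vf_apply (bigD1 j) //= ffunE eqxx mul1r big1 ?addr0 => [|k /negPf neq_kj].
      by rewrite mderivXU eq_sym -mul_mpolyC mulr1.
    by rewrite ffunE neq_kj mul0r.
  by rewrite (actZ aL) (vfm_act_one hM).
have eact p w : s (single 'X_i j) (act p w) = act p (s (single 'X_i j) w).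
  by apply: (vfm_s_act hM); apply/inX0_lin; exists (delta_mx i j) => //; rewrite lin_field_delta.
have E := @second_difference F n M act (vfm_act_one hM) aM (fun p => r (single p j))
  (s (single 'X_i j)) 'X_i f (i == j)%:R v (fun p w => r_single_mul p i j w) D1x eact.
set T := (X in act f X) in E *.
have : M' (2 *: act f T).
  rewrite -E; apply: subspaceD => //; last by do 2!apply: (stM').
  apply: subspaceB => //; first by do 2!apply: (stM').
  by apply: subspaceZ => //; do 2!apply: (stM').
by move/(subspaceZ sM' 2^-1); rewrite scalerA mulVf ?scale1r // pnatr_eq0.
Qed.

Lemma typeW_formula A : degree0_formula (typeW n) act r s A.
Proof.
have sR := degree0_formula_subspace hM; have aL := vfm_act_linear hM.
rewrite (matrix_sum_delta A); apply: (subspace_sum sR) => i _ _.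
apply: (subspace_sum sR) => j _ _; apply: (subspaceZ sR); split=> // v.
rewrite lin_field_delta (sum_act_single aL) -[X in single X j]mulr1 r_single_mul.
by rewrite (vfm_act_one hM) mulr1.
Qed.

End TypeWOps.

Section SecondOrderOps.
Variables (n : nat) (X : cartan_type n) (M : lmodType F).
Variables (act : {mpoly F[n]} -> {linear M -> M}) (r s : vfield F n -> {linear M -> M}).
Hypothesis hM : vfield_module X act r s.
Variables (c : 'M[F]_n).
Hypothesis anti_c : c^T = - c.
Hypothesis gradX : forall p, inX X (grad_field c p).
Hypothesis r_grad : forall p v, r (grad_field c p) v =
  \sum_k act (grad_field c p k) (r (single 1 k) v) + order2_term act s (grad_field c) p v.

Let gradX0 q : homogz 2 q -> inX0 X (grad_field c q).
Proof. by move=> hq; split=> //; apply: grad_field_homog2. Qed.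

Lemma vfm_square_stable (M' : M -> Prop) A (xi : 'I_n -> F) (a : F) f v : subspace M' ->
    (forall D w, inX X D -> M' w -> M' (r D w)) -> mxX X A -> a != 0 ->
    grad_field c (linear_form xi * linear_form xi) = lin_field (a *: A) -> M' v ->
  M' (act f (s (lin_field A) (s (lin_field A) v))).
Proof.
move=> sM' stM' XA a0 DA M'v.
have := square_stable (Q := inX X) (Q0 := inX0 X) (vfm_act_linear hM) (vfm_act_one hM) (vfm_act_mul hM) (inX0_subspace F X)
  (vfm_r0 hM) (vfm_s_linear hM) (vfm_s_act hM) (vfm_r_act hM)
  anti_c gradX gradX0 r_grad xi f sM' stM' M'v.
rewrite DA !(vfm_sZ hM) // !linearZ /= scalerA.
by move/(subspaceZ sM' (a * a)^-1); rewrite scalerA mulVf ?scale1r // mulf_neq0.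
Qed.

Lemma vfm_grad_formula A q : homogz 2 q -> grad_field c q = lin_field A -> mxX X A ->
  degree0_formula X act r s A.
Proof.
move=> hq DA XA; split=> // v; rewrite -DA.
exact: (r_homog2 (vfm_act_linear hM) (vfm_act_one hM) (inX0_subspace F X)
  (vfm_s_linear hM) gradX0 r_grad v hq).
Qed.

End SecondOrderOps.

Section TypeSOps.
Variables (n : nat) (M : lmodType F).
Variables (act : {mpoly F[n]} -> {linear M -> M}) (r s : vfield F n -> {linear M -> M}).
Hypothesis hM : vfield_module (typeS n) act r s.

Lemma typeS_r_grad (i j : 'I_n) : (i < j)%N -> forall p v, r (grad_field (skew_mx F i j) p) v =
  \sum_k act (grad_field (skew_mx F i j) p k) (r (single 1 k) v)
  + order2_term act s (grad_field (skew_mx F i j)) p v.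
Proof.
have aL := vfm_act_linear hM; have /= cS := vfm_compatible hM.
move=> ltij p v; rewrite -[LHS](congr1 (fun d => r (d p) v) (d_ijE F i j)) cS // -d_ijE.
congr (_ + _); rewrite -(sum_act_single aL p^`M(j) i (fun k => r (single 1 k) v)).
rewrite -(sum_act_single aL p^`M(i) j (fun k => r (single 1 k) v)) -sumrB.
by apply: eq_bigr => k _; rewrite -(actN aL) -(actD aL) /d_ij !ffunE.
Qed.

(** Compatibility in type S is stated for increasing pairs only. The root vector [t_i d_j] therefore
    comes from the potential [t_i^2] under [d_ij] or [d_ji], according to the order of [i] and
    [j]. *)
Lemma grad_skew_sqr (i j : 'I_n) : i != j ->
  grad_field (skew_mx F i j) (linear_form (fun k => (k == i)%:R) * linear_form (fun k => (k == i)%:R))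
    = lin_field ((-2) *: delta_mx i j) /\
  grad_field (skew_mx F j i) (linear_form (fun k => (k == i)%:R) * linear_form (fun k => (k == i)%:R))
    = lin_field (2 *: delta_mx i j).
Proof.
move=> neq_ij; rewrite !grad_field_sqr.
have -> : \matrix_(k, l) ((k == i)%:R * (l == i)%:R) = delta_mx i i :> 'M[F]_n.
  by apply/matrixP=> k l; rewrite !mxE -mulnb natrM.
rewrite !skew_mx_anti /skew_mx !mulmxN !mulmxBr !mul_delta_mx_cond eqxx (negPf neq_ij).
by rewrite mulr1n mulr0n subr0 sub0r opprK scalerN scaleNr.
Qed.

Lemma typeS_stable (M' : M -> Prop) f v (i j : 'I_n) : i != j -> subspace M' ->
    (forall D w, inX (typeS n) D -> M' w -> M' (r D w)) -> M' v ->
  M' (act f (s (lin_field (delta_mx i j)) (s (lin_field (delta_mx i j)) v))).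
Proof.
move=> neq_ij sM' stM' M'v; have [E1 E2] := grad_skew_sqr neq_ij.
have trE : mxX (typeS n) (delta_mx i j : 'M[F]_n) by rewrite /= mxtrace_delta (negPf neq_ij).
have n2 : (2 : F) != 0 by rewrite pnatr_eq0.
have [ltij|ltji|/val_inj eij] := ltngtP i j; last by rewrite eij eqxx in neq_ij.
  apply: (vfm_square_stable hM (skew_mx_anti F i j) (inX_skew i j) (typeS_r_grad ltij)
    f sM' stM' trE _ E1 M'v).
  by rewrite oppr_eq0.
exact: (vfm_square_stable hM (skew_mx_anti F j i) (inX_skew j i) (typeS_r_grad ltji)
    f sM' stM' trE n2 E2 M'v).
Qed.

Lemma typeS_formula A : \tr A = 0 -> degree0_formula (typeS n) act r s A.
Proof.
have sR := degree0_formula_subspace hM.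
have n2 : (2 : F) != 0 by rewrite pnatr_eq0.
have root (i j : 'I_n) : i != j -> degree0_formula (typeS n) act r s (delta_mx i j).
  move=> neq_ij; have [E1 E2] := grad_skew_sqr neq_ij.
  have trE : mxX (typeS n) (delta_mx i j : 'M[F]_n) by rewrite /= mxtrace_delta (negPf neq_ij).
  have trE' a := subspaceZ (mxX_subspace F (typeS n)) a trE.
  rewrite -[delta_mx i j]scale1r.
  have [ltij|ltji|/val_inj eij] := ltngtP i j; last by rewrite eij eqxx in neq_ij.
    rewrite -[1](mulVf (_ : - 2 != 0 :> F)) ?oppr_eq0 // -scalerA; apply: (subspaceZ sR).
    exact: (vfm_grad_formula hM (inX_skew i j) (typeS_r_grad ltij) (@homogz_linear_form_sqr _ _ _) E1 (trE' _)).
  rewrite -(mulVf n2) -scalerA; apply: (subspaceZ sR).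
  exact: (vfm_grad_formula hM (inX_skew j i) (typeS_r_grad ltji) (@homogz_linear_form_sqr _ _ _) E2 (trE' _)).
(* The potential [t_i t_j] gives the coroot [t_i d_i - t_j d_j]. *)
have cor (i j : 'I_n) : (i < j)%N -> degree0_formula (typeS n) act r s (coroot F i j).
  move=> ltij; have neq_ij : (i == j) = false by rewrite -val_eqE /= ltn_eqF.
  apply: (vfm_grad_formula hM (inX_skew i j) (typeS_r_grad ltij) (q := 'X_i * 'X_j)).
  - by rewrite -mpolyXD; apply: homogz2_monomial; rewrite mdegD !mdeg1.
  - rewrite grad_fieldBl !grad_field_delta /coroot lin_fieldB !lin_field_delta !mderivM !mderivXU.
    by rewrite !eqxx neq_ij eq_sym neq_ij !mpolyC1 !mpolyC0 !(mulr1, mul1r, mulr0, mul0r, addr0, add0r).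
  by rewrite /= /coroot linearB /= !mxtrace_delta !eqxx subrr.
have [n0|n_gt0] := posnP n.
  move=> _; rewrite (_ : A = 0); first exact: (subspace0 sR).
  by apply/matrixP=> i; have := ltn_ord i; rewrite {2}n0.
pose o := Ordinal n_gt0.
move=> /(traceless_span o)[d ->]; apply: (subspace_sum sR) => -[i j] _ _.
apply: (subspaceZ sR); rewrite /traceless_gen /=; have [_|] := eqVneq i j; last exact: root.
have [->|i0] := eqVneq i o; first by rewrite /coroot subrr; apply: (subspace0 sR).
rewrite -[coroot _ _ _]opprB; apply: (subspaceN sR); apply: cor.
by rewrite lt0n; apply: contra i0 => /eqP i0; apply/eqP/val_inj.
Qed.

End TypeSOps.

Section TypeHOps.
Variables (m : nat) (M : lmodType F).
Variables (act : {mpoly F[m + m]} -> {linear M -> M}) (r s : vfield F (m + m) -> {linear M -> M}).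
Hypothesis hM : vfield_module (typeH m) act r s.
Let c := - symplectic_mx F m.

Let anti_c : c^T = - c.
Proof. by rewrite /c linearN /= trmx_symplectic. Qed.

Let gradX p : inX (typeH m) (grad_field c p).
Proof. by exists p; rewrite d_HE. Qed.

Let r_grad p v : r (grad_field c p) v =
  \sum_k act (grad_field c p k) (r (single 1 k) v) + order2_term act s (grad_field c) p v.
Proof.
have aL := vfm_act_linear hM; have /= cH := vfm_compatible hM.
rewrite /c -d_HE cH; congr (_ + _).
under [X in X - _]eq_bigr => j _ do
  rewrite -(sum_act_single aL _ (rshift m j) (fun k => r (single 1 k) v)).
under [X in _ - X]eq_bigr => j _ do
  rewrite -(sum_act_single aL _ (lshift m j) (fun k => r (single 1 k) v)).
rewrite exchange_big [X in _ - X]exchange_big -sumrB; apply: eq_bigr => k _ /=.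
by rewrite -!(act_sum aL) -(actN aL) -(actD aL) /d_H !ffunE !sum_ffunE.
Qed.

Lemma typeH_stable (M' : M -> Prop) f v a b : subspace M' ->
    (forall D w, inX (typeH m) D -> M' w -> M' (r D w)) -> M' v ->
  M' (act f (s (lin_field (square_mx F a b)) (s (lin_field (square_mx F a b)) v))).
Proof.
move=> sM' stM' M'v.
have n2 : (2 : F) != 0 by rewrite pnatr_eq0.
exact: (vfm_square_stable hM anti_c gradX r_grad f sM' stM' (square_mx_hamiltonian F a b)
  n2 (lin_square_mx F a b) M'v).
Qed.

Lemma typeH_formula A : hamiltonian_mx A -> degree0_formula (typeH m) act r s A.
Proof.
have sR := degree0_formula_subspace hM.
have n2 : (2 : F) != 0 by rewrite pnatr_eq0.
move=> /hamiltonian_span[d ->]; apply: (subspace_sum sR) => -[a b] _ _; apply: (subspaceZ sR).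
rewrite /= -[square_mx F a b]scale1r -(mulVf n2) -scalerA; apply: (subspaceZ sR).
apply: (vfm_grad_formula hM gradX r_grad (@homogz_linear_form_sqr _ _ _) (lin_square_mx F a b)).
exact: (subspaceZ (hamiltonian_subspace F m) _ (square_mx_hamiltonian F a b)).
Qed.

End TypeHOps.
End VectorFieldModules.

(** * The main argument *)

Section Annihilators.
Variable F : numFieldType.

(* a tau(A) + b tau(A)^2 maps a submodule into its largest A_n-stable part. *)
Definition annihilator n (X : cartan_type n) : F -> F -> 'M[F]_n -> Prop :=
  match X in cartan_type n return F -> F -> 'M[F]_n -> Prop with
  | typeW n => fun a b A => exists i j : 'I_n, [/\ A = delta_mx i j, a = (i == j)%:R & b = -1]
  | typeS n => fun a b A => exists i j : 'I_n, [/\ i != j, A = delta_mx i j, a = 0 & b = 1]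
  | typeH m => fun a b A => exists i j : 'I_(m + m), [/\ A = square_mx F i j, a = 0 & b = 1]
  end.

Lemma annihilator_mxX n (X : cartan_type n) a b A : annihilator X a b A -> mxX X A.
Proof.
case: X A => {}n A //= [i [j]].
  by case=> neq_ij -> _ _; rewrite mxtrace_delta (negPf neq_ij).
by case=> -> _ _; apply: square_mx_hamiltonian.
Qed.

Lemma annihilator_stable n (X : cartan_type n) (M : lmodType F)
    (act : {mpoly F[n]} -> {linear M -> M}) (r s : vfield F n -> {linear M -> M})
    (M' : M -> Prop) a b A f v :
    vfield_module X act r s -> annihilator X a b A -> subspace M' ->
    (forall D w, inX X D -> M' w -> M' (r D w)) -> M' v ->
  M' (act f (a *: s (lin_field A) v + b *: s (lin_field A) (s (lin_field A) v))).
Proof.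
case: X act r s A f => {}n act r s A f hM /=.
- case=> i [j [-> -> ->]] sM' stM' M'v; rewrite scaleN1r lin_field_delta.
  by apply: (typeW_stable hM) => // D w; apply: stM'.
- case=> i [j [neq_ij -> -> ->]] sM' stM' M'v; rewrite scale0r add0r scale1r.
  exact: (typeS_stable hM).
case=> i [j [-> -> ->]] sM' stM' M'v; rewrite scale0r add0r scale1r.
exact: (typeH_stable hM).
Qed.

Lemma vfield_module_formula n (X : cartan_type n) (M : lmodType F)
    (act : {mpoly F[n]} -> {linear M -> M}) (r s : vfield F n -> {linear M -> M}) A :
  vfield_module X act r s -> mxX X A -> degree0_formula X act r s A.
Proof.
case: X act r s A => {}n act r s A hM /=.
- by move=> _; apply: typeW_formula.
- exact: typeS_formula.
- exact: typeH_formula.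
Qed.

Lemma cartanX_lin n (X : cartan_type n) D : cartanX X D ->
  exists A : 'M[F]_n, [/\ mxX X A, is_diag_mx A, D = lin_field A
    & forall k, mu k D = \sum_(i < n | (i < k)%N) A i i].
Proof.
case=> XD [c Dc]; have DA : D = lin_field (diag_mx (\row_i c i)).
  rewrite Dc; apply/ffunP=> j; rewrite sum_ffunE !ffunE; apply: eq_bigr => i _.
  rewrite !ffunE !mxE eq_sym; case: eqP => [->|_]; rewrite ?mulr1n ?mulr0n ?scaler0 ?scale0r //.
exists (diag_mx (\row_i c i)); split; [|exact: diag_mx_is_diag|exact: DA|].
  by apply/inX_lin; rewrite -DA.
by move=> k; rewrite DA /mu; apply: eq_bigr => i _; rewrite mcoeff_lin_field.
Qed.

Lemma annihilated_module n (X : cartan_type n) (M : lmodType F)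
    (tau : 'M[F]_n -> {linear M -> M}) (U : M -> Prop) : (2 <= n)%N ->
    irreducible_mx_module (mxX X) tau U ->
    (forall a b A u, annihilator X a b A -> U u -> a *: tau A u + b *: tau A (tau A u) = 0) ->
  (exists b : seq M, forall v, U v <-> lspan b v) /\
  exists2 k, (k <= rankX X)%N & exists v, [/\ U v, v <> 0,
    forall D, pos_root_vector X D -> exists A, [/\ mxX X A, D = lin_field A & tau A v = 0] &
    forall D, cartanX X D ->
      exists A, [/\ mxX X A, D = lin_field A & tau A v = mu k D *: v]].
Proof.
move=> n2; case: X n2 tau => {}n n2 tau hU kill.
- have sqr i j u : U u ->
      tau (delta_mx i j) (tau (delta_mx i j) u) = (i == j)%:R *: tau (delta_mx i j) u.
    move=> Uu; have /= := kill (i == j)%:R (-1) (delta_mx i j) u; rewrite scaleN1r => E.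
    by apply/esym/eqP; rewrite -subr_eq0 E //; exists i, j.
  split; first exact: (typeW_finite hU sqr).
  have [k lek [v [Uv v0 Ev Hv]]] := typeW_highest_weight hU sqr.
  exists k => //; exists v; split=> // D.
    by case=> i [j [ltij ->]]; exists (delta_mx i j); rewrite lin_field_delta Ev.
  move=> /cartanX_lin[A [XA dA -> muE]]; exists A; split=> //.
  by rewrite muE Hv.
- have sqr i j u : i != j -> U u -> tau (delta_mx i j) (tau (delta_mx i j) u) = 0.
    move=> neq_ij Uu; have /= := kill 0 1 (delta_mx i j) u.
    by rewrite scale0r add0r scale1r; apply=> //; exists i, j.
  have n0 : (0 < n)%N by apply: leq_trans n2.
  have trP (A : 'M[F]_n) : \tr A = 0 -> mxX (typeS n) A by [].
  split; first exact: (typeS_finite hU trP sqr n0 trP).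
  have [k lek [v [Uv v0 Ev Hv]]] := typeS_highest_weight hU trP sqr n0.
  exists k => //; exists v; split=> // D.
    case=> i [j [ltij ->]]; exists (delta_mx i j); rewrite lin_field_delta Ev //; split=> //=.
    by rewrite mxtrace_delta -val_eqE /= ltn_eqF.
  move=> /cartanX_lin[A [XA dA -> muE]]; exists A; split=> //.
  by rewrite muE Hv.
have sqr i j u : U u -> tau (square_mx F i j) (tau (square_mx F i j) u) = 0.
  move=> Uu; have /= := kill 0 1 (square_mx F i j) u.
  by rewrite scale0r add0r scale1r; apply=> //; exists i, j.
split; first exact: (typeH_finite hU sqr).
have [k lek [v [Uv v0 Es El Hv]]] := typeH_highest_weight hU sqr.
exists k => //; exists v; split=> // D.
  case=> -[i [j [ltij ->]]].
    exists (short_root F i j); rewrite Es //; split=> //; first exact: short_root_hamiltonian.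
    by rewrite lin_fieldB !lin_field_delta.
  exists (long_root F i j); rewrite El //; split=> //; first exact: long_root_hamiltonian.
  by rewrite lin_fieldD !lin_field_delta.
move=> /cartanX_lin[A [XA dA -> muE]]; exists A; split=> //.
by rewrite muE Hv.
Qed.

End Annihilators.

(** * Degree zero of the toroidal algebra *)

Section Toroidal.
Variables (F : numFieldType) (g : vectType F) (brg : g -> g -> g).
Variables (n : nat) (X : cartan_type n).
Local Notation deg0 := (@toroidal_deg F g n X 0).

Lemma homogz0 (d : int) : homogz d (0 : {mpoly F[n]}).
Proof. by move=> m; rewrite msupp0. Qed.

Lemma homogz_linear (d : int) (c : F) (p q : {mpoly F[n]}) :
  homogz d p -> homogz d q -> homogz d (c *: p + q).
Proof.
move=> /homogzP hp /homogzP hq; apply/homogzP=> m neq_md.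
by rewrite mcoeffD mcoeffZ hp // hq // mulr0 addr0.
Qed.

Lemma deg0_subspace : subspace deg0.
Proof.
split; first by split=> [|i|i|i]; rewrite ?ffunE; [exact: subspace0 (inX_subspace F X)|exact: homogz0..].
move=> c [[u z] D] [[u' z'] D'] [XD hu hz hD] [XD' hu' hz' hD']; split=> [|i|i|i].
- exact: (proj2 (inX_subspace F X)).
- by rewrite !ffunE; apply: homogz_linear.
- by rewrite !ffunE; apply: homogz_linear.
- by rewrite !ffunE; apply: homogz_linear.
Qed.

Lemma toroidal_ge_deg (k d : int) a : k <= d -> toroidal_deg X d a -> @toroidal_ge F g n X k a.
Proof.
move=> lekd da; exists [:: a]; split; last by rewrite big_seq1.
by move=> u; rewrite inE => /eqP->; exists d.
Qed.

Lemma deg0_vfield D : inX0 X D -> deg0 (of_vfield g D).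
Proof.
case=> XD hD; split=> // [i|i]; rewrite ?ffunE; exact: homogz0.
Qed.

Lemma homogz0_1 (c : F) : homogz 0 (c *: 1 : {mpoly F[n]}).
Proof.
apply/homogzP=> m m0; rewrite mcoeffZ mcoeff1; case: eqP => [em|]; last by rewrite mulr0.
by rewrite em mdeg0 in m0.
Qed.

Lemma deg0_current x : deg0 (of_current (pure_tensor (x : g) (1 : {mpoly F[n]}))).
Proof.
split=> [|i|i|i]; first exact: (subspace0 (inX_subspace F X)).
- by rewrite ffunE; apply: homogz0_1.
- by rewrite ffunE; apply: homogz0.
- by rewrite ffunE; apply: homogz0.
Qed.

Lemma deg0_central j : deg0 (of_central g (single 1 j)).
Proof.
split=> [|i|i|i]; first exact: (subspace0 (inX_subspace F X)).
- by rewrite ffunE; apply: homogz0.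
- rewrite ffunE; case: ifP => _; last exact: homogz0.
  by rewrite -[1]scale1r; apply: homogz0_1.
- by rewrite ffunE; apply: homogz0.
Qed.

Lemma homogz0_const (p : {mpoly F[n]}) : homogz 0 p -> p = p@_0 *: 1.
Proof.
move=> /homogzP hp; apply/mpolyP=> m; rewrite mcoeffZ mcoeff1.
have [->|m0] := eqVneq m 0%MM; first by rewrite mulr1.
by rewrite mulr0 hp //; move: m0; rewrite -mdeg_eq0; lia.
Qed.

(** Degree zero is spanned by the [x] in g, the [K_j] and the linear fields. Closure is asked only
    for combinations of degree-zero elements, since sigma need not be linear elsewhere. *)
Lemma deg0_ind (W : toroidal g n -> Prop) :
    (forall c a b, deg0 a -> deg0 b -> W a -> W b -> W (c *: a + b)) ->
    (forall x, W (of_current (pure_tensor (x : g) (1 : {mpoly F[n]})))) ->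
    (forall j, W (of_central g (single 1 j))) ->
    (forall D, inX0 X D -> W (of_vfield g D)) ->
  forall a, deg0 a -> W a.
Proof.
move=> Wlin Wu Wz WD [[u z] D] [XD hu hz hD].
have s0 := deg0_subspace.
pose W' a := deg0 a /\ W a.
have sW' : subspace W'.
  split=> [|c a b [da Wa] [db Wb]]; last by split; [apply: (proj2 s0)|apply: Wlin].
  split; first exact: (subspace0 s0).
  (* Writing 0 as the tensor of 0 with 1 makes [W 0] a case of the hypothesis on g. *)
  have -> : (0 : toroidal g n) = of_current (pure_tensor (0 : g) (1 : {mpoly F[n]})).
    by congr (_, _, _); apply/ffunP=> i; rewrite !ffunE linear0 scale0r.
  exact: Wu.
suff [] : W' (u, z, D) by [].
have -> : (u, z, D) = of_current u + of_central g z + of_vfield g D.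
  by congr (_, _, _) => /=; rewrite ?addr0 ?add0r.
apply: (subspaceD sW'); first apply: (subspaceD sW').
- pose x := \sum_i (u i)@_0 *: (vbasis {:g})`_i.
  have -> : u = pure_tensor (x : g) (1 : {mpoly F[n]}).
    apply/ffunP=> i; rewrite ffunE {1}(homogz0_const (hu i)).
    by rewrite coord_sum_free // (basis_free (vbasisP _)).
  by split; [apply: deg0_current|apply: Wu].
- have -> : of_central g z = \sum_j (z j)@_0 *: of_central g (single 1 j).
    have proj (I : Type) (l : seq I) (G : I -> toroidal g n) :
        \sum_(j <- l) G j = (\sum_(j <- l) (G j).1.1, \sum_(j <- l) (G j).1.2, \sum_(j <- l) (G j).2).
      elim: l => [|j l IHl]; first by rewrite !big_nil.
      by rewrite !big_cons IHl.
    rewrite proj /=; congr (_, _, _).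
    - by rewrite big1 // => j _; rewrite scaler0.
    - apply/ffunP=> k; rewrite sum_ffunE (bigD1 k) //= !ffunE eqxx -homogz0_const //.
      rewrite big1 ?addr0 // => j /negPf neq_jk.
      by rewrite !ffunE eq_sym neq_jk scaler0.
    - by rewrite big1 // => j _; rewrite scaler0.
  apply: (subspace_sum sW') => j _ _; apply: (subspaceZ sW').
  by split; [apply: deg0_central|apply: Wz].
have X0D : inX0 X D by split.
by split; [apply: deg0_vfield|apply: WD].
Qed.

End Toroidal.

(** * Coordinates on a highest-weight module *)

Section Realization.
Variables (F : numFieldType) (n : nat) (X : cartan_type n) (M : lmodType F).
Variables (s : vfield F n -> {linear M -> M}) (U : M -> Prop).
Hypothesis s_bracket : forall D E v, inX0 X D -> inX0 X E ->
  s (vf_bracket D E) v = s D (s E v) - s E (s D v).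
Hypothesis s_linear : forall c D E v, inX0 X D -> inX0 X E ->
  s (c *: D + E) v = c *: s D v + s E v.
Hypothesis hU : irreducible_mx_module (mxX X) (fun A => s (lin_field A)) U.
Hypothesis n2 : (2 <= n)%N.
Hypothesis kill : forall a b A u, annihilator X a b A -> U u ->
  a *: s (lin_field A) u + b *: s (lin_field A) (s (lin_field A) u) = 0.

Lemma exceptional_realization : exists2 k, (k <= rankX X)%N &
  exists (V : vectType F) (tau : vfield F n -> {linear V -> V}) (phi : {linear V -> M}),
    [/\ irreducible_of_highest_weight_mu X k tau, injective phi,
      forall v, U v <-> exists w, v = phi w &
      forall D w, inX0 X D -> phi (tau D w) = s D (phi w)].
Proof.
have [[b Ub] [k lek [v0 [Uv0 v00 posv cartv]]]] := annihilated_module n2 hU kill.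
have [d [phi [inj_phi phiP]]] := lspan_coordinates b.
have UP v : U v <-> exists w, v = phi w by rewrite Ub; apply: phiP.
have Uphi w : U (phi w) by apply/UP; exists w.
have /choice[tau tauP] : forall D, exists L : {linear 'rV[F]_d -> 'rV[F]_d},
    inX0 X D -> forall w, phi (L w) = s D (phi w).
  (* Fields that are not in degree zero of [X] receive the identity as a default operator. *)
  move=> D; have [XD|not_XD] := pselect (inX0 X D); last by exists (idfun : {linear _ -> _}).
  have /choice[h hP] : forall w, exists w', s D (phi w) = phi w'.
    move=> w; apply/UP; case/inX0_lin: XD => A XA ->.
    exact: (mxm_stable hU).
  have lin_h : linear h by move=> c x y; apply: inj_phi; rewrite -hP !linearP /= !hP.
  pose L : {linear 'rV[F]_d -> 'rV[F]_d} :=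
    HB.pack h (GRing.isLinear.Build F 'rV[F]_d 'rV[F]_d *:%R h lin_h).
  by exists L => _ w; rewrite /= hP.
have sX0 := inX0_subspace F X.
have [w0 Dv0] := (UP v0).1 Uv0.
exists k => //; exists ('rV[F]_d : vectType F), tau, phi; split=> //; last by move=> D w /tauP.
split.
- split=> [c D E w XD XE|D E w XD XE]; apply: inj_phi.
    rewrite linearP /= !tauP //; last exact: (proj2 sX0).
    by rewrite s_linear.
  rewrite linearB /= !tauP //; last first.
    case/inX0_lin: XD => A XA ->; case/inX0_lin: XE => B XB ->.
    rewrite vf_bracket_lin; apply/inX0_lin.
    by exists (A *m B - B *m A) => //; apply: mxX_comm.
  by rewrite s_bracket.
- split; first by split=> //; split.
    by exists w0 => // w00; apply: v00; rewrite Dv0 w00 linear0.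
  move=> W [sW stW] _.
  have [|||W0|allW] := mxm_irreducible hU (W := fun v => exists2 w, W w & v = phi w).
  + split=> [|c _ _ [w Ww ->] [w' Ww' ->]]; first by exists 0; [apply: subspace0|rewrite linear0].
    by exists (c *: w + w'); [apply: (proj2 sW)|rewrite linearP].
  + by move=> _ [w _ ->].
  + move=> A _ XA [w Ww ->]; have XD : inX0 X (lin_field A) by apply/inX0_lin; exists A.
    by exists (tau (lin_field A) w); [apply: stW|rewrite tauP].
  + by left=> w Ww; apply: inj_phi; rewrite linear0; apply: W0; exists w.
  + by right=> w _; have [w' Ww' /inj_phi->] := allW _ (Uphi w).
exists w0; split; first by move=> w00; apply: v00; rewrite Dv0 w00 linear0.
  move=> D /posv[A [XA DA Av]]; apply: inj_phi; rewrite linear0 tauP; first by rewrite -Dv0 DA.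
  by apply/inX0_lin; exists A.
move=> D /cartv[A [XA DA Av]]; apply: inj_phi; rewrite linearZ /= tauP; first by rewrite -Dv0 -Av DA.
by apply/inX0_lin; exists A.
Qed.

End Realization.

(** * Reducing operators on a rho-submodule *)

Section AnLModules.
Variables (F : numFieldType) (g : vectType F) (brg : g -> g -> g).
Variables (n : nat) (X : cartan_type n) (M : lmodType F).
Variables (act : {mpoly F[n]} -> {linear M -> M}) (rho sigma : toroidal g n -> {linear M -> M}).
Hypothesis hM : AnL_module brg X act rho sigma.
Local Notation deg0 := (@toroidal_deg F g n X 0).
Let r D := rho (of_vfield g D).
Let s D := sigma (of_vfield g D).

Lemma sigma_linear c a b v : toroidal_ge X 0 a -> toroidal_ge X 0 b ->
  sigma (c *: a + b) v = c *: sigma a v + sigma b v.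
Proof. by move=> a0 b0; apply: (lie_module_linear (sigma_module hM)). Qed.

Lemma deg0_ge a : deg0 a -> toroidal_ge X 0 a.
Proof. exact: toroidal_ge_deg. Qed.

Lemma of_vfield_linear c (D E : vfield F n) :
  of_vfield g (c *: D + E) = c *: of_vfield g D + of_vfield g E.
Proof. by congr (_, _, _) => /=; rewrite scaler0 addr0. Qed.

Lemma toroidal_bracket_vfield (D E : vfield F n) :
  toroidal_bracket brg (of_vfield g D) (of_vfield g E) = of_vfield g (vf_bracket D E).
Proof.
have app0 (D' : vfield F n) : vf_apply D' 0 = 0.
  by rewrite /vf_apply big1 // => i _; rewrite mderiv0 mulr0.
congr (_, _, _).
  rewrite /current_bracket big1 => [|i _].
    by apply/ffunP=> i; rewrite !ffunE !app0 subrr addr0.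
  by rewrite big1 // => j _; apply/ffunP=> k; rewrite !ffunE mul0r scaler0.
by apply/ffunP=> i; rewrite !ffunE !app0 subrr.
Qed.

Lemma AnL_vfield_module : vfield_module X act r s.
Proof.
split.
- exact: (act_linear hM).
- exact: (act_one hM).
- exact: (act_mul hM).
- move=> c D E v XD XE; rewrite /r of_vfield_linear.
  exact: (lie_module_linear (rho_module hM)).
- move=> c D E v XD XE; rewrite /s of_vfield_linear.
  by apply: sigma_linear; apply: deg0_ge; apply: deg0_vfield.
- move=> D f v XD; apply/eqP; rewrite addrC -subr_eq; apply/eqP.
  exact: (rho_vfield_act hM).
- move=> D f v XD; apply/eqP; rewrite -subr_eq0; apply/eqP.
  by apply: (sigma_act hM); apply: deg0_ge; apply: deg0_vfield.
exact: (rho_vfield hM).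
Qed.

Lemma sigma_bracket_vfield D E v : inX0 X D -> inX0 X E ->
  s (vf_bracket D E) v = s D (s E v) - s E (s D v).
Proof.
move=> XD XE; rewrite /s -toroidal_bracket_vfield.
by apply: (lie_module_bracket (sigma_module hM)); apply: deg0_ge; apply: deg0_vfield.
Qed.

Lemma sigma_actC a f v : deg0 a -> sigma a (act f v) = act f (sigma a v).
Proof.
move=> a0; apply/eqP; rewrite -subr_eq0; apply/eqP.
by apply: (sigma_act hM); apply: deg0_ge.
Qed.

Lemma sigma_rC a i v : deg0 a -> r (single 1 i) (sigma a v) = sigma a (r (single 1 i) v).
Proof.
move=> a0; apply/eqP; rewrite -subr_eq0; apply/eqP.
by apply: (rho_d_sigma hM); apply: deg0_ge.
Qed.

Variable M' : M -> Prop.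
Hypothesis hM' : submodule (in_toroidal X) rho M'.
Let sM' := proj1 hM'.

Let stable_r D w : inX X D -> M' w -> M' (r D w).
Proof. by move=> XD; apply: (proj2 hM'). Qed.

Definition largest_act_stable (v : M) := forall f, M' (act f v).
Local Notation N := largest_act_stable.

Lemma largest_sub v : N v -> M' v.
Proof. by move=> /(_ 1); rewrite (act_one hM). Qed.

Lemma largest_subspace : subspace N.
Proof.
split=> [f|c u v Nu Nv f]; first by rewrite linear0; apply: (subspace0 sM').
by rewrite linearP; apply: (proj2 sM').
Qed.

Lemma largest_act f v : N v -> N (act f v).
Proof. by move=> Nv h; rewrite -(act_mul hM). Qed.

Lemma largest_r D v : inX X D -> N v -> N (r D v).
Proof.
move=> XD Nv f.
have -> : act f (r D v) = r D (act f v) - act (vf_apply D f) v.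
  by rewrite (vfm_r_act AnL_vfield_module) // addrK.
by apply: (subspaceB sM') => //; apply: stable_r.
Qed.

(** Condition (IV) absorbs the factor: [f sigma(x) v] equals the action of [x (x) f] under rho,
    which preserves [M']. *)
Lemma sigma_current_largest x v : M' v -> N (sigma (of_current (pure_tensor x (1 : {mpoly F[n]}))) v).
Proof.
move=> M'v f; rewrite -sigma_actC; last exact: deg0_current.
rewrite -(rho_tensor hM); apply: (proj2 hM') => //.
exact: (subspace0 (inX_subspace F X)).
Qed.

Lemma sigma_central_largest j v : M' v -> N (sigma (of_central g (single 1 j)) v).
Proof.
move=> M'v f; rewrite -sigma_actC; last exact: deg0_central.
rewrite -(rho_central hM); apply: (proj2 hM') => //.
exact: (subspace0 (inX_subspace F X)).
Qed.

Lemma sigma_vfieldE D v : inX0 X D ->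
  s D v = r D v - \sum_k act (D k) (r (single 1 k) v).
Proof.
case/inX0_lin=> A XA ->; have [_ ->] := vfield_module_formula AnL_vfield_module XA.
by rewrite addrC addKr.
Qed.

Lemma largest_sigma a v : deg0 a -> N v -> N (sigma a v).
Proof.
move=> a0 Nv; move: a a0; apply: deg0_ind.
- move=> c a b a0 b0 Na Nb; rewrite sigma_linear; try exact: deg0_ge.
  exact: (proj2 largest_subspace).
- by move=> x; apply: sigma_current_largest; apply: largest_sub.
- by move=> j; apply: sigma_central_largest; apply: largest_sub.
move=> D XD; rewrite -[sigma _ v]/(s D v) sigma_vfieldE //.
apply: (subspaceB largest_subspace); first by apply: largest_r => //; case: XD.
apply: (subspace_sum largest_subspace) => k _ _; apply/largest_act/largest_r => //.
exact: single1_inX.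
Qed.

Let submod (U : M -> Prop) := submodule deg0 sigma U.

(** Commuting with A_n and the rho(d_k) lets [T] pass through the formula for sigma(D). Preserving
    sigma-submodules makes [T u], for [u] in a submodule avoiding [N], vanish as soon as it lies in
    [N]. *)
Record reducing_operator (T : M -> M) : Prop := ReducingOperator {
  red_linear : linear T;
  red_act : forall f v, T (act f v) = act f (T v);
  red_r : forall k v, T (r (single 1 k) v) = r (single 1 k) (T v);
  red_submodule : forall U v, submod U -> U v -> U (T v);
  red_largest : forall v, M' v -> N (T v)
}.

(** Only the last condition is delicate, as [sigma a v] may leave [M']. For a field, [T (s D v)] is
    [T (r D v)] minus a sum of A_n and rho(d_k) applied to [T v]; both parts lie in [N]. For g and
    the [K_j], [sigma a v] already lies in [N]. *)
Lemma reducing_sigma a T : deg0 a -> reducing_operator T ->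
  reducing_operator (fun v => sigma a (T v) - T (sigma a v)).
Proof.
move=> a0 redT; have linT := red_linear redT.
split=> [c u v|f v|k v|U v mU Uv|v M'v].
- by rewrite linT !(linearD, linearZ) /= linT; module_ring M F.
- by rewrite (red_act redT) !sigma_actC // (red_act redT) linearB.
- by rewrite (red_r redT) -!sigma_rC // (red_r redT) linearB.
- apply: (subspaceB (proj1 mU)); first by apply: (proj2 mU) => //; apply: (red_submodule redT mU).
  by apply: (red_submodule redT mU) => //; apply: (proj2 mU).
apply: (subspaceB largest_subspace); first by apply: largest_sigma => //; apply: (red_largest redT).
have T0 : T 0 = 0 by have := linT (-1) 0 0; rewrite scaler0 addr0 scaleN1r addNr.
have TD x y : T (x + y) = T x + T y by have := linT 1 x y; rewrite !scale1r.
move: a a0; apply: deg0_ind.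
- move=> c a b a0 b0 Na Nb; rewrite sigma_linear; try exact: deg0_ge.
  by rewrite linT; apply: (proj2 largest_subspace).
- by move=> x; apply: (red_largest redT) => //; apply/largest_sub/sigma_current_largest.
- by move=> j; apply: (red_largest redT) => //; apply/largest_sub/sigma_central_largest.
move=> D XD; rewrite -[sigma _ v]/(s D v) sigma_vfieldE //.
have -> : T (r D v - \sum_k act (D k) (r (single 1 k) v)) =
    T (r D v) - \sum_k act (D k) (r (single 1 k) (T v)).
  rewrite addrC -scaleN1r linT scaleN1r addrC (big_morph T TD T0).
  by congr (_ - _); apply: eq_bigr => k _; rewrite (red_act redT) (red_r redT).
have NT := red_largest redT M'v.
apply: (subspaceB largest_subspace).
  by apply: (red_largest redT) => //; apply: stable_r => //; case: XD.
apply: (subspace_sum largest_subspace) => k _ _; apply/largest_act/largest_r => //.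
exact: single1_inX.
Qed.

Lemma reducing_deg0 a : deg0 a -> (forall v, M' v -> N (sigma a v)) ->
  reducing_operator (sigma a).
Proof.
move=> a0 aN; split=> // [c u v|f v|k v|U v mU].
- by rewrite linearP.
- exact: sigma_actC.
- by rewrite sigma_rC.
exact: (proj2 mU).
Qed.

Lemma reducing_annihilator a b A : annihilator X a b A ->
  reducing_operator (fun v => a *: s (lin_field A) v + b *: s (lin_field A) (s (lin_field A) v)).
Proof.
move=> hA; have XA := annihilator_mxX hA.
have a0 : deg0 (of_vfield g (lin_field A)) by apply: deg0_vfield; apply/inX0_lin; exists A.
split=> [c u v|f v|k v|U v mU Uv|v M'v f].
- by rewrite !linearP /=; module_ring M F.
- by rewrite /s !sigma_actC // linearD !linearZ.
- by rewrite /s -!sigma_rC // -/(s _) linearD !linearZ /= !sigma_rC.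
- have Us : U (s (lin_field A) v) by apply: (proj2 mU).
  apply: (subspaceD (proj1 mU)); apply: (subspaceZ (proj1 mU)) => //.
  exact: (proj2 mU).
exact: (annihilator_stable f AnL_vfield_module hA sM' stable_r M'v).
Qed.

(** A sigma-stable replacement for [M']: it contains [M'] and [N], and a simple submodule can be
    split off from it outside [N]. *)
Definition reduced (v : M) := forall T, reducing_operator T -> N (T v).

Lemma reduced_submodule : submod reduced.
Proof.
split; first split.
- move=> T redT; have := red_linear redT (-1) 0 0.
  rewrite scaler0 addr0 scaleN1r addNr => ->; exact: (subspace0 largest_subspace).
- move=> c u v Ku Kv T redT; rewrite (red_linear redT).
  by apply: (proj2 largest_subspace); [apply: Ku|apply: Kv].
move=> a v a0 Kv T redT.
(* [T sigma(a) = sigma(a) T - [sigma(a), T]], and the commutator is again a reducing operator. *)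
rewrite -[T _](subKr (sigma a (T v))); apply: (subspaceB largest_subspace).
  by apply: largest_sigma => //; apply: Kv.
exact: (Kv _ (reducing_sigma a0 redT)).
Qed.

Lemma reduced_simple_exceptional (n2 : (2 <= n)%N) U :
    irreducible_submodule deg0 sigma U -> (forall u, U u -> reduced u) ->
    (forall u, U u -> N u -> u = 0) ->
  exists2 k, (k <= rankX X)%N & isomorphic_to_exceptional X sigma U k.
Proof.
move=> [mU [u0 Uu0 u00] irrU] sUK UN0; have [sU stU] := mU.
have killT T u : reducing_operator T -> U u -> T u = 0.
  by move=> redT Uu; apply: UN0; [apply: (red_submodule redT mU) | apply: sUK].
have sigmaE a u : deg0 a -> U u -> sigma a u = s a.2 u.
  move=> a0 Uu; move: a a0.
  have s0 : s 0 u = 0.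
    have X0 := subspace0 (inX0_subspace F X).
    have := vfm_s_linear AnL_vfield_module (-1) u X0 X0.
    by rewrite scaler0 addr0 scaleN1r addNr.
  pose W a := deg0 a /\ sigma a u = s a.2 u.
  suff WP a : deg0 a -> W a by move=> a /WP[].
  move: a; apply: deg0_ind.
  - move=> c a b a0 b0 [_ Wa] [_ Wb]; split; first exact: (proj2 (deg0_subspace g X)).
    rewrite sigma_linear; try exact: deg0_ge.
    have inX0_2 (a' : toroidal g n) : deg0 a' -> inX0 X a'.2.
      by case: a' => [[u' z'] D'] [XD' _ _ hD']; split.
    by rewrite Wa Wb -(vfm_s_linear AnL_vfield_module) //; apply: inX0_2.
  - move=> x; split; first exact: deg0_current.
    rewrite /= s0; apply: (killT (sigma _)) => //; apply: reducing_deg0; first exact: deg0_current.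
    by move=> v; apply: sigma_current_largest.
  - move=> j; split; first exact: deg0_central.
    rewrite /= s0; apply: (killT (sigma _)) => //; apply: reducing_deg0; first exact: deg0_central.
    by move=> v; apply: sigma_central_largest.
  by move=> D XD; split=> //; apply: deg0_vfield.
have inX0A A : mxX X A -> inX0 X (lin_field A) by move=> XA; apply/inX0_lin; exists A.
have hU : irreducible_mx_module (mxX X) (fun A => s (lin_field A)) U.
  split.
  - exact: mxX_subspace.
  - by move=> A B; apply: mxX_comm.
  - exact: sU.
  - by move=> A u XA; apply: stU; apply: deg0_vfield; apply: inX0A.
  - by move=> c A B u XA XB _; apply: (vfm_s_lin AnL_vfield_module).
  - by move=> A B u XA XB _; rewrite -vf_bracket_lin sigma_bracket_vfield //; apply: inX0A.
  - by exists u0.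
  (* Since g and the [K_j] act by 0 on [U], stability under the linear fields is stability under all
     of degree zero. *)
  move=> W sW sWU stW; apply: irrU => //; split=> // a w a0 Ww.
  rewrite sigmaE //; last exact: sWU.
  have /inX0_lin[A XA ->] : inX0 X a.2 by case: a a0 => [[u z] D] [XD _ _ hD]; split.
  exact: stW.
have kill a b A u : annihilator X a b A -> U u ->
    a *: s (lin_field A) u + b *: s (lin_field A) (s (lin_field A) u) = 0.
  by move=> hA; apply: killT (reducing_annihilator hA).
have [k lek [V [tau [phi [hw inj_phi UP phi_tau]]]]] :=
  exceptional_realization sigma_bracket_vfield (vfm_s_linear AnL_vfield_module) hU n2 kill.
exists k => //; exists V, tau; split=> //; exists phi; split=> // a w a0.
rewrite sigmaE //; last by apply/UP; exists w.
by apply: phi_tau; case: a a0 => [[u z] D] [XD _ _ hD]; split.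
Qed.

Lemma rho_submodule_act_stable (n2 : (2 <= n)%N) :
    completely_reducible deg0 sigma ->
    (forall U, irreducible_submodule deg0 sigma U ->
      forall k, (k <= rankX X)%N -> ~ isomorphic_to_exceptional X sigma U k) ->
  forall v, M' v -> N v.
Proof.
move=> hred hexc v M'v; apply: contrapT => Nv.
have mN : submod N by split; [exact: largest_subspace|move=> a u a0; apply: largest_sigma].
have [|all_N|U [irrU sUK UN0]] := irreducible_between hred mN reduced_submodule.
- by move=> u Nu T redT; apply: (red_largest redT) => //; apply: largest_sub.
- by apply: Nv; apply: all_N => T redT; apply: (red_largest redT).
have [k lek iso_U] := reduced_simple_exceptional n2 irrU sUK UN0.
exact: (hexc U irrU k lek iso_U).
Qed.

(** Split [a] into homogeneous summands: those of degree 0 preserve [N], in which [M'] is contained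
    by assumption, and those of positive degree act by 0. *)
Lemma rho_submodule_sigma_stable :
    (forall v, M' v -> N v) ->
    (forall y v, toroidal_ge X 1 y -> sigma y v = 0) ->
  forall a v, toroidal_ge X 0 a -> M' v -> M' (sigma a v).
Proof.
move=> sM'N hsigma a v [l [l0 ->]] M'v.
have ge_sum (l' : seq (toroidal g n)) : {subset l' <= l} -> toroidal_ge X 0 (\sum_(u <- l') u).
  by move=> sub; exists l'; split=> // u /sub /l0.
have ge0 : toroidal_ge X 0 (0 : toroidal g n) by exists [::]; rewrite big_nil.
have : {subset l <= l} by [].
elim: {1 3}l => [|u l' IHl] sub.
  rewrite big_nil; have := sigma_linear (-1) v ge0 ge0.
  by rewrite scaler0 addr0 scaleN1r addNr => ->; apply: (subspace0 sM').
have sub' : {subset l' <= l} by move=> w l'w; apply: sub; rewrite inE l'w orbT.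
have [d d0 ud] := l0 u (sub u (mem_head _ _)).
rewrite big_cons -[u in u + _]scale1r sigma_linear; last exact: ge_sum.
  rewrite scale1r; apply: (subspaceD sM'); last exact: IHl.
  have [d0'|d1] := eqVneq d 0.
    by apply/largest_sub/largest_sigma; [rewrite -d0'|apply: sM'N].
  rewrite hsigma; first exact: (subspace0 sM').
  by apply: toroidal_ge_deg ud; lia.
exact: toroidal_ge_deg ud.
Qed.

End AnLModules.

Unset Implicit Arguments.
Local Open Scope complex_scope.

Theorem theorem4p8 (R : realType) (g : vectType R[i]) (brg : g -> g -> g)
    (hg : is_simple_lie brg)
    (n : nat) (hn : (2 <= n)%N) (X : cartan_type n)
    (M : lmodType R[i]) (act : {mpoly R[i][n]} -> {linear M -> M})
    (rho sigma : toroidal g n -> {linear M -> M})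
    (hM : AnL_module brg X act rho sigma)
    (hsigma : forall (y : toroidal g n) (v : M), toroidal_ge X 1 y -> sigma y v = 0)
    (hred : completely_reducible (toroidal_deg X 0) sigma)
    (hexc : forall U : M -> Prop,
      irreducible_submodule (toroidal_deg X 0) sigma U ->
      forall k : nat, (k <= rankX X)%N ->
      ~ isomorphic_to_exceptional X sigma U k)
    (M' : M -> Prop) (hM' : submodule (in_toroidal X) rho M') :
  (forall (f : {mpoly R[i][n]}) (v : M), M' v -> M' (act f v)) /\
  (forall (a : toroidal g n) (v : M), toroidal_ge X 0 a -> M' v -> M' (sigma a v)).
Proof.
have M'N := rho_submodule_act_stable hM hM' hn hred hexc.
split=> [f v M'v|]; first exact: M'N.
exact: (rho_submodule_sigma_stable hM hM' M'N hsigma).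
Qed.
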